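(* Let $m>2$ be an integer, and let $e_1$ denote the first standard basis vector of $\mathbb{R}^m$. Let $\varepsilon>0$ and $C>0$. Then there exists smooth initial data $f:\mathbb{R}\to S^{m-1}\subset\mathbb{R}^m$ such that $f-e_1$ is supported on $[-C,C]$ and $\|f-e_1\|_{C_0^\infty}\lesssim\varepsilon$ (that is, $\sup_{x}|\partial_x^k(f-e_1)(x)|\le A_k\,\varepsilon$ for every integer $k\ge 0$, where the constants $A_k$ do not depend on $\varepsilon$), and such that the global smooth solution $\phi:\mathbb{R}^{1+1}\to S^{m-1}$ of the wave map Cauchy problem $$-\phi_{tt}+\phi_{xx}+\phi\,\bigl(|\phi_x|^2-|\phi_t|^2\bigr)=0,\qquad \phi(0,x)=f(x),\qquad \phi_t(0,x)=0$$ satisfies $$\|\phi(T)\|_{\dot H^{1/2}}\to\infty\quad\text{as }T\to\infty .$$ In particular, also $$\|\phi(T)\|_{\dot B^{1/2,1}_2}\to\infty\quad\text{as }T\to\infty .$$ In fact, these norms grow like $(\log T)^{1/2}$ and $\log T$ respectively: there are constants $0<c\le c'<\infty$ and $T_0>1$ (depending on $f$) such that for all $T\ge T_0$, $$c(\log T)^{1/2}\le\|\phi(T)\|_{\dot H^{1/2}}\le c'(\log T)^{1/2},\qquad c\log T\le\|\phi(T)\|_{\dot B^{1/2,1}_2}\le c'\log T .$$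
   Context: $S^{m-1}$ is the unit sphere in $\mathbb{R}^m$; $|\cdot|$ is the Euclidean norm on $\mathbb{R}^m$. We write $\phi(T)$ for the function $x\mapsto\phi(T,x)$. For smooth data $f:\mathbb{R}\to S^{m-1}$ and zero initial velocity, the Cauchy problem is known to have a unique global smooth solution, which takes values in $S^{m-1}$; this is ''the solution''. Norms (for functions of $x\in\mathbb{R}$ with values in $\mathbb{R}^m$): by convention constant functions have zero norm, i.e. the norms are computed after subtracting a constant such as $e_1$ (here $\phi(T)-e_1$ is smooth and compactly supported for every $T$, by finite speed of propagation). With $\hat g$ the Fourier transform of $g=\phi(T)-e_1$, $$\|\phi(T)\|_{\dot H^{1/2}}=\Bigl(\int_{\mathbb{R}}|\xi|\,|\hat g(\xi)|^2\,d\xi\Bigr)^{1/2},\qquad \|\phi(T)\|_{\dot B^{1/2,1}_2}=\sum_{j\in\mathbb{Z}}2^{j/2}\Bigl(\int_{2^j\le|\xi|<2^{j+1}}|\hat g(\xi)|^2\,d\xi\Bigr)^{1/2}.$$ *)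

(* Defs.v *)
From HB Require Import structures.
From mathcomp Require Import all_boot all_order all_algebra.
From mathcomp Require Import complex.
From mathcomp Require Import all_classical all_reals all_analysis.

Set Implicit Arguments.
Unset Strict Implicit.
Unset Printing Implicit Defensive.

Import Order.TTheory GRing.Theory Num.Theory.
Import numFieldNormedType.Exports.

Local Open Scope classical_set_scope.
Local Open Scope ring_scope.

(* The norm that the library puts on 'rV[R]_m is the sup norm; it is only used
   here through the topology it induces. *)
Definition enorm (R : realType) (m : nat) (v : 'rV[R]_m) : R :=
  Num.sqrt (\sum_(k < m) v 0 k ^+ 2).

Definition e1 (R : realType) (m : nat) : 'rV[R]_m :=
  \row_(k < m) ((k : nat) == 0%N)%:R.

Definition smooth_curve (R : realType) (m : nat) (f : R -> 'rV[R]_m) : Prop :=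
  forall (k : nat) (x : R), derivable (derive1n k f) x 1.

(* Points of R^{1+1} are pairs (t, x). *)
Definition dt (R : realType) (m : nat) (phi : R * R -> 'rV[R]_m) :
  R * R -> 'rV[R]_m := fun p => 'D_((1, 0) : R * R) phi p.

Definition dx (R : realType) (m : nat) (phi : R * R -> 'rV[R]_m) :
  R * R -> 'rV[R]_m := fun p => 'D_((0, 1) : R * R) phi p.

Fixpoint Ck (R : realType) (m n : nat) (phi : R * R -> 'rV[R]_m) : Prop :=
  if n is n'.+1 then
    [/\ continuous phi,
        forall p, derivable phi p ((1, 0) : R * R) /\
                  derivable phi p ((0, 1) : R * R),
        Ck n' (dt phi) & Ck n' (dx phi)]
  else continuous phi.

Definition smooth_field (R : realType) (m : nat) (phi : R * R -> 'rV[R]_m) :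
  Prop := forall n : nat, Ck n phi.

(* No constraint on the values of phi is imposed here. *)
Definition wave_map_solution (R : realType) (m : nat) (f : R -> 'rV[R]_m)
    (phi : R * R -> 'rV[R]_m) : Prop :=
  [/\ smooth_field phi,
      forall p, - dt (dt phi) p + dx (dx phi) p
        + (enorm (dx phi p) ^+ 2 - enorm (dt phi p) ^+ 2) *: phi p = 0,
      forall x, phi (0, x) = f x &
      forall x, dt phi (0, x) = 0].

(* Constants have norm zero by convention, so the norms of phi(T) are those of
   phi(T) - e_1. *)
Definition slice (R : realType) (m : nat) (phi : R * R -> 'rV[R]_m) (T : R) :
  R -> 'rV[R]_m := fun x => phi (T, x) - e1 R m.

(* Componentwise \int g(x) exp(- i x xi) dx. *)
Definition fourier (R : realType) (m : nat) (g : R -> 'rV[R]_m) (xi : R) :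
  'rV[R[i]]_m :=
  \row_(k < m)
    Complex (\int[lebesgue_measure]_x (g x 0 k * cos (x * xi)))
            (- \int[lebesgue_measure]_x (g x 0 k * sin (x * xi))).

Definition cnorm (R : realType) (m : nat) (v : 'rV[R[i]]_m) : R :=
  Num.sqrt (\sum_(k < m) (complex.Re (v 0 k) ^+ 2 + complex.Im (v 0 k) ^+ 2)).

(* Homogeneous H^{1/2} norm. *)
Definition hnorm (R : realType) (m : nat) (g : R -> 'rV[R]_m) : \bar R :=
  ((\int[lebesgue_measure]_xi (`|xi| * cnorm (fourier g xi) ^+ 2)%:E)
     `^ (2^-1)%R)%E.

(* Homogeneous Besov B^{1/2,1}_2 norm, with sharp dyadic cut-offs. *)
Definition bnorm (R : realType) (m : nat) (g : R -> 'rV[R]_m) : \bar R :=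
  (\esum_(j in [set: int])
     ((2 `^ (j%:~R / 2))%R%:E *
      (\int[lebesgue_measure]_(xi in
           [set xi : R | ((2 : R) ^ j <= `|xi| < (2 : R) ^ (j + 1))%R])
         (cnorm (fourier g xi) ^+ 2)%:E) `^ (2^-1)%R))%E.

(* Main.v *)
(* For the data [f], run once around a small circle of radius [k] through [e1],
   the wave map is equivariant: in coordinates adapted to the circle,
   phi = (k s(tau) cos theta, k s(tau) sin theta, w(tau)), where
   2 tau = sigma(x+t) - sigma(x-t), 2 theta = sigma(x+t) + sigma(x-t), sigma is
   the smooth angle running from 0 to 2 pi on [-C, C], and the polar motion
   (k s, w) is a pendulum, i.e. given by Jacobi elliptic functions. For
   |x| < t - C one has tau = theta = pi. As the pendulum of positive amplitude is
   slower than its linearization, at time pi it has not reached the opposite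
   point of the circle, so there phi is a constant e' different from e1, while
   phi = e1 for |x| > t + C.

   Hence phi(T) - e1 is a plateau of height h = e' - e1 on [-T, T] with two
   transition layers of fixed width. Its Fourier transform is
   2 h sin(T xi) / xi + O(1), is O(min(T, 1/|xi|, 1/xi^2)), and each of the about
   log T dyadic shells between 1/T and 1 contributes O(1) to both norms. Only
   the lower bound for H^(1/2) and the upper bound for B^(1/2,1) are proved
   directly: since each shell has bounded weight, the square of the first norm
   is at most a constant times the second, which yields the other two bounds.

   Uniqueness: the difference of two solutions solves a linear wave equation
   with bounded coefficients on every light cone, and integrating along null
   lines halves any bound of the form B exp(lambda |t|). *)
Require Import Defs.
From HB Require Import structures.
From mathcomp Require Import all_boot all_order all_algebra.
From mathcomp Require Import all_classical all_reals all_analysis.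
From mathcomp Require Import measurable_realfun.
From mathcomp Require Import ring lra.

Set Implicit Arguments.
Unset Strict Implicit.
Unset Printing Implicit Defensive.

Import Order.TTheory GRing.Theory Num.Theory.
Import numFieldNormedType.Exports.

Local Open Scope classical_set_scope.
Local Open Scope ring_scope.

(** * Smooth functions of one variable *)

(** In dimension 1+1 the wave map equation is conformally invariant: replacing each null coordinate
    by a function of itself turns solutions into solutions. The pair (tau, theta) is such a change
    of variables, applied to the map whose data at tau = 0 run around the circle at unit angular
    speed. This is why the problem reduces to an ordinary differential equation in tau and the
    solution is explicit for every amplitude [k] in (0, 1); taking [k] small only serves to make the
    data small.

    The plateau is a purely nonlinear effect. The linearised pendulum makes its half swing in time
    exactly pi, which would bring the inner region back to e1. All that is extracted from the
    elliptic functions is [s pi != -1], without any quantitative gap, because the growth constants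
    may depend on f.

    On the Fourier side, only bounds uniform in time for the solution and two space derivatives are
    needed. They are immediate, as every ingredient of the formula is a bounded function. *)

Section Derivatives.
Context {R : realType} {V : normedModType R}.
Implicit Types (f g : V -> R) (x v : V).

Lemma is_derive_add f g x v df dg :
  is_derive x v f df -> is_derive x v g dg ->
  is_derive x v (fun y => f y + g y) (df + dg).
Proof. by move=> hf hg; apply: is_deriveD. Qed.

Lemma is_derive_sub f g x v df dg :
  is_derive x v f df -> is_derive x v g dg ->
  is_derive x v (fun y => f y - g y) (df - dg).
Proof. by move=> hf hg; apply: is_deriveB. Qed.

Lemma is_derive_mul f g x v df dg :
  is_derive x v f df -> is_derive x v g dg ->
  is_derive x v (fun y => f y * g y) (f x * dg + g x * df).
Proof. by move=> hf hg; apply: is_deriveM. Qed.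

Lemma is_derive_constant (c : R) x v : is_derive x v (fun=> c) 0.
Proof. exact: is_derive_cst. Qed.

(** A directional derivative only sees the restriction to a line, so the chain rule on a normed
    space is inherited from the one-variable one. *)
Lemma is_derive_line f x v df :
  is_derive (0 : R) (1 : R) (fun h => f (h *: v + x)) df <-> is_derive x v f df.
Proof.
have E : 'D_1 (fun h : R => f (h *: v + x)) 0 = 'D_v f x.
  rewrite /derive; set g1 := fun h => h^-1 *: _; set g2 := fun h => h^-1 *: _.
  suff -> : g1 = g2 by [].
  by rewrite funeqE /g1 /g2 => h /=; rewrite addr0 scale0r add0r [_%:A]mulr1.
split=> -[Df Ef]; apply: DeriveDef.
- exact: (derivable1P f x v).2.
- exact: etrans (esym E) Ef.
- exact: (derivable1P f x v).1.
- exact: etrans E Ef.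
Qed.

Lemma is_derive_comp (h : R -> R) f x v dh df :
  is_derive (f x) 1 h dh -> is_derive x v f df ->
  is_derive x v (fun y => h (f y)) (dh * df).
Proof.
move=> hh /is_derive_line hf; apply/is_derive_line.
apply: (@is_derive1_comp _ h (fun s => f (s *: v + x))).
by rewrite scale0r add0r.
Qed.

Lemma is_derive_ext f g x v df :
  f =1 g -> is_derive x v f df -> is_derive x v g df.
Proof. by move=> /funext ->. Qed.

End Derivatives.

Section Smooth1.
Context {R : realType}.
Implicit Types (f g h : R -> R) (x y : R).

(** A finite order makes closure under each operation an induction on [n] over all functions at
    once. Order 0 asks nothing, not even continuity. *)
Fixpoint smoothn (n : nat) (h : R -> R) : Prop :=
  if n is n'.+1 then (forall x, derivable h x 1) /\ smoothn n' (derive1 h) else True.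

Definition smooth h := forall n, smoothn n h.

Lemma derive1_fun f g : (forall x, is_derive x (1 : R) f (g x)) -> derive1 f = g.
Proof.
by move=> H; apply/funext => x; rewrite derive1E; apply: derive_val.
Qed.

Lemma smoothnS n f g :
  (forall x, is_derive x (1 : R) f (g x)) -> smoothn n g -> smoothn n.+1 f.
Proof. by move=> H Sg; split=> [x|]; [case: (H x)|rewrite (derive1_fun H)]. Qed.

Lemma smoothn_is_derive n f x : smoothn n.+1 f -> is_derive x (1 : R) f (derive1 f x).
Proof. by case=> D _; rewrite derive1E; apply: derivableP. Qed.

Lemma smoothnW n f : smoothn n.+1 f -> smoothn n f.
Proof.
elim: n f => [//|n IH] f [D S]; split=> //; exact: IH.
Qed.

Lemma smoothn_cst n (c : R) : smoothn n (fun=> c).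
Proof.
elim: n c => [//|n IH] c; apply: (@smoothnS _ _ (fun=> 0)) => //.
Qed.

Lemma smoothn_id n : smoothn n id.
Proof.
case: n => [//|n]; apply: (@smoothnS _ _ (fun=> 1)) => //; exact: smoothn_cst.
Qed.

Lemma smoothnD n f g : smoothn n f -> smoothn n g ->
  smoothn n (fun x => f x + g x).
Proof.
elim: n f g => [//|n IH] f g Sf Sg.
have D x := is_derive_add (smoothn_is_derive x Sf) (smoothn_is_derive x Sg).
apply: (smoothnS D).
by apply: IH; [case: Sf|case: Sg].
Qed.

Lemma smoothnM n f g : smoothn n f -> smoothn n g ->
  smoothn n (fun x => f x * g x).
Proof.
elim: n f g => [//|n IH] f g Sf Sg.
have D x := is_derive_mul (smoothn_is_derive x Sf) (smoothn_is_derive x Sg).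
apply: (smoothnS D).
by apply: smoothnD; apply: IH; [exact: smoothnW|case: Sg|exact: smoothnW|case: Sf].
Qed.

Lemma smoothn_comp n f g : smoothn n f -> smoothn n g ->
  smoothn n (fun x => f (g x)).
Proof.
elim: n f g => [//|n IH] f g Sf Sg.
have D x := is_derive_comp (smoothn_is_derive (g x) Sf) (smoothn_is_derive x Sg).
apply: (smoothnS D).
by apply: smoothnM; [apply: IH; [case: Sf|exact: smoothnW]|case: Sg].
Qed.

(** The derivative of 1/f is a polynomial in 1/f and f', so the induction can keep [f] fixed. *)
Lemma smoothnV n f : (forall x, f x != 0) -> smoothn n f ->
  smoothn n (fun x => (f x)^-1).
Proof.
move=> f0; elim: n => [//|n IH] Sf.
apply: (@smoothnS _ _ (fun x => - 1 * ((f x)^-1 * (f x)^-1) * (derive1 f) x)).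
  move=> x; apply: is_derive_eq.
    exact: (@is_deriveV _ f x (derive1 f x) 1 (f0 x) (smoothn_is_derive x Sf)).
  by rewrite /GRing.scale /= mulN1r -exprVn expr2.
apply: smoothnM; last by case: Sf.
apply: smoothnM; first exact: smoothn_cst.
by have S := IH (smoothnW Sf); apply: smoothnM.
Qed.

Lemma smoothn_sin_cos n : smoothn n (@sin R) /\ smoothn n (@cos R).
Proof.
elim: n => [//|n [Ss Sc]]; split.
  by apply: smoothnS Sc => x; apply: is_derive_sin.
apply: (@smoothnS _ _ (fun x => - 1 * sin x)).
  by move=> x; rewrite mulN1r; apply: is_derive_cos.
by apply: smoothnM => //; exact: smoothn_cst.
Qed.

Lemma smooth_derive f : smooth f -> smooth (derive1 f).
Proof. by move=> S n; case: (S n.+1). Qed.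

Lemma smooth_is_derive f x : smooth f -> is_derive x (1 : R) f (derive1 f x).
Proof. by move=> S; apply: (@smoothn_is_derive 0). Qed.

Lemma smooth_continuous f : smooth f -> continuous f.
Proof.
move=> S x; apply/differentiable_continuous/derivable1_diffP.
by case: (S 1%N).
Qed.

Lemma smooth_derive1n f n : smooth f -> smooth (derive1n n f).
Proof.
elim: n f => [|n IH] f S; first by rewrite derive1n0.
by rewrite derive1Sn; apply: IH; exact: smooth_derive.
Qed.

End Smooth1.

(** * A smooth step function built from exp(-1/x) *)

Section Step.
Context {R : realType}.
Implicit Types x y : R.

(** The powers of [x^-1] close the family under differentiation, so one induction over all [j] gives
    smoothness. *)
Definition flat (j : nat) x : R :=
  if 0 < x then x^-1 ^+ j * expR (- x^-1) else 0.

Lemma is_derive_exprn (f : R -> R) x df n : is_derive x (1:R) f df ->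
  is_derive x (1:R) (fun y => f y ^+ n) (n%:R * f x ^+ n.-1 * df).
Proof.
move=> H; elim: n => [|n IH].
  by rewrite !mul0r; apply: is_derive_ext (is_derive_constant 1 x 1) => y.
apply: (@is_derive_eq _ _ _ _ _ _ _ (f x * (n%:R * f x ^+ n.-1 * df) + f x ^+ n * df)).
  by apply: is_derive_ext (is_derive_mul H IH) => y; rewrite exprS.
by case: n {IH} => [|n]; rewrite ?expr0 /= -?natr1 ?exprS; ring.
Qed.

Lemma flat_le0 j x : x <= 0 -> flat j x = 0.
Proof. by move=> x0; rewrite /flat ltNge x0. Qed.

Lemma flat_gt0 j x : 0 < x -> 0 < flat j x.
Proof. by move=> x0; rewrite /flat x0 mulr_gt0 ?expR_gt0// exprn_gt0// invr_gt0. Qed.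

Lemma flat_ge0 j x : 0 <= flat j x.
Proof. by case: (leP x 0) => [/flat_le0 ->//|/flat_gt0 /ltW]. Qed.

(** It exhibits [flat j.+1] as the difference quotient of [flat j] at 0, which is what the
    Caratheodory criterion asks for. *)
Lemma flatS j x : flat j x = flat j.+1 x * x.
Proof.
rewrite /flat; case: ifP => x0; last by rewrite mul0r.
by rewrite exprS mulrAC [x^-1 * _ * x]mulrAC mulVf ?mul1r ?gt_eqF.
Qed.

(** The exponential at [x^-1] dominates its Taylor term of degree [j.+1], one power more than is
    needed to cancel [x^-1 ^+ j]. *)
Lemma flat_le j x : flat j x <= (j.+1)`!%:R * `|x|.
Proof.
case: (leP x 0) => x0; first by rewrite flat_le0// mulr_ge0.
rewrite gtr0_norm// /flat x0 expRN ler_pdivrMr ?expR_gt0//.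
have y0 : 0 <= x^-1 by rewrite invr_ge0 ltW.
have H := expR_ge1Dxn j y0.
have {}H : x^-1 ^+ j.+1 <= (j.+1)`!%:R * expR x^-1.
  rewrite -ler_pdivrMl ?ltr0n ?fact_gt0// mulrC.
  by apply: le_trans H; rewrite lerDr.
rewrite mulrAC -ler_pdivrMr//; apply: le_trans H.
by rewrite exprSr.
Qed.

Lemma flat_continuous0 j : {for 0, continuous (flat j)}.
Proof.
rewrite /prop_for /continuous_at flat_le0//.
apply/cvgrPdist_le => e e0.
have d0 : 0 < (j.+1)`!%:R^-1 * e by rewrite mulr_gt0// invr_gt0 ltr0n fact_gt0.
apply: filterS (@nbhs0_le R R^o _ d0) => z zd.
rewrite sub0r normrN ger0_norm ?flat_ge0//.
apply: (le_trans (flat_le j z)).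
by rewrite -ler_pdivlMl ?ltr0n ?fact_gt0.
Qed.

Lemma is_derive_flat j x :
  is_derive x (1 : R) (flat j) (flat j.+2 x - j%:R * flat j.+1 x).
Proof.
have [x0|x0|->] := ltgtP x 0.
- rewrite !flat_le0 ?ltW// mulr0 subr0.
  apply: (near_eq_is_derive _ (is_derive_constant 0 x 1)).
  by near=> z; rewrite flat_le0// ltW//; near: z; exact: lt_nbhsl.
- have xn0 : x != 0 by rewrite gt_eqF.
  have dV : is_derive x (1:R) (fun z : R => z^-1) (- x ^- 2).
    apply: is_derive_eq; first exact: (@is_deriveV _ id x 1 1).
    by rewrite /GRing.scale /= mulr1.
  have D : is_derive x (1:R) (fun z => z^-1 ^+ j * expR (- z^-1))
      (flat j.+2 x - j%:R * flat j.+1 x).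
    have dN : is_derive x (1:R) (fun z : R => - z^-1) (- - x ^- 2).
      exact: is_deriveN.
    have dE := @is_derive_comp R R expR (fun z : R => - z^-1) x 1 _ _ (is_derive_expR _) dN.
    apply: is_derive_eq; first exact: is_derive_mul (is_derive_exprn j dV) dE.
    rewrite /flat x0 /GRing.scale /=.
    case: j => [|j]; first by rewrite expr0 !mul0r mulr0 -exprVn; ring.
    by rewrite succnK -exprVn !exprS; ring.
  apply: near_eq_is_derive D.
  by near=> z; rewrite /flat ifT//; near: z; exact: lt_nbhsr.
- rewrite !flat_le0// mulr0 subr0.
  apply/is_derive1_caratheodory; exists (flat j.+1); split.
  + by move=> z; rewrite [flat j 0]flat_le0// !subr0 flatS.
  + exact: flat_continuous0.
  + exact: flat_le0.
Unshelve. all: by end_near. Qed.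

Lemma smoothn_flat n j : smoothn n (flat j).
Proof.
elim: n j => [//|n IH] j.
apply: (@smoothnS _ _ _ (fun x => flat j.+2 x + - j%:R * flat j.+1 x)).
  by move=> x; rewrite mulNr; exact: is_derive_flat.
by apply: smoothnD => //; apply: smoothnM => //; exact: smoothn_cst.
Qed.

Definition step (C x : R) : R :=
  flat 0 (C + x) * (flat 0 (C + x) + flat 0 (C + - 1 * x))^-1.

(** At every point, one of [C + x] and [C - x] is positive. *)
Lemma step_denom (C x : R) : 0 < C -> 0 < flat 0 (C + x) + flat 0 (C + - 1 * x).
Proof.
move=> C0; have [x0|x0] := leP x 0.
  by rewrite ltr_wpDl ?flat_ge0// flat_gt0//; lra.
by rewrite ltr_wpDr ?flat_ge0// flat_gt0//; lra.
Qed.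

Lemma step_smooth (C : R) : 0 < C -> smooth (step C).
Proof.
move=> C0 n.
have aff (a b : R) : smoothn n (fun x => a + b * x).
  apply: smoothnD; first exact: smoothn_cst.
  by apply: smoothnM; [exact: smoothn_cst|exact: smoothn_id].
have S1 : smoothn n (fun x => flat 0 (C + x)).
  apply: smoothn_comp; first exact: smoothn_flat.
  by apply: smoothnD; [exact: smoothn_cst|exact: smoothn_id].
have S2 : smoothn n (fun x => flat 0 (C + -1 * x)).
  by apply: smoothn_comp => //; exact: smoothn_flat.
apply: smoothnM => //; apply: smoothnV; last exact: smoothnD.
by move=> x; rewrite gt_eqF// step_denom.
Qed.

Lemma step_left (C x : R) : x <= - C -> step C x = 0.
Proof. by move=> xC; rewrite /step flat_le0 ?mul0r//; lra. Qed.

Lemma step_right (C x : R) : 0 < C -> C <= x -> step C x = 1.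
Proof.
move=> C0 xC; have := step_denom x C0; rewrite /step.
rewrite [flat 0 (C + - 1 * x)]flat_le0 ?addr0; last by lra.
by move=> H; rewrite mulfV// gt_eqF.
Qed.

End Step.

(** * Derivative bounds for functions that are constant outside a segment *)

Section CompactSupport.
Context {R : realType}.

Lemma continuous_segment_bounded (f : R -> R) (a b : R) :
  continuous f -> exists M : R, 0 <= M /\ forall x : R, a <= x <= b -> `|f x| <= M.
Proof.
move=> cf; have [ab|ab] := leP a b; last first.
  by exists 0; split=> // x /andP[h1 h2]; move: (le_trans h1 h2); rewrite leNgt ab.
have cn : {within `[a, b], continuous (fun x => `|f x|)}.
  apply: continuous_subspaceT => x.
  by apply: continuous_comp; [exact: cf|exact: norm_continuous].
have [c _ H] := EVT_max ab cn.
by exists `|f c|; split=> // x xab; apply: H; rewrite in_itv.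
Qed.

(** The strict inequality makes the half-line open, so [f] is constant near each of its points. *)
Lemma derive1n_cst_gt (f : R -> R) (a c : R) n :
  (forall y, a < y -> f y = c) -> forall y, a < y -> derive1n n.+1 f y = 0.
Proof.
move=> H; rewrite derive1Sn => y ya.
have : forall y, a < y -> derive1 f y = 0.
  move=> z za; rewrite derive1E (near_eq_derive (g := fun=> c)).
    by rewrite derive_cst.
  near=> t; apply: H; near: t; exact: lt_nbhsr.
move: (derive1 f) => g; elim: n y ya g => [|n IH] y ya g G.
  by rewrite derive1n0 G.
rewrite derive1Sn; apply: IH => // z za.
rewrite derive1E (near_eq_derive (g := fun=> 0)); first by rewrite derive_cst.
near=> t; apply: G; near: t; exact: lt_nbhsr.
Unshelve. all: by end_near. Qed.

Lemma derive1n_cst_lt (f : R -> R) (a c : R) n :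
  (forall y, y < a -> f y = c) -> forall y, y < a -> derive1n n.+1 f y = 0.
Proof.
move=> H; rewrite derive1Sn => y ya.
have : forall y, y < a -> derive1 f y = 0.
  move=> z za; rewrite derive1E (near_eq_derive (g := fun=> c)).
    by rewrite derive_cst.
  near=> t; apply: H; near: t; exact: lt_nbhsl.
move: (derive1 f) => g; elim: n y ya g => [|n IH] y ya g G.
  by rewrite derive1n0 G.
rewrite derive1Sn; apply: IH => // z za.
rewrite derive1E (near_eq_derive (g := fun=> 0)); first by rewrite derive_cst.
near=> t; apply: G; near: t; exact: lt_nbhsl.
Unshelve. all: by end_near. Qed.

Lemma smooth_eventually_cst_bounded (f : R -> R) (C c c' : R) :
  smooth f -> (forall y : R, y <= - C -> f y = c) -> (forall y : R, C <= y -> f y = c') ->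
  exists A : nat -> R, forall n x, 0 <= A n /\ `|(derive1n n f x : R)| <= A n.
Proof.
move=> Sf fl fr.
have H n : exists M : R, forall x : R, 0 <= M /\ `|(derive1n n f x : R)| <= M.
  have Sn := smooth_derive1n n Sf.
  have [M [M0 HM]] := @continuous_segment_bounded _ (- C) C (smooth_continuous Sn).
  have a0 : 0 <= `|c| by []. have b0 : 0 <= `|c'| by [].
  (* The last two terms serve order 0 outside the segment; all higher derivatives vanish there. *)
  exists (M + `|c| + `|c'|) => x; split; first by rewrite !addr_ge0.
  have [xC|xC] := ltP x (- C).
    case: n Sn HM => [|n] Sn HM.
      by rewrite derive1n0 (fl _ (ltW xC)) addrAC lerDr addr_ge0.
    rewrite (derive1n_cst_lt (a := - C) (c := c))//.
      by rewrite normr0 !addr_ge0.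
    by move=> y /ltW /fl.
  have [Cx|Cx] := ltP C x.
    case: n Sn HM => [|n] Sn HM.
      by rewrite derive1n0 (fr _ (ltW Cx)) lerDr addr_ge0.
    rewrite (derive1n_cst_gt (a := C) (c := c'))//.
      by rewrite normr0 !addr_ge0.
    by move=> y /ltW /fr.
  have := HM x; rewrite xC Cx => /(_ isT) Hx.
  by rewrite -addrA (le_trans Hx)// lerDl addr_ge0.
by have [A HA] := choice H; exists A => n x; exact: HA.
Qed.

End CompactSupport.

(** * Jacobi elliptic functions *)

Section Primitive.
Context {R : realType}.
Local Notation mu := (@lebesgue_measure R).

Lemma is_derive_continuous (f df : R -> R) :
  (forall x : R, is_derive x (1 : R) f (df x)) -> continuous f.
Proof.
move=> H x; apply/differentiable_continuous/derivable1_diffP.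
by case: (H x).
Qed.

Lemma mean_value (f df : R -> R) (a b : R) : a < b ->
  (forall x : R, a <= x <= b -> is_derive x (1 : R) f (df x)) ->
  exists2 c : R, a < c < b & f b - f a = df c * (b - a).
Proof.
move=> ab H; have [|/=|c /[!in_itv]/= cab E] := @MVT R f df a b ab.
- by move=> x /[!in_itv]/= /andP[/ltW h1 /ltW h2]; apply: H; rewrite h1 h2.
- apply: derivable_within_continuous => x /[!in_itv]/= xab.
  by case: (H x xab).
- by exists c.
Qed.

(** The fundamental theorem gives a primitive to the right of each [- n]. Normalised to vanish at 0,
    these agree on overlaps and are glued by letting [n] depend on the point. *)
Lemma continuous_has_primitive (f : R -> R) : continuous f ->
  exists F : R -> R, F 0 = 0 /\ forall x : R, is_derive x (1 : R) F (f x).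
Proof.
move=> cf.
pose G0 (n : nat) (x : R) := (\int[mu]_(t in `[- n%:R, x]) f t)%R.
pose G n x := G0 n x - G0 n 0.
have dG (n : nat) (x : R) : - n%:R < x -> is_derive x (1 : R) (G n) (f x).
  move=> nx; have x1 : x < x + 1 by rewrite ltrDl.
  have [||D E] := @continuous_FTC1_closed R f (- n%:R) x _ x1 _ nx.
  - apply: continuous_compact_integrable; first exact: segment_compact.
    exact: continuous_subspaceT.
  - exact: cf.
  - rewrite -[f x]subr0 -E derive1E; apply: is_derive_sub.
    exact: derivableP.
have Gn (n m : nat) (x : R) : (0 < n)%N -> (0 < m)%N -> - n%:R < x -> - m%:R < x ->
    G n x = G m x.
  move=> n0 m0 nx mx.
  have n0' : - n%:R < 0 :> R by rewrite oppr_lt0 ltr0n.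
  have m0' : - m%:R < 0 :> R by rewrite oppr_lt0 ltr0n.
  have E0 : G n 0 - G m 0 = 0 by rewrite /G !subrr.
  have D (z : R) : - n%:R < z -> - m%:R < z ->
      is_derive z (1 : R) (fun z : R => G n z - G m z) ((fun=> 0) z).
    by move=> nz mz; rewrite -[X in is_derive _ _ _ X](subrr (f z));
      apply: is_derive_sub; exact: dG.
  apply/eqP; rewrite -subr_eq0; apply/eqP.
  have [x0|x0|->//] := ltgtP x 0.
    have [z /andP[h1 h2]|c _] := mean_value x0
        (f := fun z => G n z - G m z) (df := fun=> 0).
      by apply: D; apply: lt_le_trans h1.
    by rewrite mul0r E0 sub0r => /eqP; rewrite oppr_eq0 => /eqP.
  have [z /andP[h1 h2]|c _] := mean_value x0
        (f := fun z => G n z - G m z) (df := fun=> 0).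
    by apply: D; apply: lt_le_trans h1.
  by rewrite mul0r E0 subr0.
(* The margin 1 keeps the base point chosen for [x] to the left of all points near [x] as well. *)
have bd (x : R) : - (Num.bound x).+1%:R < x - 1.
  rewrite -addn1 natrD opprD ltrD2r.
  have := ler_norm (- x); rewrite normrN.
  have := archi_boundP (normr_ge0 x); rewrite /Num.bound normr_id => h1 h2.
  by rewrite ltrNl (le_lt_trans h2).
exists (fun x => G (Num.bound x).+1 x); split; first by rewrite /G subrr.
move=> x; apply: near_eq_is_derive (dG (Num.bound x).+1 x _); last first.
  by apply: lt_trans (bd x) _; rewrite ltrBlDr ltrDl.
near=> y; apply: Gn => //.
  by apply: lt_trans (bd x) _; near: y; apply: lt_nbhsr; rewrite ltrBlDr ltrDl.
by apply: lt_trans (bd y) _; rewrite ltrBlDr ltrDl.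
Unshelve. all: by end_near. Qed.

End Primitive.

Section Jacobi.
Context {R : realType}.

(* With [k] the modulus, [s], [c], [w] are the Jacobi functions [sn], [cn],
   [dn] with the argument shifted by a quarter period. They are obtained from
   the amplitude [psi], the inverse of an incomplete elliptic integral. *)
Lemma jacobi_functions (k : R) : 0 < k < 1 ->
  exists s c w : R -> R,
   [/\ forall t : R, [/\ is_derive t (1 : R) s (c t * w t),
         is_derive t (1 : R) c (- (s t * w t)) &
         is_derive t (1 : R) w (- (k ^+ 2 * s t * c t))],
       forall t, s t ^+ 2 + c t ^+ 2 = 1,
       forall t, w t ^+ 2 = 1 - k ^+ 2 * s t ^+ 2 &
       [/\ forall t, 0 < w t, s 0 = 1, c 0 = 0 & s pi != -1]].
Proof.
move=> /andP[k0 k1].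
have k21 : k ^+ 2 < 1 by rewrite expr_lt1// ltW.
pose D (x : R) := 1 - k ^+ 2 * sin x ^+ 2.
pose W (x : R) := Num.sqrt (D x).
have s2le (x : R) : sin x ^+ 2 <= 1.
  by rewrite -(cos2Dsin2 x) lerDr sqr_ge0.
have D0 (x : R) : 0 < D x.
  rewrite subr_gt0 (le_lt_trans _ k21)// ler_piMr ?sqr_ge0//.
have W0 (x : R) : 0 < W x by rewrite sqrtr_gt0.
have W1 (x : R) : W x <= 1.
  rewrite -sqrtr1 ler_wsqrtr// /D lerBlDr lerDl mulr_ge0 ?sqr_ge0//.
have W2 (x : R) : W x ^+ 2 = D x by rewrite sqr_sqrtr// ltW.
have dD (x : R) : is_derive x (1 : R) D (- (k ^+ 2 * (2 * sin x * cos x))).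
  apply: (is_derive_eq (is_derive_sub (is_derive_constant 1 x 1)
      (is_derive_mul (is_derive_constant (k ^+ 2) x 1)
        (is_derive_exprn 2 (is_derive_sin x))))).
  rewrite /=; ring.
have dW (x : R) : is_derive x (1 : R) W (- (k ^+ 2 * sin x * cos x) / W x).
  apply: (is_derive_eq (is_derive_comp (is_derive1_sqrt (D0 x)) (dD x))).
  rewrite -/(W x); have := W0 x; move/lt0r_neq0 => h; field.
  exact: h.
have cV : continuous (fun x => (W x)^-1).
  move=> x; apply: continuousV; first exact: lt0r_neq0.
  exact: (is_derive_continuous dW).
(* [F] is the incomplete elliptic integral of the first kind. Its integrand is at least 1, which
   makes [F] injective and onto. *)
have [F [F0 dF]] := continuous_has_primitive cV.
have cF := is_derive_continuous dF.
have Fge (x y : R) : x < y -> y - x <= F y - F x.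
  move=> xy; have [c _ ->] := mean_value xy (fun z _ => dF z).
  by rewrite ler_peMl ?subr_ge0 ?(ltW xy)//= invf_ge1.
have Fmono (x y : R) : x < y -> F x < F y.
  by move=> xy; have := Fge _ _ xy; lra.
have Finj : injective F.
  move=> x y E; have [/Fmono|/Fmono|//] := ltgtP x y; by rewrite E ltxx.
(* The shift is the quarter period: the inverse [psi] starts at [pi / 2], with the pendulum at rest
   in its extreme position. *)
have Fsurj (t : R) : exists x, F x = t + F (pi / 2).
  set v := t + F (pi / 2); pose a : R := `|v| + 1.
  have a0 : 0 < a by rewrite ltr_wpDl.
  have h1 : v <= F a.
    have := Fge _ _ a0; rewrite F0 !subr0; apply: le_trans.
    by rewrite /a (le_trans (ler_norm _))// lerDl.
  have h2 : F (- a) <= v.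
    have na0 : - a < 0 by rewrite oppr_lt0.
    have := Fge _ _ na0; rewrite F0 !sub0r opprK => h.
    have := ler_norm (- v); rewrite normrN /a in h *; lra.
  have [|||c _ Ec] := @IVT R F (- a) a v; last by exists c.
  - by lra.
  - exact: continuous_subspaceT.
  - by rewrite ge_min h2 /= le_max h1 orbT.
have [psi Fpsi] := choice Fsurj.
have psiF (x : R) : psi (F x - F (pi / 2)) = x.
  by apply: Finj; rewrite Fpsi subrK.
have dpsi (t : R) : is_derive t (1 : R) psi (W (psi t)).
  have -> : t = F (psi t) - F (pi / 2) by rewrite Fpsi addrK.
  rewrite psiF -[W _]invrK.
  apply: (@is_derive_inverse R (fun x => F x - F (pi / 2)) psi).
  - by near=> z; exact: psiF.
  - near=> z; apply: continuousB; first exact: cF.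
    exact: cst_continuous.
  - rewrite -[X in is_derive _ _ _ X]subr0; exact: is_derive_sub (dF _) _.
  - by rewrite invr_eq0 gt_eqF.
have psi0 : psi 0 = pi / 2 by rewrite -(psiF (pi / 2)) subrr.
exists (fun t => sin (psi t)), (fun t => cos (psi t)), (fun t => W (psi t)); split.
- move=> t; split.
  + exact: is_derive_comp (is_derive_sin _) (dpsi t).
  + rewrite -mulNr; exact: is_derive_comp (is_derive_cos _) (dpsi t).
  + apply: (is_derive_eq (is_derive_comp (dW _) (dpsi t))).
    by rewrite mulfVK// gt_eqF.
- by move=> t; rewrite addrC cos2Dsin2.
- by move=> t; rewrite W2.
- split=> //; [by rewrite psi0 sin_pihalf|by rewrite psi0 cos_pihalf|].
have pi0 : 0 < pi :> R := pi_gt0 R.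
have pi2 : 2 <= pi :> R := pi_ge2 R.
have Wmv (a b : R) : a < b ->
    exists2 c, a < c < b & psi b - psi a = W (psi c) * (b - a).
  by move=> ab; exact: mean_value ab (fun z _ => dpsi z).
have psi_gt (a b : R) : a < b -> psi a < psi b.
  move=> ab; have [c _ E] := Wmv _ _ ab.
  by rewrite -subr_gt0 E mulr_gt0// subr_gt0.
have psi_le (a b : R) : a < b -> psi b - psi a <= b - a.
  move=> ab; have [c _ ->] := Wmv _ _ ab.
  by rewrite ler_piMl// subr_ge0 ltW.
(* [W <= 1] alone gives only [psi pi <= pi / 2 + pi]. Between times 0 and 1 the sine of [psi] is
   positive, so there the speed is strictly below 1 and the delay is never made up. *)
have psi_lt1 : psi 1 < pi / 2 + 1.
  have [c /andP[c0 c1] E] := Wmv 0 1 ltr01.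
  have p1 := psi_gt _ _ c0; have p2 := psi_le _ _ c0.
  have sc : 0 < sin (psi c) by apply: sin_gt0_pi; rewrite psi0 in p1 p2; lra.
  have Wc : W (psi c) < 1.
    rewrite -sqrtr1 ltr_sqrt// /D ltrBlDr ltrDl mulr_gt0// exprn_gt0//.
  by rewrite psi0 in E; lra.
have psipi1 : psi pi < pi / 2 + pi.
  have : psi pi - psi 1 <= pi - 1 by apply: psi_le; lra.
  by lra.
have psipi2 : pi / 2 < psi pi by rewrite -psi0; exact: psi_gt.
(* The sine of [psi pi] is the cosine of this angle. On [[0, pi]] the cosine is injective, so the
   value -1 would force the angle to be pi, against [psipi1]. *)
have : psi pi - pi / 2 \in `[0, pi] by rewrite in_itv /=; lra.
move=> hy; apply/eqP => E.
have : cos (psi pi - pi / 2) = cos pi by rewrite cosBpihalf E cospi.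
move=> /(cos_inj hy); rewrite in_itv /= lexx pi_ge0 => /(_ isT) E'.
by lra.
Unshelve. all: by end_near. Qed.

End Jacobi.

(** * Smooth fields on the plane *)

Section Fields.
Context {R : realType}.
Implicit Types (g h : R * R -> R) (p : R * R).

Local Notation et := ((1, 0) : R * R).
Local Notation ex := ((0, 1) : R * R).

(** Scalar counterpart of [Ck]: algebra and composition are treated here and transferred to rows
    coordinate by coordinate. *)
Fixpoint Cks (n : nat) g : Prop :=
  if n is n'.+1 then
    [/\ continuous g, forall p, derivable g p et /\ derivable g p ex,
        Cks n' (fun p => 'D_et g p) & Cks n' (fun p => 'D_ex g p)]
  else continuous g.

Lemma Cks_continuous n g : Cks n g -> continuous g.
Proof. by case: n => [//|n] []. Qed.

Lemma CksS n g gt gx : continuous g ->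
  (forall p, is_derive p et g (gt p)) -> (forall p, is_derive p ex g (gx p)) ->
  Cks n gt -> Cks n gx -> Cks n.+1 g.
Proof.
move=> cg Ht Hx St Sx; split; first exact: cg.
- by move=> p; split; [case: (Ht p)|case: (Hx p)].
- have E : (fun p => 'D_et g p) = gt by apply/funext => p; case: (Ht p).
  by rewrite -E in St.
- have E : (fun p => 'D_ex g p) = gx by apply/funext => p; case: (Hx p).
  by rewrite -E in Sx.
Qed.

Lemma Cks_dt n g p : Cks n.+1 g -> is_derive p et g ('D_et g p).
Proof. by case=> _ D _ _; case: (D p) => ? _; apply: derivableP. Qed.

Lemma Cks_dx n g p : Cks n.+1 g -> is_derive p ex g ('D_ex g p).
Proof. by case=> _ D _ _; case: (D p) => _ ?; apply: derivableP. Qed.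

Lemma CksW n g : Cks n.+1 g -> Cks n g.
Proof.
elim: n g => [|n IH] g [cg D St Sx]; first exact: cg.
split.
- exact: cg.
- exact: D.
- exact: (IH _ St).
- exact: (IH _ Sx).
Qed.

Lemma Cks_cst n (c : R) : Cks n (fun=> c).
Proof.
elim: n c => [|n IH] c; first by move=> p; exact: cst_continuous.
apply: (@CksS n _ (fun=> 0) (fun=> 0)) => //; move=> p.
exact: cst_continuous.
Qed.

Lemma CksD n g h : Cks n g -> Cks n h -> Cks n (fun p => g p + h p).
Proof.
elim: n g h => [|n IH] g h Sg Sh.
  by move=> p; apply: cvgD; [exact: Sg|exact: Sh].
apply: (@CksS n _ (fun p => 'D_et g p + 'D_et h p) (fun p => 'D_ex g p + 'D_ex h p)).
- by move=> p; apply: cvgD; [apply: Cks_continuous Sg _|apply: Cks_continuous Sh _].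
- by move=> p; exact: is_derive_add (Cks_dt p Sg) (Cks_dt p Sh).
- by move=> p; exact: is_derive_add (Cks_dx p Sg) (Cks_dx p Sh).
- by apply: IH; [case: Sg|case: Sh].
- by apply: IH; [case: Sg|case: Sh].
Qed.

Lemma CksM n g h : Cks n g -> Cks n h -> Cks n (fun p => g p * h p).
Proof.
elim: n g h => [|n IH] g h Sg Sh.
  by move=> p; apply: cvgM; [exact: Sg|exact: Sh].
apply: (@CksS n _ (fun p => g p * 'D_et h p + h p * 'D_et g p)
                  (fun p => g p * 'D_ex h p + h p * 'D_ex g p)).
- by move=> p; apply: cvgM; [apply: Cks_continuous Sg _|apply: Cks_continuous Sh _].
- by move=> p; exact: is_derive_mul (Cks_dt p Sg) (Cks_dt p Sh).
- by move=> p; exact: is_derive_mul (Cks_dx p Sg) (Cks_dx p Sh).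
- have [Wg Wh] := (CksW Sg, CksW Sh); case: Sg Sh => _ _ ? _ [_ _ ? _].
  by apply: CksD; apply: IH.
- have [Wg Wh] := (CksW Sg, CksW Sh); case: Sg Sh => _ _ _ ? [_ _ _ ?].
  by apply: CksD; apply: IH.
Qed.

Lemma Cks_comp n (f : R -> R) g : smooth f -> Cks n g -> Cks n (fun p => f (g p)).
Proof.
elim: n f g => [|n IH] f g Sf Sg.
  by move=> p; apply: continuous_comp; [exact: Sg|exact: smooth_continuous].
have Sf' := smooth_derive Sf.
apply: (@CksS n _ (fun p => derive1 f (g p) * 'D_et g p)
                  (fun p => derive1 f (g p) * 'D_ex g p)).
- move=> p; apply: continuous_comp; last exact: smooth_continuous.
  exact: Cks_continuous Sg _.
- by move=> p; exact: is_derive_comp (smooth_is_derive _ Sf) (Cks_dt p Sg).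
- by move=> p; exact: is_derive_comp (smooth_is_derive _ Sf) (Cks_dx p Sg).
- by have Wg := CksW Sg; case: Sg => _ _ ? _; apply: CksM => //; apply: IH.
- by have Wg := CksW Sg; case: Sg => _ _ _ ?; apply: CksM => //; apply: IH.
Qed.

Lemma is_derive_affine (a b : R) p (v : R * R) :
  is_derive p v (fun q => a * q.1 + b * q.2) (a * v.1 + b * v.2).
Proof.
apply/is_derive_line.
have E : (fun h : R => a * (h *: v + p).1 + b * (h *: v + p).2) =
   (fun h : R => (a * p.1 + b * p.2) + (a * v.1 + b * v.2) * h).
  by apply/funext => h /=; rewrite /GRing.scale /=; ring.
rewrite E.
have H := is_derive_add (is_derive_constant (a * p.1 + b * p.2) (0 : R) 1)
  (is_derive_mul (is_derive_constant (a * v.1 + b * v.2) (0 : R) 1)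
     (is_derive_id (0 : R) (1 : R))).
by apply: (is_derive_eq H); rewrite /=; ring.
Qed.

Lemma Cks_affine n (a b : R) : Cks n (fun q => a * q.1 + b * q.2).
Proof.
have c0 : continuous (fun q : R * R => a * q.1 + b * q.2).
  move=> p; apply: cvgD; apply: cvgM.
  - exact: cvg_cst.
  - exact: cvg_fst.
  - exact: cvg_cst.
  - exact: cvg_snd.
case: n => [//|n].
by apply: (CksS c0 (fun p => is_derive_affine a b p et)
  (fun p => is_derive_affine a b p ex)); exact: Cks_cst.
Qed.

End Fields.

(** * Coordinates of vector fields, and rows supported on three entries *)

Section Rows.
Context {R : realType} {m : nat}.
Local Notation et := ((1, 0) : R * R).
Local Notation ex := ((0, 1) : R * R).

Lemma row_continuous (T : topologicalType) (F : T -> 'rV[R]_m) :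
  (forall k, continuous (fun p => F p 0 k)) -> continuous F.
Proof.
move=> H p; apply/cvgrPdist_le => /= e e0; near=> x.
rewrite /Num.Def.normr/= mx_normrE (bigmax_le _ (ltW e0))//= => i _.
rewrite !mxE/= ord1.
move: i; near: x; apply: filter_forall => /= i.
exact: ((cvgrPdist_le _ _).1 (H i.2 p)).
Unshelve. all: by end_near. Qed.

Lemma continuous_coord (T : topologicalType) (F : T -> 'rV[R]_m) k :
  continuous F -> continuous (fun p => F p 0 k).
Proof.
move=> H p; apply: (@continuous_comp _ _ _ F (fun M : 'rV[R]_m => M 0 k)).
  exact: H.
exact: coord_continuous.
Qed.

Lemma is_derive_row (V : normedModType R) (F : V -> 'rV[R]_m) (p v : V) dF :
  is_derive p v F dF <-> forall k, is_derive p v (fun q => F q 0 k) (dF 0 k).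
Proof.
split=> [[D <-] k|H].
  by apply: DeriveDef; [exact: ((derivable_mxP F p v).1 D 0 k)|rewrite (derive_mx D) mxE].
have D : derivable F p v by apply: (derivable_mxP F p v).2 => i j; rewrite ord1; case: (H j).
apply: DeriveDef; first exact: D.
rewrite (derive_mx D); apply/rowP => k; rewrite mxE.
by case: (H k).
Qed.

Lemma Cks_coord n (F : R * R -> 'rV[R]_m) k : Ck n F -> Cks n (fun p => F p 0 k).
Proof.
elim: n F => [|n IH] F; first exact: continuous_coord.
case=> cF D St Sx.
have Dt p := (is_derive_row F p et _).1 (derivableP (D p).1) k.
have Dx p := (is_derive_row F p ex _).1 (derivableP (D p).2) k.
by apply: (CksS _ Dt Dx (IH _ St) (IH _ Sx)); exact: continuous_coord.
Qed.

Lemma Ck_row n (F : R * R -> 'rV[R]_m) :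
  (forall k, Cks n (fun p => F p 0 k)) -> Ck n F.
Proof.
elim: n F => [|n IH] F H; first exact: row_continuous.
have Dt p : is_derive p et F (\row_k 'D_et (fun p => F p 0 k) p).
  apply: (is_derive_row F p et _).2 => k; rewrite mxE; exact: Cks_dt (H k).
have Dx p : is_derive p ex F (\row_k 'D_ex (fun p => F p 0 k) p).
  apply: (is_derive_row F p ex _).2 => k; rewrite mxE; exact: Cks_dx (H k).
split.
- by apply: row_continuous => k; exact: Cks_continuous (H k).
- by move=> p; split; [case: (Dt p)|case: (Dx p)].
- apply: IH => k.
  have -> : (fun p => dt F p 0 k) = (fun p => 'D_et (fun p => F p 0 k) p).
    by apply/funext => p; rewrite /dt; case: (Dt p) => _ ->; rewrite mxE.
  by case: (H k).
- apply: IH => k.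
  have -> : (fun p => dx F p 0 k) = (fun p => 'D_ex (fun p => F p 0 k) p).
    by apply/funext => p; rewrite /dx; case: (Dx p) => _ ->; rewrite mxE.
  by case: (H k).
Qed.

(** The whole construction takes place in a two-sphere inside the target. Entries beyond the third
    are the default 0 of [nth]. *)
Definition row3 (a b c : R) : 'rV[R]_m :=
  \row_(i < m) [:: a; b; c]`_i.

Lemma row3D a b c a' b' c' :
  row3 a b c + row3 a' b' c' = row3 (a + a') (b + b') (c + c').
Proof.
apply/rowP => -[[|[|[|i]]] hi]; rewrite !mxE//=.
by rewrite nth_nil addr0.
Qed.

Lemma row3Z x a b c : x *: row3 a b c = row3 (x * a) (x * b) (x * c).
Proof.
apply/rowP => -[[|[|[|i]]] hi]; rewrite !mxE//=.
by rewrite nth_nil mulr0.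
Qed.

Lemma row30 : row3 0 0 0 = 0.
Proof. by apply/rowP => -[[|[|[|i]]] hi]; rewrite !mxE//= nth_nil. Qed.

Lemma e1_row3 : e1 R m = row3 1 0 0.
Proof. by apply/rowP => -[[|[|[|i]]] hi]; rewrite !mxE//= nth_nil. Qed.

Lemma is_derive_row3 (V : normedModType R) (f g h : V -> R) (p v : V) df dg dh :
  is_derive p v f df -> is_derive p v g dg -> is_derive p v h dh ->
  is_derive p v (fun q => row3 (f q) (g q) (h q)) (row3 df dg dh).
Proof.
move=> Hf Hg Hh; apply/is_derive_row => -[[|[|[|i]]] hi]; rewrite mxE /=.
- by apply: is_derive_ext Hf => q; rewrite mxE.
- by apply: is_derive_ext Hg => q; rewrite mxE.
- by apply: is_derive_ext Hh => q; rewrite mxE.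
- by rewrite nth_nil; apply: is_derive_ext (is_derive_constant 0 p v) => q;
    rewrite mxE /= nth_nil.
Qed.

Lemma Ck_row3 n (f g h : R * R -> R) : Cks n f -> Cks n g -> Cks n h ->
  Ck n (fun q => row3 (f q) (g q) (h q)).
Proof.
move=> Sf Sg Sh; apply/Ck_row => -[[|[|[|i]]] hi].
- by rewrite (_ : (fun p => _) = f)//; apply/funext => p; rewrite mxE.
- by rewrite (_ : (fun p => _) = g)//; apply/funext => p; rewrite mxE.
- by rewrite (_ : (fun p => _) = h)//; apply/funext => p; rewrite mxE.
- rewrite (_ : (fun p => _) = (fun=> 0)); first exact: Cks_cst.
  by apply/funext => p; rewrite mxE /= nth_nil.
Qed.

Lemma derive1n_row3 n (f g h : R -> R) : smooth f -> smooth g -> smooth h ->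
  derive1n n (fun x => row3 (f x) (g x) (h x)) =
  (fun x => row3 (derive1n n f x) (derive1n n g x) (derive1n n h x)).
Proof.
elim: n f g h => [|n IH] f g h Sf Sg Sh; first by rewrite !derive1n0.
rewrite derive1Sn (_ : derive1 _ =
    (fun x => row3 (derive1 f x) (derive1 g x) (derive1 h x))).
  by rewrite IH ?derive1Sn//; exact: smooth_derive.
apply/funext => x; rewrite derive1E.
by case: (is_derive_row3 (smooth_is_derive x Sf)
  (smooth_is_derive x Sg) (smooth_is_derive x Sh)).
Qed.

Lemma smooth_curve_row3 (f g h : R -> R) : smooth f -> smooth g -> smooth h ->
  smooth_curve (fun x => row3 (f x) (g x) (h x)).
Proof.
move=> Sf Sg Sh k x; rewrite derive1n_row3//.
have S u : smooth u -> is_derive x (1 : R) (derive1n k u) (derive1 (derive1n k u) x).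
  by move=> Su; apply: smooth_is_derive; apply: smooth_derive1n.
by case: (is_derive_row3 (S _ Sf) (S _ Sg) (S _ Sh)).
Qed.

End Rows.

Section RowNorm.
Context {R : realType}.

Lemma enorm_row3 m (a b c : R) : (2 < m)%N ->
  enorm (@row3 R m a b c) = Num.sqrt (a ^+ 2 + b ^+ 2 + c ^+ 2).
Proof.
case: m => [//|[//|[//|m]]] _; rewrite /enorm !big_ord_recl !mxE /=.
rewrite big1 ?addr0 ?addrA// => i _; rewrite mxE /= nth_nil expr0n//.
Qed.

Lemma enorm_row3_le m (a b c : R) :
  enorm (@row3 R m a b c) <= `|a| + `|b| + `|c|.
Proof.
rewrite -[leRHS]ger0_norm ?addr_ge0// -sqrtr_sqr ler_wsqrtr//.
have le3 : a ^+ 2 + b ^+ 2 + c ^+ 2 <= (`|a| + `|b| + `|c|) ^+ 2.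
  rewrite -(real_normK (num_real a)) -(real_normK (num_real b)) -(real_normK (num_real c)).
  have [] : 0 <= `|a| * `|b| /\ 0 <= `|a| * `|c| by split; apply: mulr_ge0.
  have : 0 <= `|b| * `|c| by apply: mulr_ge0.
  rewrite !expr2; lra.
apply: le_trans le3.
(* For [m < 3] the row is truncated, and dropping squares keeps the bound. *)
case: m => [|[|[|m]]].
- by rewrite big_ord0 !addr_ge0 ?sqr_ge0.
- by rewrite big_ord1 mxE /= -addrA lerDl addr_ge0 ?sqr_ge0.
- by rewrite !big_ord_recl big_ord0 !mxE /= addr0 lerDl sqr_ge0.
- rewrite !big_ord_recl !mxE /= big1 ?addr0 ?addrA// => i _.
  by rewrite mxE /= nth_nil expr0n.
Qed.

End RowNorm.

(** * The explicit solution *)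

Section Bounded.
Context {R : realType} {T : Type}.
Implicit Types f g : T -> R.

Definition bounded_fct f := exists M : R, forall p, `|f p| <= M.

Lemma bounded_cst (c : R) : bounded_fct (fun=> c).
Proof. by exists `|c|. Qed.

Lemma bounded_add f g : bounded_fct f -> bounded_fct g ->
  bounded_fct (fun p => f p + g p).
Proof.
move=> [M HM] [N HN]; exists (M + N) => p.
by rewrite (le_trans (ler_normD _ _))// lerD.
Qed.

Lemma bounded_opp f : bounded_fct f -> bounded_fct (fun p => - f p).
Proof. by move=> [M HM]; exists M => p; rewrite normrN. Qed.

Lemma bounded_mul f g : bounded_fct f -> bounded_fct g ->
  bounded_fct (fun p => f p * g p).
Proof.
move=> [M HM] [N HN]; exists (M * N) => p.
by rewrite normrM ler_pM.
Qed.

End Bounded.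

(** * Derivatives of a rotating pendulum, in an arbitrary direction *)

Section RotatingField.
Context {R : realType}.
Variables (k ka : R) (S Cn W co si P Q A2 B2 : R * R -> R).

Let X q := k * (S q * co q).
Let Y q := k * (S q * si q).
(** The coordinates adapted to the circle are rotated in the plane of [X] and [W], so that the
    starting point [X = k], [W = ka] becomes e1 when [k ^+ 2 + ka ^+ 2 = 1]. *)
Definition rot0 q := k * X q + ka * W q.
Definition rot1 q := - ka * X q + k * W q.
Definition rot2 q := Y q.

(** [P] and [Q] stand for the derivatives of tau and theta in one direction. Exchanging their values
    passes from the time to the space direction, so one computation serves both. *)
Let DX q := k * (S q * (- (si q * Q q)) + co q * (Cn q * W q * P q)).
Let DY q := k * (S q * (co q * Q q) + si q * (Cn q * W q * P q)).
Let DW q := - (k ^+ 2 * S q * Cn q * P q).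
Definition drot0 q := k * DX q + ka * DW q.
Definition drot1 q := - ka * DX q + k * DW q.
Definition drot2 q := DY q.

(** [B2] and [A2] are the second derivatives of tau and theta. They are the same in time and in
    space, since tau and theta solve the free wave equation. *)
Let DDX q := k * (- S q * (co q * Q q ^+ 2 + si q * A2 q)
  - 2 * si q * Q q * (Cn q * W q * P q)
  + co q * (- S q * (W q ^+ 2 + k ^+ 2 * Cn q ^+ 2) * P q ^+ 2
            + Cn q * W q * B2 q)).
Let DDY q := k * (S q * (- si q * Q q ^+ 2 + co q * A2 q)
  + 2 * co q * Q q * (Cn q * W q * P q)
  + si q * (- S q * (W q ^+ 2 + k ^+ 2 * Cn q ^+ 2) * P q ^+ 2
            + Cn q * W q * B2 q)).
Let DDW q := - k ^+ 2 * (W q * (Cn q ^+ 2 - S q ^+ 2) * P q ^+ 2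
  + S q * Cn q * B2 q).
Definition ddrot0 q := k * DDX q + ka * DDW q.
Definition ddrot1 q := - ka * DDX q + k * DDW q.
Definition ddrot2 q := DDY q.

Section Direction.
Variables (p v : R * R).
Hypotheses (dS : is_derive p v S (Cn p * W p * P p))
  (dCn : is_derive p v Cn (- (S p * W p * P p)))
  (dW : is_derive p v W (- (k ^+ 2 * S p * Cn p * P p)))
  (dco : is_derive p v co (- (si p * Q p)))
  (dsi : is_derive p v si (co p * Q p))
  (dP : is_derive p v P (B2 p)) (dQ : is_derive p v Q (A2 p)).

Let dmulc (c : R) (f : R * R -> R) df : is_derive p v f df ->
  is_derive p v (fun q => c * f q) (c * df).
Proof.
move=> H; apply: (is_derive_eq (is_derive_mul (is_derive_constant c p v) H)).
by rewrite mulr0 addr0.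
Qed.

Let dopp (f : R * R -> R) df : is_derive p v f df ->
  is_derive p v (fun q => - f q) (- df).
Proof. by move=> H; exact: is_deriveN H. Qed.

Let dX : is_derive p v X (DX p).
Proof. exact: dmulc (is_derive_mul dS dco). Qed.

Let dY : is_derive p v Y (DY p).
Proof. exact: dmulc (is_derive_mul dS dsi). Qed.

Lemma is_derive_rot0 : is_derive p v rot0 (drot0 p).
Proof. exact: is_derive_add (dmulc k dX) (dmulc ka dW). Qed.

Lemma is_derive_rot1 : is_derive p v rot1 (drot1 p).
Proof. exact: is_derive_add (dmulc (- ka) dX) (dmulc k dW). Qed.

Lemma is_derive_rot2 : is_derive p v rot2 (drot2 p).
Proof. exact: dY. Qed.

Let dCWP := is_derive_mul (is_derive_mul dCn dW) dP.

Let ddX : is_derive p v DX (DDX p).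
Proof.
apply: (is_derive_eq (dmulc k (is_derive_add
  (is_derive_mul dS (dopp (is_derive_mul dsi dQ))) (is_derive_mul dco dCWP)))).
rewrite /DDX; ring.
Qed.

Let ddY : is_derive p v DY (DDY p).
Proof.
apply: (is_derive_eq (dmulc k (is_derive_add
  (is_derive_mul dS (is_derive_mul dco dQ)) (is_derive_mul dsi dCWP)))).
rewrite /DDY; ring.
Qed.

Let ddW : is_derive p v DW (DDW p).
Proof.
apply: (is_derive_eq (dopp (is_derive_mul
  (is_derive_mul (dmulc (k ^+ 2) dS) dCn) dP))).
rewrite /DDW; ring.
Qed.

Lemma is_derive_drot0 : is_derive p v drot0 (ddrot0 p).
Proof. exact: is_derive_add (dmulc k ddX) (dmulc ka ddW). Qed.

Lemma is_derive_drot1 : is_derive p v drot1 (ddrot1 p).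
Proof. exact: is_derive_add (dmulc (- ka) ddX) (dmulc k ddW). Qed.

Lemma is_derive_drot2 : is_derive p v drot2 (ddrot2 p).
Proof. exact: ddY. Qed.

End Direction.

Hypotheses (bS : bounded_fct S) (bCn : bounded_fct Cn) (bW : bounded_fct W)
  (bco : bounded_fct co) (bsi : bounded_fct si) (bP : bounded_fct P)
  (bQ : bounded_fct Q) (bA : bounded_fct A2) (bB : bounded_fct B2).

Ltac bnd := repeat first [assumption | exact: bounded_cst | apply: bounded_opp
  | apply: bounded_add | apply: bounded_mul].

Lemma bounded_rot : [/\ bounded_fct rot0, bounded_fct rot1 & bounded_fct rot2].
Proof. by split; rewrite /rot0 /rot1 /rot2 /X /Y; bnd. Qed.

Lemma bounded_drot : [/\ bounded_fct drot0, bounded_fct drot1 & bounded_fct drot2].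
Proof. by split; rewrite /drot0 /drot1 /drot2 /DX /DY /DW; bnd. Qed.

Lemma bounded_ddrot :
  [/\ bounded_fct ddrot0, bounded_fct ddrot1 & bounded_fct ddrot2].
Proof.
by split; rewrite /ddrot0 /ddrot1 /ddrot2 /DDX /DDY /DDW; bnd.
Qed.

End RotatingField.

Section RotatingFieldEquation.
Context {R : realType}.
Variables (k ka : R) (S Cn W co si A B A2 B2 : R * R -> R) (p : R * R).
Hypotheses (kka : k ^+ 2 + ka ^+ 2 = 1) (SC : S p ^+ 2 + Cn p ^+ 2 = 1)
  (WS : W p ^+ 2 = 1 - k ^+ 2 * S p ^+ 2) (cs : co p ^+ 2 + si p ^+ 2 = 1).

Lemma rot_norm : rot0 k ka S W co p ^+ 2 + rot1 k ka S W co p ^+ 2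
  + rot2 k S si p ^+ 2 = 1.
Proof.
rewrite /rot0 /rot1 /rot2.
have -> : (k * (k * (S p * co p)) + ka * W p) ^+ 2 +
    (- ka * (k * (S p * co p)) + k * W p) ^+ 2 + (k * (S p * si p)) ^+ 2 =
  (k ^+ 2 + ka ^+ 2) * ((k * (S p * co p)) ^+ 2 + W p ^+ 2) + (k * (S p * si p)) ^+ 2.
  by ring.
rewrite kka WS (_ : _ + _ = 1 + k ^+ 2 * S p ^+ 2 * (co p ^+ 2 + si p ^+ 2 - 1)).
  by rewrite cs subrr mulr0 addr0.
by ring.
Qed.

(** The rotation to e1 preserves norms, and the polar and angular motions are orthogonal. The polar
    speed simplifies because [W ^+ 2 + k ^+ 2 * S ^+ 2] is 1. *)
Lemma drot_norm P Q : drot0 k ka S Cn W co si P Q p ^+ 2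
    + drot1 k ka S Cn W co si P Q p ^+ 2
    + drot2 k S Cn W co si P Q p ^+ 2
  = k ^+ 2 * (Cn p ^+ 2 * P p ^+ 2 + S p ^+ 2 * Q p ^+ 2).
Proof.
rewrite /drot0 /drot1 /drot2.
set a := S p * _ + co p * _; set d := k ^+ 2 * S p * Cn p * P p.
set b := S p * (co p * _) + _.
have -> : (k * (k * a) + ka * - d) ^+ 2 + (- ka * (k * a) + k * - d) ^+ 2 +
    (k * b) ^+ 2 = (k ^+ 2 + ka ^+ 2) * (k ^+ 2 * a ^+ 2 + d ^+ 2) + k ^+ 2 * b ^+ 2.
  by ring.
rewrite kka mul1r.
have -> : k ^+ 2 * a ^+ 2 + d ^+ 2 + k ^+ 2 * b ^+ 2 =
   k ^+ 2 * ((co p ^+ 2 + si p ^+ 2) * (S p ^+ 2 * Q p ^+ 2) +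
     ((co p ^+ 2 + si p ^+ 2) * W p ^+ 2 + k ^+ 2 * S p ^+ 2) *
       (Cn p ^+ 2 * P p ^+ 2)).
  by rewrite /a /b /d; ring.
by rewrite cs WS; ring.
Qed.

(* The nonlinear term only sees [A^2 - B^2], which is also what survives of the
   second derivatives. *)
Let N := k ^+ 2 * (Cn p ^+ 2 * B p ^+ 2 + S p ^+ 2 * A p ^+ 2)
  - k ^+ 2 * (Cn p ^+ 2 * A p ^+ 2 + S p ^+ 2 * B p ^+ 2).

Let CnE : Cn p ^+ 2 = 1 - S p ^+ 2.
Proof. by rewrite -SC addrC addKr. Qed.

Lemma rot_equation :
  [/\ - ddrot0 k ka S Cn W co si A B A2 B2 p + ddrot0 k ka S Cn W co si B A A2 B2 p
        + N * rot0 k ka S W co p = 0,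
      - ddrot1 k ka S Cn W co si A B A2 B2 p + ddrot1 k ka S Cn W co si B A A2 B2 p
        + N * rot1 k ka S W co p = 0 &
      - ddrot2 k S Cn W co si A B A2 B2 p + ddrot2 k S Cn W co si B A A2 B2 p
        + N * rot2 k S si p = 0].
Proof.
by split; rewrite /ddrot0 /ddrot1 /ddrot2 /rot0 /rot1 /rot2 /N WS CnE; ring.
Qed.

End RotatingFieldEquation.

(** * The rotating pendulum evaluated in null coordinates *)

Section ExplicitSolution.
Context {R : realType}.
Local Notation et := ((1, 0) : R * R).
Local Notation ex := ((0, 1) : R * R).

Lemma smoothnN n (f : R -> R) : smoothn n f -> smoothn n (fun x => - f x).
Proof.
move=> Sf; have := smoothnM (smoothn_cst n (-1)) Sf.
by congr smoothn; apply/funext => x; rewrite mulN1r.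
Qed.

Lemma jacobi_smooth (k : R) (s c w : R -> R) :
  (forall t : R, [/\ is_derive t (1 : R) s (c t * w t),
     is_derive t (1 : R) c (- (s t * w t)) &
     is_derive t (1 : R) w (- (k ^+ 2 * s t * c t))]) ->
  [/\ smooth s, smooth c & smooth w].
Proof.
move=> H.
suff S n : [/\ smoothn n s, smoothn n c & smoothn n w].
  by split=> n; case: (S n).
elim: n => [//|n [Ss Sc Sw]]; split.
- apply: (@smoothnS _ _ _ (fun t => c t * w t)); first by move=> t; case: (H t).
  exact: smoothnM.
- apply: (@smoothnS _ _ _ (fun t => - (s t * w t))); first by move=> t; case: (H t).
  exact/smoothnN/smoothnM.
- apply: (@smoothnS _ _ _ (fun t => - (k ^+ 2 * s t * c t))).
    by move=> t; case: (H t).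
  apply/smoothnN/smoothnM => //; apply: smoothnM => //; exact: smoothn_cst.
Qed.

Lemma norm_le1 (x y : R) : 0 <= y -> x ^+ 2 + y = 1 -> `|x| <= 1.
Proof.
move=> y0 E; rewrite -sqrtr1 -sqrtr_sqr ler_wsqrtr// -E lerDl//.
Qed.

Definition sigma (C x : R) : R := 2 * pi * step C x.

Lemma sigma_smooth C : 0 < C -> smooth (sigma C).
Proof. by move=> C0 n; apply: smoothnM; [exact: smoothn_cst|exact: step_smooth]. Qed.

Lemma sigma_left (C x : R) : x <= - C -> sigma C x = 0.
Proof. by move=> xC; rewrite /sigma step_left// mulr0. Qed.

Lemma sigma_right (C x : R) : 0 < C -> C <= x -> sigma C x = 2 * pi.
Proof. by move=> C0 xC; rewrite /sigma step_right// mulr1. Qed.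

Lemma cos_2pi : cos (2 * pi) = 1 :> R.
Proof. by rewrite mulrC mulr_natr cos2pi. Qed.

Lemma sin_2pi : sin (2 * pi) = 0 :> R.
Proof. by rewrite mulrC mulr_natr sin2pi. Qed.

(* A small circle through [e1] traversed once, with angular radius [asin k]. *)
Definition circle_data m (C k x : R) : 'rV[R]_m :=
  row3 (1 + k * (k * (cos (sigma C x) - 1)))
       (k * (Num.sqrt (1 - k ^+ 2) * (1 - cos (sigma C x))))
       (k * sin (sigma C x)).

Section Solution.
Variables (m : nat) (hm : (2 < m)%N) (C k : R) (C0 : 0 < C) (k01 : 0 < k < 1).
Variables (s c w : R -> R).
Hypotheses (D : forall t : R, [/\ is_derive t (1 : R) s (c t * w t),
     is_derive t (1 : R) c (- (s t * w t)) &
     is_derive t (1 : R) w (- (k ^+ 2 * s t * c t))])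
  (sc : forall t, s t ^+ 2 + c t ^+ 2 = 1)
  (ws : forall t, w t ^+ 2 = 1 - k ^+ 2 * s t ^+ 2)
  (w0 : forall t, 0 < w t) (s0 : s 0 = 1) (c0 : c 0 = 0) (spi : s pi != -1).

Let ka := Num.sqrt (1 - k ^+ 2).
Let sg := sigma C.
Let Ss : smooth sg := sigma_smooth C0.
Let u (q : R * R) := 1 * q.1 + 1 * q.2.
Let v (q : R * R) := -1 * q.1 + 1 * q.2.
Let ta (q : R * R) := 2^-1 * (sg (u q) + -1 * sg (v q)).
Let th (q : R * R) := 2^-1 * (sg (u q) + sg (v q)).
(** [A] is both the time derivative of [ta] and the space derivative of [th], and [B] is both the
    space derivative of [ta] and the time derivative of [th]. These relations express
    conformality. *)
Let A (q : R * R) := 2^-1 * (derive1 sg (u q) + derive1 sg (v q)).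
Let B (q : R * R) := 2^-1 * (derive1 sg (u q) + -1 * derive1 sg (v q)).
Let A2 (q : R * R) :=
  2^-1 * (derive1 (derive1 sg) (u q) + derive1 (derive1 sg) (v q)).
Let B2 (q : R * R) :=
  2^-1 * (derive1 (derive1 sg) (u q) + -1 * derive1 (derive1 sg) (v q)).
Let S (q : R * R) := s (ta q).
Let Cn (q : R * R) := c (ta q).
Let W (q : R * R) := w (ta q).
Let co (q : R * R) := cos (th q).
Let si (q : R * R) := sin (th q).

Let phi (q : R * R) : 'rV[R]_m :=
  row3 (rot0 k ka S W co q) (rot1 k ka S W co q) (rot2 k S si q).

Let kka : k ^+ 2 + ka ^+ 2 = 1.
Proof.
have /andP[k0 k1] := k01.
by rewrite sqr_sqrtr ?subrKC// subr_ge0 expr_le1// ltW.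
Qed.

Let ka_gt0 : 0 < ka.
Proof.
have /andP[k0 k1] := k01.
by rewrite sqrtr_gt0 subr_gt0 expr_lt1// ltW.
Qed.

Let duv (f : R -> R) p : smooth f ->
  [/\ is_derive p et (fun q => f (u q)) (derive1 f (u p)),
      is_derive p et (fun q => f (v q)) (- derive1 f (v p)),
      is_derive p ex (fun q => f (u q)) (derive1 f (u p)) &
      is_derive p ex (fun q => f (v q)) (derive1 f (v p))].
Proof.
move=> Sf.
have H (a b : R) (vv : R * R) :=
  @is_derive_comp R _ f (fun q : R * R => a * q.1 + b * q.2) p vv _ _
    (smooth_is_derive (a * p.1 + b * p.2) Sf) (is_derive_affine a b p vv).
split.
- by apply: (is_derive_eq (H 1 1 et)); rewrite /=; ring.
- by apply: (is_derive_eq (H (-1) 1 et)); rewrite /=; ring.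
- by apply: (is_derive_eq (H 1 1 ex)); rewrite /=; ring.
- by apply: (is_derive_eq (H (-1) 1 ex)); rewrite /=; ring.
Qed.

Let dpm (f : R -> R) (e : R) p : smooth f ->
  is_derive p et (fun q => 2^-1 * (f (u q) + e * f (v q)))
    (2^-1 * (derive1 f (u p) + - e * derive1 f (v p))) /\
  is_derive p ex (fun q => 2^-1 * (f (u q) + e * f (v q)))
    (2^-1 * (derive1 f (u p) + e * derive1 f (v p))).
Proof.
move=> /(duv p)[ut vt ux vx].
have cst (a : R) vv := is_derive_constant a p vv.
split.
- apply: (is_derive_eq (is_derive_mul (cst 2^-1 et)
    (is_derive_add ut (is_derive_mul (cst e et) vt)))); ring.
- apply: (is_derive_eq (is_derive_mul (cst 2^-1 ex)
    (is_derive_add ux (is_derive_mul (cst e ex) vx)))); ring.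
Qed.

Let dplus (f : R -> R) p : smooth f ->
  is_derive p et (fun q => 2^-1 * (f (u q) + f (v q)))
    (2^-1 * (derive1 f (u p) + -1 * derive1 f (v p))) /\
  is_derive p ex (fun q => 2^-1 * (f (u q) + f (v q)))
    (2^-1 * (derive1 f (u p) + derive1 f (v p))).
Proof.
move=> /(dpm 1 p)[]; rewrite mul1r.
by under eq_fun do rewrite mul1r.
Qed.

Let dminus (f : R -> R) p : smooth f ->
  is_derive p et (fun q => 2^-1 * (f (u q) + -1 * f (v q)))
    (2^-1 * (derive1 f (u p) + derive1 f (v p))) /\
  is_derive p ex (fun q => 2^-1 * (f (u q) + -1 * f (v q)))
    (2^-1 * (derive1 f (u p) + -1 * derive1 f (v p))).
Proof. by move=> /(dpm (-1) p)[]; rewrite opprK mul1r. Qed.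

Let atoms (p vv : R * R) (P Q : R * R -> R) :
  is_derive p vv ta (P p) -> is_derive p vv th (Q p) ->
  [/\ is_derive p vv S (Cn p * W p * P p),
      is_derive p vv Cn (- (S p * W p * P p)),
      is_derive p vv W (- (k ^+ 2 * S p * Cn p * P p)),
      is_derive p vv co (- (si p * Q p)) &
      is_derive p vv si (co p * Q p)].
Proof.
move=> Hta Hth; have [ds dc dw] := D (ta p); split.
- exact: is_derive_comp ds Hta.
- by apply: (is_derive_eq (is_derive_comp dc Hta)); rewrite mulNr.
- by apply: (is_derive_eq (is_derive_comp dw Hta)); rewrite mulNr.
- by apply: (is_derive_eq (is_derive_comp (is_derive_cos (th p)) Hth)); rewrite mulNr.
- exact: is_derive_comp (is_derive_sin (th p)) Hth.
Qed.

Let drow P Q q : 'rV[R]_m := row3 (drot0 k ka S Cn W co si P Q q)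
  (drot1 k ka S Cn W co si P Q q) (drot2 k S Cn W co si P Q q).
Let ddrow P Q q : 'rV[R]_m := row3 (ddrot0 k ka S Cn W co si P Q A2 B2 q)
  (ddrot1 k ka S Cn W co si P Q A2 B2 q) (ddrot2 k S Cn W co si P Q A2 B2 q).

Let Ss1 : smooth (derive1 sg) := smooth_derive Ss.

Let dphi p : is_derive p et phi (drow A B p) /\ is_derive p ex phi (drow B A p).
Proof.
have [tat tax] := dminus p Ss; have [tht thx] := dplus p Ss.
have [a1 a2 a3 a4 a5] := atoms (P := A) (Q := B) tat tht.
have [b1 b2 b3 b4 b5] := atoms (P := B) (Q := A) tax thx.
split.
- exact: is_derive_row3 (is_derive_rot0 ka a1 a3 a4) (is_derive_rot1 ka a1 a3 a4)
    (is_derive_rot2 k a1 a5).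
- exact: is_derive_row3 (is_derive_rot0 ka b1 b3 b4) (is_derive_rot1 ka b1 b3 b4)
    (is_derive_rot2 k b1 b5).
Qed.

Let dtphi : dt phi = drow A B.
Proof. by apply/funext => p; have [[_ <-] _] := dphi p. Qed.

Let dxphi : dx phi = drow B A.
Proof. by apply/funext => p; have [_ [_ <-]] := dphi p. Qed.

Let ddphi p : is_derive p et (drow A B) (ddrow A B p) /\
  is_derive p ex (drow B A) (ddrow B A p).
Proof.
have [tat tax] := dminus p Ss; have [tht thx] := dplus p Ss.
have [At Ax] := dplus p Ss1; have [Bt Bx] := dminus p Ss1.
have [a1 a2 a3 a4 a5] := atoms (P := A) (Q := B) tat tht.
have [b1 b2 b3 b4 b5] := atoms (P := B) (Q := A) tax thx.
split.
- exact: is_derive_row3 (is_derive_drot0 ka a1 a2 a3 a4 a5 At Bt)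
    (is_derive_drot1 ka a1 a2 a3 a4 a5 At Bt) (is_derive_drot2 a1 a2 a3 a4 a5 At Bt).
- exact: is_derive_row3 (is_derive_drot0 ka b1 b2 b3 b4 b5 Bx Ax)
    (is_derive_drot1 ka b1 b2 b3 b4 b5 Bx Ax) (is_derive_drot2 b1 b2 b3 b4 b5 Bx Ax).
Qed.

Let ddtphi : dt (dt phi) = ddrow A B.
Proof. by rewrite dtphi; apply/funext => p; have [[_ <-] _] := ddphi p. Qed.

Let ddxphi : dx (dx phi) = ddrow B A.
Proof. by rewrite dxphi; apply/funext => p; have [_ [_ <-]] := ddphi p. Qed.

Let cs p : co p ^+ 2 + si p ^+ 2 = 1.
Proof. exact: cos2Dsin2. Qed.

Let phi_smooth : smooth_field phi.
Proof.
move=> n.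
have Su : Cks n (fun q => sg (u q)) := Cks_comp Ss (Cks_affine n 1 1).
have Sv : Cks n (fun q => sg (v q)) := Cks_comp Ss (Cks_affine n (-1) 1).
have St : Cks n ta.
  by apply: CksM; [exact: Cks_cst|apply: CksD => //; apply: CksM => //; exact: Cks_cst].
have Sh : Cks n th by apply: CksM; [exact: Cks_cst|apply: CksD].
have [js jc jw] := jacobi_smooth D.
have SS : Cks n S := Cks_comp js St.
have SW : Cks n W := Cks_comp jw St.
have Sco : Cks n co by apply: Cks_comp Sh => j; case: (@smoothn_sin_cos R j).
have Ssi : Cks n si by apply: Cks_comp Sh => j; case: (@smoothn_sin_cos R j).
have cst (a : R) : Cks n (fun=> a) := Cks_cst n a.
have SX : Cks n (fun q => k * (S q * co q)) := CksM (cst _) (CksM SS Sco).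
apply: Ck_row3.
- exact: CksD (CksM (cst _) SX) (CksM (cst _) SW).
- exact: CksD (CksM (cst _) SX) (CksM (cst _) SW).
- exact: CksM (cst _) (CksM SS Ssi).
Qed.

Let phi_norm p : enorm (phi p) = 1.
Proof. have H := @rot_norm R k ka S W co si p kka (ws (ta p)) (cs p).
by rewrite enorm_row3// H sqrtr1. Qed.

Let drow_norm P Q p : enorm (drow P Q p) ^+ 2 =
  k ^+ 2 * (Cn p ^+ 2 * P p ^+ 2 + S p ^+ 2 * Q p ^+ 2).
Proof.
rewrite enorm_row3// sqr_sqrtr ?addr_ge0 ?sqr_ge0//.
exact: (@drot_norm R k ka S Cn W co si p kka (ws (ta p)) (cs p)).
Qed.

Let phi_equation p : - dt (dt phi) p + dx (dx phi) p
  + (enorm (dx phi p) ^+ 2 - enorm (dt phi p) ^+ 2) *: phi p = 0.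
Proof.
rewrite ddtphi ddxphi dtphi dxphi !drow_norm.
rewrite -scaleN1r !row3Z !row3D !mulN1r.
have [E0 E1 E2] := rot_equation ka co si A B A2 B2 (sc (ta p) : S p ^+ 2 + Cn p ^+ 2 = 1)
  (ws (ta p) : W p ^+ 2 = 1 - k ^+ 2 * S p ^+ 2).
by rewrite E0 E1 E2 row30.
Qed.

Let ta0 x : ta (0, x) = 0.
Proof. by rewrite /ta /u /v /= !mulr0 !add0r mulN1r subrr mulr0. Qed.

Let th0 x : th (0, x) = sg x.
Proof. by rewrite /th /u /v /= !mulr0 !add0r !mul1r; field. Qed.

Let w00 : w 0 = ka.
Proof.
apply/eqP; rewrite -(@eqrXn2 _ 2)// ?ltW//.
by rewrite ws s0 expr1n mulr1 -kka addrC addKr.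
Qed.

Let phi_initial x : phi (0, x) = circle_data m C k x.
Proof.
rewrite /phi /circle_data /rot0 /rot1 /rot2 /S /W /co /si ta0 th0 w00 s0 -/ka -/sg.
rewrite (_ : k * _ + ka * ka = 1 + k * (k * (cos (sg x) - 1))).
  rewrite (_ : - ka * _ + k * ka = k * (ka * (1 - cos (sg x)))).
    by rewrite mul1r.
  by ring.
have -> : ka * ka = 1 - k ^+ 2 by rewrite -[in RHS]kka; ring.
by ring.
Qed.

Let phi_velocity x : dt phi (0, x) = 0.
Proof.
rewrite dtphi.
(* At time 0 theta is stationary ([B] vanishes) and the pendulum is at rest ([Cn] vanishes); every
   term of the velocity contains one of these factors. *)
have B0 : B (0, x) = 0 by rewrite /B /u /v /= !mulr0 !add0r mulN1r subrr mulr0.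
have C0' : Cn (0, x) = 0 by rewrite /Cn ta0.
rewrite /drow /drot0 /drot1 /drot2 B0 C0' !(mulr0, mul0r, oppr0, addr0).
exact: row30.
Qed.

Let bounded_uv (f : R -> R) : bounded_fct f ->
  bounded_fct (fun q => f (u q)) /\ bounded_fct (fun q => f (v q)).
Proof. by move=> [M HM]; split; exists M => q. Qed.

Let bounded_atoms : [/\ bounded_fct S, bounded_fct Cn, bounded_fct W,
   bounded_fct co & bounded_fct si].
Proof.
split; exists 1 => q.
- exact: norm_le1 (sqr_ge0 _) (sc _).
- by apply: (norm_le1 (sqr_ge0 (S q))); rewrite addrC sc.
- apply: (@norm_le1 _ (k ^+ 2 * S q ^+ 2)); first by rewrite mulr_ge0 ?sqr_ge0.
  by rewrite ws subrK.
- exact: cos_max.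
- exact: sin_max.
Qed.

Let bounded_sigma : [/\ bounded_fct A, bounded_fct B, bounded_fct A2 & bounded_fct B2].
Proof.
have [M HM] := smooth_eventually_cst_bounded Ss (@sigma_left C)
  (fun y => @sigma_right C y C0).
have [a1 a2] : bounded_fct (fun q => derive1 sg (u q)) /\
    bounded_fct (fun q => derive1 sg (v q)).
  by apply: bounded_uv; exists (M 1%N) => x; have [] := HM 1%N x.
have [b1 b2] : bounded_fct (fun q => derive1 (derive1 sg) (u q)) /\
    bounded_fct (fun q => derive1 (derive1 sg) (v q)).
  by apply: bounded_uv; exists (M 2%N) => x; have [] := HM 2%N x.
have cst (a : R) : bounded_fct (fun _ : R * R => a) := bounded_cst a.
by split; apply: bounded_mul => //; apply: bounded_add => //; apply: bounded_mul.
Qed.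

Lemma bounded_row3 (f g h : R * R -> R) :
  bounded_fct f -> bounded_fct g -> bounded_fct h ->
  exists M : R, forall q j, `|(row3 (f q) (g q) (h q) : 'rV[R]_m) 0 j| <= M.
Proof.
move=> [F HF] [G HG] [H HH]; exists (`|F| + `|G| + `|H|) => q [[|[|[|j]]] hj].
- rewrite mxE /= -addrA (le_trans (HF q))// (le_trans (ler_norm F))// lerDl addr_ge0//.
- by rewrite mxE /= addrAC (le_trans (HG q))// (le_trans (ler_norm G))// lerDr addr_ge0.
- by rewrite mxE /= (le_trans (HH q))// (le_trans (ler_norm H))// lerDr addr_ge0.
- by rewrite mxE /= nth_nil normr0 !addr_ge0.
Qed.

Lemma explicit_solution : exists phi : R * R -> 'rV[R]_m,
  [/\ wave_map_solution (circle_data m C k) phi,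
      forall p, enorm (phi p) = 1,
      exists K : R, forall p j,
        [/\ `|phi p 0 j| <= K, `|dx phi p 0 j| <= K & `|dx (dx phi) p 0 j| <= K] &
      exists h : 'rV[R]_m, h 0 (Ordinal (ltn_trans (isT : (0 < 2)%N) hm)) != 0 /\
        forall T x : R, 0 <= T ->
          (`|x| <= T - C -> slice phi T x = h) /\
          (T + C <= `|x| -> slice phi T x = 0)].
Proof.
have [bS bCn bW bco bsi] := bounded_atoms; have [bA bB bA2 bB2] := bounded_sigma.
exists phi; split.
- by split; [exact: phi_smooth|exact: phi_equation|exact: phi_initial|
    exact: phi_velocity].
- exact: phi_norm.
- have [r0 r1 r2] := bounded_rot k ka bS bW bco bsi.
  have [d0 d1 d2] := bounded_drot k ka bS bCn bW bco bsi bB bA.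
  have [e0 e1 e2] := bounded_ddrot k ka bS bCn bW bco bsi bB bA bA2 bB2.
  have [K1 H1] := bounded_row3 r0 r1 r2.
  have [K2 H2] := bounded_row3 d0 d1 d2.
  have [K3 H3] := bounded_row3 e0 e1 e2.
  exists (`|K1| + `|K2| + `|K3|) => p j; split.
  + by rewrite -addrA (le_trans (H1 p j))// (le_trans (ler_norm K1))// lerDl addr_ge0.
  + rewrite dxphi addrAC (le_trans (H2 p j))// (le_trans (ler_norm K2))//.
    by rewrite lerDr addr_ge0.
  + rewrite ddxphi (le_trans (H3 p j))// (le_trans (ler_norm K3))//.
    by rewrite lerDr addr_ge0.
have phiE (q : R * R) (t r : R) : ta q = t -> th q = r -> phi q =
    row3 (k * (k * (s t * cos r)) + ka * w t) (- ka * (k * (s t * cos r)) + k * w t)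
      (k * (s t * sin r)).
  by move=> <- <-.
have phi_e1 (q : R * R) : ta q = 0 -> cos (th q) = 1 -> sin (th q) = 0 ->
    phi q = e1 R m.
  move=> h1 h2 h3; rewrite (phiE q 0 _ h1 erefl) h2 h3 s0 w00 e1_row3 !mulr1 mulr0.
  by rewrite -!expr2 kka mulNr [ka * k]mulrC addNr mulr0.
exists (row3 (k * (k * (s pi * cos pi)) + ka * w pi)
  (- ka * (k * (s pi * cos pi)) + k * w pi) (k * (s pi * sin pi)) - e1 R m); split.
  rewrite !mxE /= cospi subr_eq0; apply/eqP => E.
  (* The left side is the squared distance from the plateau value to e1, in the coordinates of the
     circle. On the unit sphere it vanishes as soon as the first coordinate is 1. *)
  have Hs : (k * (s pi + 1)) ^+ 2 + (w pi - ka) ^+ 2 = 0.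
    have Hw := ws pi; have -> : (k * (s pi + 1)) ^+ 2 + (w pi - ka) ^+ 2 =
       k ^+ 2 * s pi ^+ 2 + w pi ^+ 2 + (k ^+ 2 + ka ^+ 2)
       - 2 * (k * (k * (s pi * -1)) + ka * w pi) by ring.
    by rewrite E kka Hw; ring.
  have : (k * (s pi + 1)) ^+ 2 == 0.
    by rewrite eq_le sqr_ge0 andbT -Hs lerDl sqr_ge0.
  rewrite sqrf_eq0 mulf_eq0 addr_eq0 (negbTE spi) orbF.
  by have /andP[k0 _] := k01; rewrite gt_eqF.
move=> T x T0; split=> xT.
  rewrite /slice; congr (_ - _); apply: phiE; rewrite /ta /th /u /v /= !mul1r mulN1r.
    rewrite /sg sigma_right// ?sigma_left//; first by field.
    - by move: xT; rewrite ler_norml => /andP[]; lra.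
    - by move: xT; rewrite ler_norml => /andP[]; lra.
  rewrite /sg sigma_right// ?sigma_left//; first by field.
  - by move: xT; rewrite ler_norml => /andP[]; lra.
  - by move: xT; rewrite ler_norml => /andP[]; lra.
(* Outside, [sigma] takes the same value 2 pi or 0 at both null coordinates: tau is 0 and theta is a
   full turn or 0. *)
rewrite /slice (phi_e1 (T, x)) ?subrr//; move: xT; rewrite ler_normr => /orP[] xT.
- rewrite /ta /u /v /= !mul1r mulN1r /sg !sigma_right//; [by ring|lra|lra].
- rewrite /ta /u /v /= !mul1r mulN1r /sg !sigma_left//; [by ring|lra|lra].
- rewrite /th /u /v /= !mul1r mulN1r /sg !sigma_right//; [|lra|lra].
  by rewrite (_ : 2^-1 * _ = 2 * pi) ?cos_2pi//; field.
- rewrite /th /u /v /= !mul1r mulN1r /sg !sigma_left//; [|lra|lra].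
  by rewrite addr0 mulr0 cos0.
- rewrite /th /u /v /= !mul1r mulN1r /sg !sigma_right//; [|lra|lra].
  by rewrite (_ : 2^-1 * _ = 2 * pi) ?sin_2pi//; field.
- rewrite /th /u /v /= !mul1r mulN1r /sg !sigma_left//; [|lra|lra].
  by rewrite addr0 mulr0 sin0.
Qed.

End Solution.

End ExplicitSolution.

(** * Uniqueness *)

Section TwoVariables.
Context {R : realType}.
Local Notation et := ((1, 0) : R * R).
Local Notation ex := ((0, 1) : R * R).
Implicit Types (g : R * R -> R) (p q : R * R).

Lemma continuous_pair_ball g p (e : R) : continuous g -> 0 < e ->
  exists2 d : R, 0 < d & forall q, `|q.1 - p.1| < d -> `|q.2 - p.2| < d ->
    `|g q - g p| <= e.
Proof.
move=> cg e0; have /cvgrPdist_le/(_ e e0)/nbhs_ballP[d /= d0 H] := cg p.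
exists d => // q h1 h2; rewrite distrC; apply: H; split => /=.
- by rewrite /ball /= distrC.
- by rewrite /ball /= distrC.
Qed.

Lemma scale_pairD (h a b t x : R) :
  h *: ((a, b) : R * R) + (t, x) = (h * a + t, h * b + x).
Proof. by []. Qed.

Lemma is_derive_path g (t x a b s d : R) :
  is_derive (t + s * a, x + s * b) ((a, b) : R * R) g d ->
  is_derive s (1 : R) (fun s => g (t + s * a, x + s * b)) d.
Proof.
move=> /is_derive_line H; apply/is_derive_line; apply: is_derive_ext H => h.
congr g; rewrite scale_pairD [_%:A]mulr1; congr pair; ring.
Qed.

Lemma is_derive_slice_x g (t x d : R) :
  is_derive (t, x) ex g d -> is_derive x (1 : R) (fun y => g (t, y)) d.
Proof.
move=> /is_derive_line H; apply/is_derive_line; apply: is_derive_ext H => h.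
congr g; rewrite scale_pairD [_%:A]mulr1; congr pair; ring.
Qed.

Lemma is_derive_slice_t g (t x d : R) :
  is_derive (t, x) et g d -> is_derive t (1 : R) (fun y => g (y, x)) d.
Proof.
move=> /is_derive_line H; apply/is_derive_line; apply: is_derive_ext H => h.
congr g; rewrite scale_pairD [_%:A]mulr1; congr pair; ring.
Qed.

Lemma mean_value_segment (f df : R -> R) (x y : R) :
  (forall z : R, is_derive z (1 : R) f (df z)) ->
  exists2 z : R, `|z - x| <= `|y - x| & f y - f x = df z * (y - x).
Proof.
move=> H; have [xy|yx|->] := ltgtP x y.
- have [z /andP[xz zy] E] := mean_value xy (fun z _ => H z); exists z => //.
  by rewrite !gtr0_norm ?subr_gt0 ?lerD2r ?ltW//; exact: lt_trans zy.
- have [z /andP[yz zx] E] := mean_value yx (fun z _ => H z); exists z.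
    by rewrite !ltr0_norm ?subr_lt0// lerN2 lerD2r ltW.
  by rewrite -opprB E -mulrN opprB.
- by exists y; rewrite // !subrr mulr0.
Qed.

(** Only the two partial derivatives are given; oblique directions, here the null ones, follow from
    their continuity by the mean value theorem along two sides of a small rectangle. *)
Lemma is_derive_direction g p (a b : R) : Cks 1 g ->
  is_derive p ((a, b) : R * R) g (a * 'D_et g p + b * 'D_ex g p).
Proof.
move=> Sg; have [_ _ ct cx] := Sg.
case: p => t x.
suff H : (h^-1 *: (g (h *: ((a, b) : R * R) + (t, x)) - g (t, x))) @[h --> (0 : R)^']
    --> a * 'D_et g (t, x) + b * 'D_ex g (t, x).
  by apply: DeriveDef; [apply/cvg_ex; eexists; exact: H|exact: cvg_lim].
apply/cvgrPdist_le => /= e e0.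
pose ab := `|a| + `|b| + 1.
have ab0 : 0 < ab by rewrite ltr_wpDl ?addr_ge0.
have e'0 : 0 < e / ab by rewrite divr_gt0.
have [d1 d10 H1] := continuous_pair_ball (t, x) ct e'0.
have [d2 d20 H2] := continuous_pair_ball (t, x) cx e'0.
have dd0 : 0 < Num.min d1 d2 / ab by rewrite divr_gt0// lt_min d10.
apply: filterS2 (@dnbhs0_lt R R^o _ dd0) (@nbhs_dnbhs_neq R 0) => h hd h0.
have {}hd : `|h| * ab < Num.min d1 d2 by rewrite -ltr_pdivlMr.
have ha : `|h * a| < Num.min d1 d2.
  by apply: le_lt_trans hd; rewrite normrM ler_wpM2l// /ab -addrA lerDl addr_ge0.
have hb : `|h * b| < Num.min d1 d2.
  apply: le_lt_trans hd; rewrite normrM ler_wpM2l// /ab addrAC lerDr addr_ge0//.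
have [y yx Ey] := mean_value_segment x (x + h * b)
  (fun z => is_derive_slice_x (Cks_dx (t + h * a, z) Sg)).
have [s st Es] := mean_value_segment t (t + h * a)
  (fun z => is_derive_slice_t (Cks_dt (z, x) Sg)).
rewrite [x + _ - x]addrC addKr in yx Ey; rewrite [t + _ - t]addrC addKr in st Es.
have -> : h *: ((a, b) : R * R) + (t, x) = (t + h * a, x + h * b).
  by rewrite scale_pairD; congr pair; rewrite addrC.
have -> : g (t + h * a, x + h * b) - g (t, x) =
   h * (b * 'D_ex g (t + h * a, y) + a * 'D_et g (s, x)).
  have -> : g (t + h * a, x + h * b) - g (t, x) =
    (g (t + h * a, x + h * b) - g (t + h * a, x)) + (g (t + h * a, x) - g (t, x)).
    by ring.
  by rewrite Ey Es; ring.
rewrite /GRing.scale /= mulrA mulVf// mul1r.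
have rearrange (u0 v0 u1 v1 : R) : a * u0 + b * v0 - (b * v1 + a * u1) =
    - (a * (u1 - u0) + b * (v1 - v0)) by ring.
have tri (u0 v0 u1 v1 c : R) : `|u1 - u0| <= c -> `|v1 - v0| <= c ->
    `|- (a * (u1 - u0) + b * (v1 - v0))| <= `|a| * c + `|b| * c.
  move=> hu hv; rewrite normrN (le_trans (ler_normD _ _))// !normrM.
  by rewrite lerD// ler_wpM2l.
rewrite rearrange.
have B1 : `|'D_et g (s, x) - 'D_et g (t, x)| <= e / ab.
  apply: H1; rewrite /= ?subrr ?normr0//.
  by apply: le_lt_trans st _; apply: lt_le_trans ha _; rewrite ge_min lexx.
have B2 : `|'D_ex g (t + h * a, y) - 'D_ex g (t, x)| <= e / ab.
  apply: H2 => /=.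
    rewrite [t + _ - t]addrC addKr.
    by apply: lt_le_trans ha _; rewrite ge_min lexx orbT.
  by apply: le_lt_trans yx _; apply: lt_le_trans hb _; rewrite ge_min lexx orbT.
apply: (le_trans (tri _ _ _ _ _ B1 B2)).
rewrite -mulrDl mulrCA ler_piMr ?(ltW e0)// ler_pdivrMr// mul1r /ab.
by rewrite lerDl.
Qed.

(** The second difference over a small square, evaluated by mean values in both orders, equals
    either mixed derivative at a point of the square; continuity of both concludes. *)
Lemma schwarz g p : Cks 2 g ->
  'D_ex (fun q => 'D_et g q) p = 'D_et (fun q => 'D_ex g q) p.
Proof.
move=> Sg; have Sg1 := CksW Sg.
have St : Cks 1 (fun q => 'D_et g q) := let: And4 _ _ H _ := Sg in H.
have Sx : Cks 1 (fun q => 'D_ex g q) := let: And4 _ _ _ H := Sg in H.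
have [_ _ _ ctx] := St; have [_ _ cxt _] := Sx.
set gtx := (fun q => 'D_ex (fun q => 'D_et g q) q) in ctx *.
set gxt := (fun q => 'D_et (fun q => 'D_ex g q) q) in cxt *.
case: p => t x; apply/eqP; rewrite -subr_eq0 -normr_le0.
apply/ler_addgt0Pr => e e0; rewrite add0r.
have e20 : 0 < e / 2 by rewrite divr_gt0.
have [d1 d10 H1] := continuous_pair_ball (t, x) ctx e20.
have [d2 d20 H2] := continuous_pair_ball (t, x) cxt e20.
pose h := Num.min d1 d2 / 2.
have m0 : 0 < Num.min d1 d2 by rewrite lt_min d10.
have h0 : 0 < h by rewrite divr_gt0.
have hm : h < Num.min d1 d2 by rewrite /h; lra.
have h1 : h < d1 by apply: lt_le_trans hm _; rewrite ge_min lexx.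
have h2 : h < d2 by apply: lt_le_trans hm _; rewrite ge_min lexx orbT.
have addK z : z + h - z = h by rewrite addrC addKr.
have [s1 s1t E1] := mean_value_segment t (t + h) (fun z => is_derive_sub
  (is_derive_slice_t (Cks_dt (z, x + h) Sg1)) (is_derive_slice_t (Cks_dt (z, x) Sg1))).
have [y1 y1x F1] := mean_value_segment x (x + h)
  (fun z => is_derive_slice_x (Cks_dx (s1, z) St)).
have [y2 y2x E2] := mean_value_segment x (x + h) (fun z => is_derive_sub
  (is_derive_slice_x (Cks_dx (t + h, z) Sg1)) (is_derive_slice_x (Cks_dx (t, z) Sg1))).
have [s2 s2t F2] := mean_value_segment t (t + h)
  (fun z => is_derive_slice_t (Cks_dt (z, y2) Sx)).
have hE : `|h| = h := gtr0_norm h0.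
rewrite !addK ?hE in s1t y1x y2x s2t E1 F1 E2 F2.
have E : gtx (s1, y1) = gxt (s2, y2).
  apply: (mulIf (lt0r_neq0 h0)); apply: (mulIf (lt0r_neq0 h0)).
  have swap (u1 u2 u3 u4 : R) : u1 - u2 - (u3 - u4) = u1 - u3 - (u2 - u4) by ring.
  exact: etrans (etrans (esym (etrans E1 (congr1 ( *%R^~ h) F1))) (swap _ _ _ _))
    (etrans E2 (congr1 ( *%R^~ h) F2)).
have B1 : `|gtx (s1, y1) - gtx (t, x)| <= e / 2.
  exact: H1 (s1, y1) (le_lt_trans s1t h1) (le_lt_trans y1x h1).
have B2 : `|gxt (s2, y2) - gxt (t, x)| <= e / 2.
  exact: H2 (s2, y2) (le_lt_trans s2t h2) (le_lt_trans y2x h2).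
rewrite -/(gtx (t, x)) -/(gxt (t, x)).
have -> : gtx (t, x) - gxt (t, x) =
   (gxt (s2, y2) - gxt (t, x)) - (gtx (s1, y1) - gtx (t, x)).
  by move: E; move: (gtx _) (gxt _) (gtx _) (gxt _) => a b c d ->; ring.
rewrite (splitr e); apply: le_trans (ler_normB _ _) _.
exact: lerD B2 B1.
Qed.

Lemma continuous_rectangle_bounded g (T x0 : R) : continuous g ->
  exists M : R, forall t x : R, `|t| <= T -> `|x - x0| <= T -> `|g (t, x)| <= M.
Proof.
move=> cg; have [T0|T0] := leP 0 T; last first.
  by exists 0 => t x tT; have := le_trans (normr_ge0 t) tT; rewrite leNgt T0.
pose K := `[- T, T]%classic `*` `[x0 - T, x0 + T]%classic : set (R * R).
have K0 : K !=set0.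
  by exists (0, x0); split; rewrite /= in_itv /=; apply/andP; split; lra.
have cK : compact K by apply: compact_setX; exact: segment_compact.
have cn : {within K, continuous (fun q => `|g q|)}.
  apply: continuous_subspaceT => q.
  by apply: continuous_comp; [exact: cg|exact: norm_continuous].
have [c _ H] := compact_EVT_max K0 cK cn.
exists `|g c| => t x tT xT; apply: H; rewrite inE; split; rewrite /= in_itv /=.
- by rewrite -ler_norml.
- by rewrite -ler_distlC distrC.
Qed.

End TwoVariables.

Section Uniqueness.
Context {R : realType}.
Local Notation et := ((1, 0) : R * R).
Local Notation ex := ((0, 1) : R * R).

Lemma is_derive_unique (V : normedModType R) (g : V -> R) (p v : V) d1 d2 :
  is_derive p v g d1 -> is_derive p v g d2 -> d1 = d2.
Proof. by case=> _ <- [_ <-]. Qed.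

(** Integrating an exponential bound of rate [la] gains a factor [1 / la]. With [la] large this is
    the contraction behind uniqueness. *)
Lemma exp_compare_ge0 (h dh : R -> R) (la c t : R) : 0 < la -> 0 <= c -> h 0 = 0 ->
  (forall s : R, is_derive s (1 : R) h (dh s)) -> 0 <= t ->
  (forall s, 0 <= s <= t -> `|dh s| <= c * expR (la * s)) ->
  `|h t| <= c / la * expR (la * t).
Proof.
move=> la0 c0 h0 dhP; rewrite le_eqVlt => /predU1P[<- _|t0 H].
  by rewrite h0 normr0 mulr_ge0 ?expR_ge0// divr_ge0// ltW.
have E s : is_derive s (1 : R) (fun s : R => c / la * expR (la * s))
    (c * expR (la * s)).
  apply: (is_derive_eq (is_derive_mul (is_derive_constant (c / la) s 1)
    (@is_derive_comp R R expR (fun s : R => la * s) s 1 _ _ (is_derive_expR (la * s))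
      (is_derive_mul (is_derive_constant la s 1) (is_derive_id s (1 : R)))))).
  by rewrite /=; field; rewrite gt_eqF.
have [s1 /andP[h1 h2] E1] := mean_value t0 (fun s _ => is_derive_sub (E s) (dhP s)).
have [s2 /andP[h3 h4] E2] := mean_value t0 (fun s _ => is_derive_add (E s) (dhP s)).
have := H s1; rewrite (ltW h1) (ltW h2) => /(_ isT) /ler_normlP[_ B1].
have := H s2; rewrite (ltW h3) (ltW h4) => /(_ isT) /ler_normlP[B2 _].
rewrite h0 mulr0 expR0 mulr1 subr0 in E1 E2.
have P1 : 0 <= (c * expR (la * s1) - dh s1) * t by rewrite mulr_ge0// ?subr_ge0// ltW.
have P2 : 0 <= (c * expR (la * s2) + dh s2) * t.
  by rewrite mulr_ge0 ?(ltW t0)// -[dh s2]opprK subr_ge0.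
have cla : 0 <= c / la by rewrite divr_ge0// ltW.
rewrite ler_norml; apply/andP; split; lra.
Qed.

(** The condition on [s] says that [s] lies between 0 and [t], whatever the sign of [t]. *)
Lemma exp_compare (h dh : R -> R) (la c t : R) : 0 < la -> 0 <= c -> h 0 = 0 ->
  (forall s : R, is_derive s (1 : R) h (dh s)) ->
  (forall s, `|t - s| = `|t| - `|s| -> `|dh s| <= c * expR (la * `|s|)) ->
  `|h t| <= c / la * expR (la * `|t|).
Proof.
move=> la0 c0 h0 dhP; have [t0|t0] := leP 0 t => H.
  rewrite (ger0_norm t0) in H *.
  apply: (exp_compare_ge0 la0 c0 h0 dhP t0) => s /andP[s0 st].
  have := H s; rewrite (ger0_norm s0) ger0_norm ?subr_ge0//; exact.
rewrite -[t]opprK normrN; set u := - t.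
have u0 : 0 < u by rewrite oppr_gt0.
rewrite (gtr0_norm u0).
have dN s : is_derive s (1 : R) (fun s : R => h (- s)) (- dh (- s)).
  apply: (is_derive_eq (@is_derive_comp R R h (fun s : R => - s) s 1 _ _ (dhP (- s))
    (is_deriveN (is_derive_id s (1 : R))))).
  by rewrite mulrN mulr1.
apply: (exp_compare_ge0 (h := fun s => h (- s)) la0 c0 _ dN (ltW u0)).
  by rewrite oppr0.
move=> s /andP[s0 su]; rewrite normrN.
have := H (- s); rewrite normrN opprK (ger0_norm s0); apply.
rewrite /u in su *.
by rewrite (ltr0_norm t0) ler0_norm; [ring|lra].
Qed.

Lemma sum_sqr_diff_le (m : nat) (a a' : 'I_m -> R) (M E : R) :
  (forall j, `|a j| <= M) -> (forall j, `|a' j| <= M) ->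
  (forall j, `|a j - a' j| <= E) ->
  `|\sum_(j < m) a j ^+ 2 - \sum_(j < m) a' j ^+ 2| <= m%:R * (2 * M * E).
Proof.
move=> Ha Ha' HE; rewrite -sumrB (le_trans (ler_norm_sum _ _ _))//.
rewrite -[m in leRHS]card_ord -sumr_const mulr_suml ler_sum// => j _.
rewrite mul1r subr_sqr normrM mulrC ler_pM// mulr_natl mulr2n.
exact: le_trans (ler_normD _ _) (lerD (Ha j) (Ha' j)).
Qed.

Lemma sum_sqr_le (m : nat) (a : 'I_m -> R) (M : R) :
  (forall j, `|a j| <= M) -> `|\sum_(j < m) a j ^+ 2| <= m%:R * M ^+ 2.
Proof.
move=> Ha; rewrite (le_trans (ler_norm_sum _ _ _))//.
rewrite -[m in leRHS]card_ord -sumr_const mulr_suml ler_sum// => j _.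
rewrite mul1r normrX ler_pXn2r ?nnegrE// (le_trans _ (Ha j))//.
Qed.

Lemma enorm_sqr m (y : 'rV[R]_m) : enorm y ^+ 2 = \sum_(j < m) y 0 j ^+ 2.
Proof. by rewrite sqr_sqrtr// sumr_ge0// => j _; rewrite sqr_ge0. Qed.

Lemma wave_coord m (X Y Z : 'rV[R]_m) (c : R) k : - X + Y + c *: Z = 0 ->
  X 0 k - Y 0 k = c * Z 0 k.
Proof.
move=> /rowP/(_ k); rewrite !mxE => W.
by apply/eqP; rewrite -subr_eq0 -oppr_eq0; apply/eqP; rewrite -[RHS]W; ring.
Qed.

(** The constant is 6 = 4 + 2: the change of the bracket costs 4, the change of the value multiplied
    by it costs 2. *)
Lemma quadratic_difference_le (N M E X1 X2 T1 T2 y1 y2 w1 w2 : R) : 0 <= M ->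
  w1 = (X1 - T1) * y1 -> w2 = (X2 - T2) * y2 ->
  `|X1 - X2| <= N * (2 * M * E) -> `|T1 - T2| <= N * (2 * M * E) ->
  `|X2| <= N * M ^+ 2 -> `|T2| <= N * M ^+ 2 -> `|y1| <= M -> `|y1 - y2| <= E ->
  `|w1 - w2| <= 6 * N * M ^+ 2 * E.
Proof.
move=> M0 -> -> hX hT hX2 hT2 hy hd.
have -> : (X1 - T1) * y1 - (X2 - T2) * y2 =
    ((X1 - X2) - (T1 - T2)) * y1 + (X2 - T2) * (y1 - y2) by ring.
have -> : 6 * N * M ^+ 2 * E =
   (N * (2 * M * E) + N * (2 * M * E)) * M + (N * M ^+ 2 + N * M ^+ 2) * E by ring.
rewrite (le_trans (ler_normD _ _))// !normrM lerD// ler_pM//.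
- exact: le_trans (ler_normB _ _) (lerD hX hT).
- exact: le_trans (ler_normB _ _) (lerD hX2 hT2).
Qed.

Lemma half_sum_le (u v c : R) : `|u + 1 * v| <= c -> `|u + -1 * v| <= c ->
  `|u| <= c /\ `|v| <= c.
Proof.
rewrite !ler_norml => /andP[u1 u2] /andP[u3 u4].
by split; apply/andP; split; lra.
Qed.

Lemma geometric_squeeze (y B : R) : (forall n, y <= B / 2 ^+ n) -> y <= 0.
Proof.
move=> H; rewrite leNgt; apply/negP => y0.
have B0 : 0 < B by have := H 0%N; rewrite expr0 divr1; exact: lt_le_trans.
have := archi_boundP (ltW (divr_gt0 B0 y0)); set n := Num.bound _ => hn.
have n2 : n%:R <= 2 ^+ n :> R by rewrite -natrX ler_nat ltnW// ltn_expl.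
have := H n; rewrite ler_pdivlMr ?exprn_gt0// leNgt => /negP; apply.
rewrite mulrC -ltr_pdivrMr//; exact: lt_le_trans hn n2.
Qed.

Section TwoSolutions.
Variables (m : nat) (f : R -> 'rV[R]_m) (phi1 phi2 : R * R -> 'rV[R]_m).
Hypotheses (H1 : wave_map_solution f phi1) (H2 : wave_map_solution f phi2).

Let coordB (F G : R * R -> 'rV[R]_m) (k : 'I_m) q := F q 0 k + -1 * G q 0 k.

Let coordB_smooth F G k n : Ck n F -> Ck n G -> Cks n (coordB F G k).
Proof.
move=> SF SG; exact: CksD (Cks_coord k SF) (CksM (Cks_cst n (-1)) (Cks_coord k SG)).
Qed.

Let is_derive_coordB F G k (p v : R * R) : derivable F p v -> derivable G p v ->
  is_derive p v (coordB F G k) ('D_v F p 0 k + -1 * 'D_v G p 0 k).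
Proof.
move=> DF DG.
have cF := (is_derive_row F p v _).1 (derivableP DF) k.
have cG := (is_derive_row G p v _).1 (derivableP DG) k.
apply: (is_derive_eq (is_derive_add cF (is_derive_mul (is_derive_constant (-1) p v) cG))).
by rewrite mulr0 addr0.
Qed.

Let dt_coordB F G k : Ck 1 F -> Ck 1 G ->
  (fun q => 'D_et (coordB F G k) q) = coordB (dt F) (dt G) k.
Proof.
move=> [_ DF _ _] [_ DG _ _]; apply/funext => q.
by case: (is_derive_coordB k (DF q).1 (DG q).1).
Qed.

Let dx_coordB F G k : Ck 1 F -> Ck 1 G ->
  (fun q => 'D_ex (coordB F G k) q) = coordB (dx F) (dx G) k.
Proof.
move=> [_ DF _ _] [_ DG _ _]; apply/funext => q.
by case: (is_derive_coordB k (DF q).2 (DG q).2).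
Qed.

Let Ck_dt n (F : R * R -> 'rV[R]_m) (H : Ck n.+1 F) : Ck n (dt F) :=
  let: And4 _ _ H' _ := H in H'.

Let Ck_dx n (F : R * R -> 'rV[R]_m) (H : Ck n.+1 F) : Ck n (dx F) :=
  let: And4 _ _ _ H' := H in H'.

Let S1 n : Ck n phi1. Proof. by case: H1. Qed.
Let S2 n : Ck n phi2. Proof. by case: H2. Qed.

Let d k := coordB phi1 phi2 k.
Let a k := coordB (dt phi1) (dt phi2) k.
Let b k := coordB (dx phi1) (dx phi2) k.

Let da k p : [/\ is_derive p et (a k) (coordB (dt (dt phi1)) (dt (dt phi2)) k p),
  is_derive p ex (b k) (coordB (dx (dx phi1)) (dx (dx phi2)) k p),
  is_derive p et (d k) (a k p), is_derive p ex (d k) (b k p) &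
  'D_ex (a k) p = 'D_et (b k) p].
Proof.
have [_ D1 _ _] := S1 1; have [_ D2 _ _] := S2 1.
have [_ D1t _ _] := Ck_dt (S1 2); have [_ D2t _ _] := Ck_dt (S2 2).
have [_ D1x _ _] := Ck_dx (S1 2); have [_ D2x _ _] := Ck_dx (S2 2).
split.
- exact: is_derive_coordB (D1t p).1 (D2t p).1.
- exact: is_derive_coordB (D1x p).2 (D2x p).2.
- exact: is_derive_coordB (D1 p).1 (D2 p).1.
- exact: is_derive_coordB (D1 p).2 (D2 p).2.
- have Et : (fun q => 'D_et (d k) q) = a k := dt_coordB k (S1 1) (S2 1).
  have Ex : (fun q => 'D_ex (d k) q) = b k := dx_coordB k (S1 1) (S2 1).
  exact: etrans (congr1 (fun F => 'D_ex F p) (esym Et))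
    (etrans (schwarz p (coordB_smooth k (S1 2) (S2 2)))
      (congr1 (fun F => 'D_et F p) Ex)).
Qed.

Let a_smooth k : Cks 1 (a k) := coordB_smooth k (Ck_dt (S1 2)) (Ck_dt (S2 2)).
Let b_smooth k : Cks 1 (b k) := coordB_smooth k (Ck_dx (S1 2)) (Ck_dx (S2 2)).

(* [d_t + e d_x] is transported with speed [- e], up to the nonlinearity. *)
Let null_derivative k (e : R) p : e ^+ 2 = 1 ->
  is_derive p ((1, - e) : R * R) (fun q => a k q + e * b k q)
    (coordB (dt (dt phi1)) (dt (dt phi2)) k p - coordB (dx (dx phi1)) (dx (dx phi2)) k p).
Proof.
move=> e2; have [att bxx _ _ S] := da k p.
have derive_val (g : R * R -> R) (v : R * R) dg : is_derive p v g dg -> 'D_v g p = dg.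
  by case.
have Da := is_derive_direction p 1 (- e) (a_smooth k).
have Db := is_derive_direction p 1 (- e) (b_smooth k).
have Dab := is_derive_add Da
  (is_derive_mul (is_derive_constant e p ((1, - e) : R * R)) Db).
have comb (w x X1 X2 X3 X4 z : R) : X1 = w -> X4 = x -> X2 = X3 ->
    1 * X1 + - e * X2 + (e * (1 * X3 + - e * X4) + z * 0) = w - x.
  move=> -> -> ->; transitivity (w - e ^+ 2 * x); first by ring.
  by rewrite e2 mul1r.
apply: (is_derive_eq Dab).
by apply: comb; [exact: derive_val att|exact: derive_val bxx|exact: S].
Qed.

(** Subtracting the two equations, the cubic nonlinearity becomes linear in the difference and its
    first derivatives, with coefficients bounded through [M]. *)
Let wave_difference k p (M E : R) :
  (forall j, `|phi1 p 0 j| <= M /\ `|phi2 p 0 j| <= M) ->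
  (forall j, `|dt phi1 p 0 j| <= M /\ `|dt phi2 p 0 j| <= M) ->
  (forall j, `|dx phi1 p 0 j| <= M /\ `|dx phi2 p 0 j| <= M) ->
  (forall j, [/\ `|d j p| <= E, `|a j p| <= E & `|b j p| <= E]) ->
  `|coordB (dt (dt phi1)) (dt (dt phi2)) k p - coordB (dx (dx phi1)) (dx (dx phi2)) k p|
    <= 6 * m%:R * M ^+ 2 * E.
Proof.
move=> B0 Bt Bx BE.
have M0 : 0 <= M := le_trans (normr_ge0 _) (B0 k).1.
have E0 : 0 <= E by have [h _ _] := BE k; exact: le_trans (normr_ge0 _) h.
have W (phi : R * R -> 'rV[R]_m) : wave_map_solution f phi ->
    dt (dt phi) p 0 k - dx (dx phi) p 0 k =
    (\sum_(j < m) dx phi p 0 j ^+ 2 - \sum_(j < m) dt phi p 0 j ^+ 2) * phi p 0 k.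
  case=> _ W _ _; exact: etrans (wave_coord k (W p))
    (congr2 (fun u v => (u - v) * phi p 0 k) (enorm_sqr _) (enorm_sqr _)).
have rearrange (u1 u2 v1 v2 : R) : (u1 + -1 * u2) - (v1 + -1 * v2) = (u1 - v1) - (u2 - v2).
  by ring.
rewrite /coordB rearrange.
apply: (quadratic_difference_le M0 (W _ H1) (W _ H2)).
- apply: sum_sqr_diff_le => j; [exact: (Bx j).1|exact: (Bx j).2|].
  by have [_ _] := BE j; rewrite /b /coordB mulN1r.
- apply: sum_sqr_diff_le => j; [exact: (Bt j).1|exact: (Bt j).2|].
  by have [_ + _] := BE j; rewrite /a /coordB mulN1r.
- by apply: sum_sqr_le => j; exact: (Bx j).2.
- by apply: sum_sqr_le => j; exact: (Bt j).2.
- exact: (B0 k).1.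
- by have [+ _ _] := BE k; rewrite /d /coordB mulN1r.
Qed.

Let d_initial k x : d k (0, x) = 0.
Proof.
have [_ _ I1 _] := H1; have [_ _ I2 _] := H2.
by rewrite /d /coordB I1 I2 mulN1r subrr.
Qed.

Let a_initial k x : a k (0, x) = 0.
Proof.
have [_ _ _ I1] := H1; have [_ _ _ I2] := H2.
by rewrite /a /coordB I1 I2 mulN1r subrr.
Qed.

Let b_initial k x : b k (0, x) = 0.
Proof.
have [_ _ _ dX _] := da k (0, x).
have D := is_derive_slice_x dX.
have D0 : is_derive x (1 : R) (fun y => d k (0, y)) 0.
  by apply: is_derive_ext (is_derive_constant 0 x 1) => y; rewrite d_initial.
exact: is_derive_unique D D0.
Qed.

Section Cone.
Variables (T x0 M : R).
Hypothesis bounds : forall t x, `|t| <= T -> `|x - x0| <= T -> forall j,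
  [/\ `|phi1 (t, x) 0 j| <= M /\ `|phi2 (t, x) 0 j| <= M,
      `|dt phi1 (t, x) 0 j| <= M /\ `|dt phi2 (t, x) 0 j| <= M &
      `|dx phi1 (t, x) 0 j| <= M /\ `|dx phi2 (t, x) 0 j| <= M].

(** [la] is at least [2 * L] and at least 2, so one integration halves both kinds of bound: [L * B]
    along null lines, [B] along the time axis. *)
Let L := 6 * m%:R * M ^+ 2.
Let la := 2 * (L + 1).

Let L0 : 0 <= L. Proof. by rewrite /L mulr_ge0 ?sqr_ge0// mulr_ge0. Qed.

Definition cone_bound (B : R) := forall t x, `|x - x0| <= T - `|t| -> forall j,
  [/\ `|d j (t, x)| <= B * expR (la * `|t|), `|a j (t, x)| <= B * expR (la * `|t|) &
      `|b j (t, x)| <= B * expR (la * `|t|)].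

(** [a] and [b] are controlled through [a + b] and [a - b], each integrated from time 0 along its
    own null line, and [d] by integrating [a] in time. All these paths stay in the cone. *)
Lemma cone_bound_half (B : R) : 0 <= B -> cone_bound B -> cone_bound (B / 2).
Proof.
move=> B0 HB t x xt k; have L0' := L0.
have la0 : 0 < la by rewrite mulr_gt0// ltr_wpDl.
have LBla : L * B <= la / 2 * B.
  by rewrite ler_wpM2r// /la mulrAC mulfV// mul1r lerDl.
have Bla : B <= la / 2 * B.
  by rewrite ler_peMl// /la mulrAC mulfV// mul1r lerDr.
have half (c : R) : 0 <= c -> c <= la / 2 * B ->
    c / la * expR (la * `|t|) <= B / 2 * expR (la * `|t|).
  move=> c0 cB; rewrite ler_wpM2r ?expR_ge0// ler_pdivrMr//.
  by rewrite mulrAC [B * _]mulrC mulrAC.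
have null (e : R) : e ^+ 2 = 1 -> `|e| = 1 ->
    `|a k (t, x) + e * b k (t, x)| <= B / 2 * expR (la * `|t|).
  move=> e2 e1.
  pose h (s : R) := a k (0 + s * 1, (x + e * t) + s * - e)
    + e * b k (0 + s * 1, (x + e * t) + s * - e).
  have -> : a k (t, x) + e * b k (t, x) = h t.
    have Ep : (t, x) = (0 + t * 1, x + e * t + t * - e) by congr pair; ring.
    exact: (congr1 (fun q => a k q + e * b k q) Ep).
  have h0 : h 0 = 0.
    have Ep : (0 + 0 * 1, x + e * t + 0 * - e) = (0, x + e * t) :> R * R.
      by congr pair; ring.
    apply: (etrans (congr1 (fun q => a k q + e * b k q) Ep)).
    by rewrite a_initial b_initial mulr0 addr0.
  have LB0 : 0 <= L * B by rewrite mulr_ge0.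
  apply: (le_trans (exp_compare la0 LB0 h0
    (fun s => is_derive_path (null_derivative k _ e2)) (t := t) _)); last first.
    exact: half.
  move=> s ts; rewrite -mulrA.
  (* Going back from [t] to [s], the null line moves by [|t| - |s|], exactly what the cone gains in
     width. *)
  have inK : `|x + e * t + s * - e - x0| <= T - `|s|.
    have -> : x + e * t + s * - e - x0 = (x - x0) + e * (t - s) by ring.
    rewrite (le_trans (ler_normD _ _))// normrM e1 mul1r ts; lra.
  have E1 : (0 + s * 1, x + e * t + s * - e) = (s, x + e * t + s * - e).
    by congr pair; ring.
  have sT : `|s| <= T by rewrite -subr_ge0; exact: le_trans inK.
  have xT : `|x + e * t + s * - e - x0| <= T.
    by rewrite (le_trans inK)// lerBlDr lerDl.
  have bd := bounds sT xT.
  rewrite E1; apply: wave_difference => j.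
  - by have [q _ _] := bd j; exact: q.
  - by have [_ q _] := bd j; exact: q.
  - by have [_ _ q] := bd j; exact: q.
  - exact: HB.
have n1 := null 1 (expr1n _ _) (normr1 _).
have n2 : `|a k (t, x) + -1 * b k (t, x)| <= B / 2 * expR (la * `|t|).
  by apply: null; rewrite ?sqrrN ?expr1n// normrN normr1.
have [na nb] := half_sum_le n1 n2.
split; [|exact: na|exact: nb].
have dts s : is_derive s (1 : R) (fun s => d k (s, x)) (a k (s, x)).
  by have [_ _ dT _ _] := da k (s, x); exact: is_derive_slice_t dT.
apply: (le_trans (exp_compare la0 B0 (d_initial k x) dts (t := t) _)); last first.
  exact: half.
move=> s ts; have xs : `|x - x0| <= T - `|s|.
  by rewrite (le_trans xt)// lerB// -subr_ge0 -ts.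
by have [_ ha _] := HB s x xs k; exact: ha.
Qed.

Lemma cone_bound_zero (B : R) : 0 <= B -> cone_bound B ->
  forall t x, `|x - x0| <= T - `|t| -> phi1 (t, x) = phi2 (t, x).
Proof.
move=> B0 HB t x xt; apply/rowP => k; apply/eqP; rewrite -subr_eq0 -normr_le0.
have Hn n : 0 <= B / 2 ^+ n /\ cone_bound (B / 2 ^+ n).
  elim: n => [|n [b0 IH]]; first by rewrite expr0 divr1.
  rewrite exprSr invfM mulrA; split; first by rewrite divr_ge0.
  exact: cone_bound_half.
apply: (@geometric_squeeze _ (B * expR (la * `|t|))) => n.
have [_ /(_ t x xt k)[+ _ _]] := Hn n.
by rewrite /d /coordB mulN1r mulrAC.
Qed.

End Cone.

Lemma bounded_family (I : finType) (P : I -> R -> Prop) :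
  (forall i, exists M : R, P i M) ->
  (forall i (M N : R), M <= N -> P i M -> P i N) ->
  exists M : R, forall i, P i M.
Proof.
move=> H mono; have [M HM] := choice H.
exists (\sum_i `|M i|) => i; apply: mono (HM i).
rewrite (bigD1 i)//= (le_trans (ler_norm _))// lerDl sumr_ge0//.
Qed.

Lemma six_upper_bound (M1 M2 M3 M4 M5 M6 : R) : exists M : R,
  [/\ 0 <= M, M1 <= M, M2 <= M, M3 <= M & [/\ M4 <= M, M5 <= M & M6 <= M]].
Proof.
exists (\big[Num.max/0]_(y <- [:: M1; M2; M3; M4; M5; M6]) y).
rewrite !big_cons big_nil !le_max !lexx !orbT.
by split.
Qed.

Lemma wave_map_unique : phi1 = phi2.
Proof.
apply/funext => -[t x0].
(* The given point is the apex of the cone. *)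
pose T := `|t|.
have bnd (F : R * R -> 'rV[R]_m) : continuous F -> exists M : R, forall j,
    forall t x : R, `|t| <= T -> `|x - x0| <= T -> `|F (t, x) 0 j| <= M.
  move=> cF; apply: (bounded_family (P := fun j M => forall t x : R,
    `|t| <= T -> `|x - x0| <= T -> `|F (t, x) 0 j| <= M)).
    move=> j; have [M HM] := @continuous_rectangle_bounded _ (fun p => F p 0 j) T x0
      (continuous_coord cF).
    exists M => s y sT yT; exact: HM.
  by move=> j M N MN H s y sT yT; exact: le_trans (H s y sT yT) MN.
have cdt (F : R * R -> 'rV[R]_m) : Ck 1 F -> continuous (dt F) by case.
have cdx (F : R * R -> 'rV[R]_m) : Ck 1 F -> continuous (dx F) by case.
have [M1 B1] := bnd _ (S1 0); have [M2 B2] := bnd _ (S2 0).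
have [M3 B3] := bnd _ (cdt _ (S1 1)); have [M4 B4] := bnd _ (cdt _ (S2 1)).
have [M5 B5] := bnd _ (cdx _ (S1 1)); have [M6 B6] := bnd _ (cdx _ (S2 1)).
have [M [M0 k1 k2 k3 [k4 k5 k6]]] := six_upper_bound M1 M2 M3 M4 M5 M6.
have bounds s y : `|s| <= T -> `|y - x0| <= T -> forall j,
  [/\ `|phi1 (s, y) 0 j| <= M /\ `|phi2 (s, y) 0 j| <= M,
      `|dt phi1 (s, y) 0 j| <= M /\ `|dt phi2 (s, y) 0 j| <= M &
      `|dx phi1 (s, y) 0 j| <= M /\ `|dx phi2 (s, y) 0 j| <= M].
  move=> sT yT j; split; split.
  - exact: le_trans (B1 j s y sT yT) k1.
  - exact: le_trans (B2 j s y sT yT) k2.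
  - exact: le_trans (B3 j s y sT yT) k3.
  - exact: le_trans (B4 j s y sT yT) k4.
  - exact: le_trans (B5 j s y sT yT) k5.
  - exact: le_trans (B6 j s y sT yT) k6.
have M20 : 0 <= 2 * M by rewrite mulr_ge0.
apply: (cone_bound_zero bounds M20); last by rewrite subrr normr0 subrr.
move=> s y ys j.
have sT : `|s| <= T by rewrite -subr_ge0; exact: le_trans ys.
have yT : `|y - x0| <= T by rewrite (le_trans ys)// lerBlDr lerDl.
have e1 : 2 * M <= 2 * M * expR (2 * (6 * m%:R * M ^+ 2 + 1) * `|s|).
  rewrite ler_peMr//; apply: le_trans (expR_ge1Dx _).
  rewrite lerDl mulr_ge0// mulr_ge0// addr_ge0//.
  by rewrite mulr_ge0 ?sqr_ge0// mulr_ge0.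
have [[h1 h2] [h3 h4] [h5 h6]] := bounds s y sT yT j.
have tri (u v : R) : `|u| <= M -> `|v| <= M -> `|u + -1 * v| <= 2 * M.
  move=> hu hv; rewrite mulN1r (le_trans (ler_normB _ _))//.
  by rewrite mulr_natl mulr2n lerD.
exact: And3 (le_trans (tri _ _ h1 h2) e1) (le_trans (tri _ _ h3 h4) e1)
  (le_trans (tri _ _ h5 h6) e1).
Qed.

End TwoSolutions.

End Uniqueness.

(** * Oscillatory integrals of plateau functions *)

Section Oscillatory.
Context {R : realType}.
Local Notation mu := (@lebesgue_measure R).

Lemma primitive_increment_le (F f : R -> R) (a b M : R) : a <= b ->
  (forall x : R, is_derive x (1 : R) F (f x)) ->
  (forall x, a <= x <= b -> `|f x| <= M) -> `|F b - F a| <= M * (b - a).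
Proof.
rewrite le_eqVlt => /predU1P[<- _ _|ab dF H]; first by rewrite !subrr normr0 mulr0.
have [c /andP[ac cb] ->] := mean_value ab (fun x _ => dF x).
rewrite normrM (@ger0_norm _ (b - a)) ?subr_ge0 ?(ltW ab)// ler_wpM2r ?subr_ge0 ?(ltW ab)//.
by rewrite H// (ltW ac) (ltW cb).
Qed.

Lemma integral_itv_primitive (F f : R -> R) (a b : R) : a < b -> continuous f ->
  (forall x : R, is_derive x (1 : R) F (f x)) ->
  (\int[mu]_(x in `[a, b]) (f x)%:E = (F b - F a)%:E)%E.
Proof.
move=> ab cf dF; rewrite (continuous_FTC2 ab (F := F)).
- by rewrite EFinB.
- exact: continuous_subspaceT.
- have cF := is_derive_continuous dF; split.
  + by move=> x _; case: (dF x).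
  + by apply: cvg_at_right_filter; exact: cF.
  + by apply: cvg_at_left_filter; exact: cF.
- by move=> x _; rewrite derive1E; case: (dF x).
Qed.

Lemma Rintegral_primitive (F f : R -> R) (A : R) : 0 < A -> continuous f ->
  (forall x : R, is_derive x (1 : R) F (f x)) ->
  (forall x, A <= `|x| -> f x = 0) ->
  \int[mu]_x f x = F A - F (- A).
Proof.
move=> A0 cf dF f0.
have -> : \int[mu]_x f x = \int[mu]_(x in `[- A, A]) f x.
  rewrite [RHS]Rintegral_mkcond; congr (Rintegral _ _ _); apply/funext => x.
  rewrite patchE; case: ifPn => //; rewrite notin_setE /= in_itv /= => /negP.
  by rewrite -ler_norml -ltNge => /ltW /f0.
rewrite /Rintegral (integral_itv_primitive _ cf dF)//.
by rewrite (lt_trans _ A0)// oppr_lt0.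
Qed.

Lemma cos_lipschitz (u v : R) : `|cos u - cos v| <= `|u - v|.
Proof.
wlog uv : u v / v <= u.
  by move=> H; case: (leP v u) => [/H//|/ltW /H]; rewrite distrC [leRHS]distrC.
have := primitive_increment_le (M := 1) uv (@is_derive_cos R).
rewrite mul1r (@ger0_norm _ (u - v)) ?subr_ge0//; apply => x _.
by rewrite normrN sin_max.
Qed.

Lemma sin_lipschitz (u v : R) : `|sin u - sin v| <= `|u - v|.
Proof.
wlog uv : u v / v <= u.
  by move=> H; case: (leP v u) => [/H//|/ltW /H]; rewrite distrC [leRHS]distrC.
have := primitive_increment_le (M := 1) uv (@is_derive_sin R).
rewrite mul1r (@ger0_norm _ (u - v)) ?subr_ge0//; apply => x _.
by rewrite cos_max.
Qed.

(** One coordinate of a time slice. [C] and [K] will not depend on [T], so all dependence on [T] in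
    the estimates is explicit. *)
Definition plateau (C K T h : R) (g g1 g2 : R -> R) :=
  [/\ forall x : R, is_derive x (1 : R) g (g1 x),
      forall x : R, is_derive x (1 : R) g1 (g2 x),
      continuous g2,
      forall x, [/\ `|g x| <= K, `|g1 x| <= K & `|g2 x| <= K] &
      (forall x, `|x| <= T - C -> g x = h) /\ (forall x, T + C <= `|x| -> g x = 0)].

Section Plateau.
Variables (C K T h : R) (g g1 g2 : R -> R).
Hypotheses (C0 : 0 < C) (CT : C < T) (T1 : 1 <= T).
Hypothesis G : plateau C K T h g g1 g2.

Local Ltac hlra := have := C0; have := CT; have := T1; lra.

Let A := T + C.
Let A0 : 0 < A. Proof. by rewrite /A; hlra. Qed.
Let T0 : 0 < T. Proof. hlra. Qed.

Let dg : forall x : R, is_derive x (1 : R) g (g1 x). Proof. by case: G. Qed.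
Let dg1 : forall x : R, is_derive x (1 : R) g1 (g2 x). Proof. by case: G. Qed.
Let cg : continuous g := is_derive_continuous dg.
Let cg1 : continuous g1 := is_derive_continuous dg1.
Let cg2 : continuous g2. Proof. by case: G. Qed.

Let K0 : 0 <= K.
Proof. by have [_ _ _ /(_ 0)[+ _ _] _] := G; apply: le_trans. Qed.

Let gK x : `|g x| <= K. Proof. by have [_ _ _ /(_ x)[]] := G. Qed.

Lemma derive_locally_constant (f f' : R -> R) (c : R) (P : R -> Prop) :
  (forall x : R, is_derive x (1 : R) f (f' x)) -> (forall x, P x -> f x = c) ->
  (forall x, P x -> \forall y \near x, P y) -> forall x, P x -> f' x = 0.
Proof.
move=> df Pc Pn x Px; have [_ <-] := df x.
have D : is_derive x (1 : R) f 0.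
  apply: near_eq_is_derive (is_derive_constant c x 1).
  by apply: filterS (Pn x Px) => y /Pc.
by case: D.
Qed.

Let near_norm_lt (x a : R) : `|x| < a -> \forall y \near x, `|y| < a.
Proof.
move=> xa; near=> y.
rewrite -[y](subrK x) (le_lt_trans (ler_normD _ _))// -ltrBrDr distrC.
near: y; apply: (@cvgr_dist_lt _ _ _ (nbhs x) _ id x); first exact: cvg_id.
by rewrite subr_gt0.
Unshelve. all: by end_near. Qed.

Let near_norm_gt (x a : R) : a < `|x| -> \forall y \near x, a < `|y|.
Proof.
move=> xa; near=> y.
have : `|x| <= `|x - y| + `|y| by rewrite -[X in `|X| <= _](subrK y) ler_normD.
suff : `|x - y| < `|x| - a by hlra.
near: y; apply: (@cvgr_dist_lt _ _ _ (nbhs x) _ id x); first exact: cvg_id.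
by rewrite subr_gt0.
Unshelve. all: by end_near. Qed.

Let off_transition (f : R -> R) := forall x, `|x| < T - C \/ A < `|x| -> f x = 0.

Let near_off (x : R) : `|x| < T - C \/ A < `|x| ->
  \forall y \near x, `|y| < T - C \/ A < `|y|.
Proof.
by case=> [/near_norm_lt|/near_norm_gt]; apply: filterS => y; [left|right].
Qed.

Let g1_off : off_transition g1.
Proof.
move=> x [xT|xT]; have [_ _ _ _ [gh g0]] := G.
- apply: (derive_locally_constant dg (c := h) (P := fun x => `|x| < T - C)) xT.
    by move=> y /ltW /gh.
  by move=> y; exact: near_norm_lt.
- apply: (derive_locally_constant dg (c := 0) (P := fun x => A < `|x|)) xT.
    by move=> y /ltW /g0.
  by move=> y; exact: near_norm_gt.
Qed.

Let g2_off : off_transition g2.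
Proof. exact: derive_locally_constant dg1 g1_off near_off. Qed.

(* The transition regions have total length [4 C], whatever [T]. *)
Let transition_integral_le (F f : R -> R) (M : R) :
  (forall x : R, is_derive x (1 : R) F (f x)) -> off_transition f ->
  (forall x, `|f x| <= M) -> `|F A - F (- A)| <= 4 * C * M.
Proof.
move=> dF f0 fM.
have h1 : `|F A - F (T - C)| <= M * (A - (T - C)).
  by apply: primitive_increment_le dF _; [rewrite /A; hlra|move=> x _; exact: fM].
have h2 : `|F (- (T - C)) - F (- A)| <= M * (- (T - C) - - A).
  by apply: primitive_increment_le dF _; [rewrite /A; hlra|move=> x _; exact: fM].
have h3 : F (T - C) = F (- (T - C)).
  have ab : - (T - C) < T - C by hlra.
  have [c /andP[c1 c2]] := mean_value ab (fun x _ => dF x).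
  rewrite f0 ?mul0r; last by left; rewrite ltr_norml c1.
  by move/eqP; rewrite subr_eq0 => /eqP.
have -> : F A - F (- A) = (F A - F (T - C)) + (F (- (T - C)) - F (- A)).
  by rewrite h3; ring.
rewrite (le_trans (ler_normD _ _))//.
by move: h1 h2; rewrite /A; hlra.
Qed.

(** * Integration by parts against a pair of waves, (cos, sin) or (sin, -cos) *)

Section Wave.
Variables (xi : R) (a b : R -> R).
Hypotheses (da : forall x : R, is_derive x (1 : R) a (- (xi * b x)))
  (db : forall x : R, is_derive x (1 : R) b (xi * a x))
  (a1 : forall x, `|a x| <= 1) (b1 : forall x, `|b x| <= 1).

Let ca : continuous a := is_derive_continuous da.
Let cb : continuous b := is_derive_continuous db.

Let g_out x : A <= `|x| -> g x = 0.
Proof. by have [_ _ _ _ [_]] := G; apply. Qed.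

Let cM (f1 f2 : R -> R) : continuous f1 -> continuous f2 ->
  continuous (fun x => f1 x * f2 x).
Proof. by move=> c1 c2 x; apply: cvgM; [exact: c1|exact: c2]. Qed.

Let nM (f1 f2 : R -> R) (M : R) x : `|f1 x| <= M -> `|f2 x| <= 1 -> `|f1 x * f2 x| <= M.
Proof.
move=> h1 h2; rewrite normrM -[M]mulr1 ler_pM//.
Qed.

Let out_A : A <= `|A| /\ A <= `|- A|.
Proof. by rewrite normrN gtr0_norm. Qed.

Let J := \int[mu]_x (g x * a x).

(** The support has length 2 (T + C), which is below 4 T. *)
Lemma plateau_integral_le_T : `|J| <= 4 * K * T.
Proof.
have [F [_ dF]] := continuous_has_primitive (cM cg ca).
rewrite /J (Rintegral_primitive A0 (cM cg ca) dF) => [|x /g_out ->]; last by rewrite mul0r.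
have AA : - A <= A by have := A0; hlra.
have := primitive_increment_le (M := K) AA dF (fun x _ => nM (gK x) (a1 x)).
move=> /le_trans; apply.
have -> : 4 * K * T = K * (4 * T) by ring.
by rewrite ler_wpM2l// /A; hlra.
Qed.

(** One integration by parts puts the derivative on [g], and [g1] lives on the transition layers
    only. *)
Lemma plateau_integral_le_1 : `|xi| * `|J| <= 4 * C * K.
Proof.
have [F [_ dF]] := continuous_has_primitive (cM cg ca).
rewrite /J (Rintegral_primitive A0 (cM cg ca) dF) => [|x /g_out ->]; last by rewrite mul0r.
have cgb := cM cg1 cb.
have [H [_ dH]] := continuous_has_primitive cgb.
have E : xi * (F A - F (- A)) + (H A - H (- A)) = g A * b A - g (- A) * b (- A).
  have D (x : R) : is_derive x (1 : R) (fun x => xi * F x + H x - g x * b x) 0.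
    apply: (is_derive_eq (is_derive_sub (is_derive_add (is_derive_mul
      (is_derive_constant xi x 1) (dF x)) (dH x)) (is_derive_mul (dg x) (db x)))).
    by ring.
  have := is_derive_0_is_cst A (- A) D; hlra.
rewrite !g_out ?out_A.1 ?out_A.2// !mul0r subrr in E.
rewrite -normrM (_ : xi * _ = - (H A - H (- A))); last by hlra.
rewrite normrN; apply: transition_integral_le dH _ _.
- by move=> x /g1_off ->; rewrite mul0r.
- by move=> x; apply: nM => //; have [_ _ _ /(_ x)[]] := G.
Qed.

(** A second integration by parts; this decay makes the high shells summable. *)
Lemma plateau_integral_le_2 : `|xi| ^+ 2 * `|J| <= 4 * C * K.
Proof.
have [F [_ dF]] := continuous_has_primitive (cM cg ca).
rewrite /J (Rintegral_primitive A0 (cM cg ca) dF) => [|x /g_out ->]; last by rewrite mul0r.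
have [H [_ dH]] := continuous_has_primitive (cM cg2 ca).
have g1_A x : A <= `|x| -> g1 x = 0.
  rewrite le_eqVlt => /predU1P[xA|xA]; last by apply: g1_off; right.
  (* by continuity, on the boundary of the support *)
  have [Fx|] := pselect (g1 x = 0); first by [].
  move=> /eqP g1x; exfalso.
  have c1 : {for x, continuous g1} := @cg1 x.
  move/cvgrPdist_lt : c1 => /(_ `|g1 x|); rewrite normr_gt0 => /(_ g1x).
  move=> /nbhs_ballP[d /= d0 Hd].
  pose y := x + Num.sg x * (d / 2).
  have x0 : x != 0 by rewrite -normr_gt0 -xA.
  have sx : `|Num.sg x| = 1 by rewrite normr_sg x0.
  have yb : ball x d y.
    rewrite /ball /= /y opprD addrA subrr sub0r normrN normrM sx mul1r gtr0_norm//; hlra.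
  have yA : A < `|y|.
    rewrite /y [x in x + _]numEsg -mulrDr normrM sx mul1r.
    have d20 : 0 < d / 2 by rewrite divr_gt0.
    by rewrite -xA gtr0_norm ?ltrDl// addr_gt0.
  by have := Hd _ yb; rewrite (g1_off (or_intror yA)) subr0 ltxx.
have E : xi ^+ 2 * (F A - F (- A)) + (H A - H (- A)) =
    (g A * xi * b A + g1 A * a A) - (g (- A) * xi * b (- A) + g1 (- A) * a (- A)).
  have D (x : R) : is_derive x (1 : R)
      (fun x => xi ^+ 2 * F x + H x - (g x * (xi * b x) + g1 x * a x)) 0.
    apply: (is_derive_eq (is_derive_sub (is_derive_add (is_derive_mul
      (is_derive_constant (xi ^+ 2) x 1) (dF x)) (dH x))
      (is_derive_add (is_derive_mul (dg x)
          (is_derive_mul (is_derive_constant xi x 1) (db x)))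
        (is_derive_mul (dg1 x) (da x))))).
    by ring.
  have := is_derive_0_is_cst A (- A) D; hlra.
rewrite !g_out ?g1_A ?out_A.1 ?out_A.2// !mul0r subrr in E.
rewrite -normrX -normrM (_ : xi ^+ 2 * _ = - (H A - H (- A))); last by hlra.
rewrite normrN; apply: transition_integral_le dH _ _.
- by move=> x /g2_off ->; rewrite mul0r.
- by move=> x; apply: nM => //; have [_ _ _ /(_ x)[]] := G.
Qed.

(** The subtracted term is [xi] times the integral of [h * a] over [[-T, T]]. There [g] differs from
    [h] on length [2 * C] by at most [2 * K]; the outer halves of the layers add [2 * C * K]. The
    total 6 is rounded up to 8. *)
Lemma plateau_integral_approx : `|h| <= K ->
  `|xi * J - h * (b T - b (- T))| <= 8 * C * K * `|xi|.
Proof.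
move=> hK.
have [F [_ dF]] := continuous_has_primitive (cM cg ca).
rewrite /J (Rintegral_primitive A0 (cM cg ca) dF) => [|x /g_out ->]; last by rewrite mul0r.
have [_ _ _ _ [gh _]] := G.
have B1 : `|F A - F T| <= K * (A - T).
  apply: primitive_increment_le dF _; first by rewrite /A; hlra.
  by move=> x _; exact: nM.
have B2 : `|F (- T) - F (- A)| <= K * (- T - - A).
  apply: primitive_increment_le dF _; first by rewrite /A; hlra.
  by move=> x _; exact: nM.
pose H x := xi * F x - h * b x.
have dH (x : R) : is_derive x (1 : R) H (xi * ((g x - h) * a x)).
  apply: (is_derive_eq (is_derive_sub (is_derive_mul (is_derive_constant xi x 1) (dF x))
    (is_derive_mul (is_derive_constant h x 1) (db x)))).
  by ring.
have HM x : `|xi * ((g x - h) * a x)| <= `|xi| * (2 * K).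
  rewrite normrM ler_wpM2l// (@nM (fun x => g x - h))//.
  by rewrite (le_trans (ler_normB _ _))// mulr_natl mulr2n lerD.
have B3 : `|H T - H (T - C)| <= `|xi| * (2 * K) * (T - (T - C)).
  by apply: primitive_increment_le dH _; [hlra|move=> x _; exact: HM].
have B4 : `|H (- (T - C)) - H (- T)| <= `|xi| * (2 * K) * (- (T - C) - - T).
  by apply: primitive_increment_le dH _; [hlra|move=> x _; exact: HM].
have B5 : H (T - C) = H (- (T - C)).
  have ab : - (T - C) < T - C by hlra.
  have [c /andP[c1 c2]] := mean_value ab (fun x _ => dH x).
  rewrite gh ?subrr ?mul0r ?mulr0 ?mul0r; last by rewrite ler_norml !ltW.
  by move/eqP; rewrite subr_eq0 => /eqP.
have -> : xi * (F A - F (- A)) - h * (b T - b (- T)) =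
   xi * ((F A - F T) + (F (- T) - F (- A))) +
   ((H T - H (T - C)) + (H (- (T - C)) - H (- T))).
  by rewrite B5 /H; ring.
have B12 : `|xi * ((F A - F T) + (F (- T) - F (- A)))| <= `|xi| * (2 * C * K).
  rewrite normrM ler_wpM2l// (le_trans (ler_normD _ _))//.
  by move: B1 B2; rewrite /A; hlra.
have B34 : `|(H T - H (T - C)) + (H (- (T - C)) - H (- T))| <= `|xi| * (4 * C * K).
  rewrite (le_trans (ler_normD _ _))//; move: B3 B4.
  have -> : `|xi| * (2 * K) * (T - (T - C)) = 2 * (`|xi| * C * K) by ring.
  have -> : `|xi| * (2 * K) * (- (T - C) - - T) = 2 * (`|xi| * C * K) by ring.
  have -> : `|xi| * (4 * C * K) = 4 * (`|xi| * C * K) by ring.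
  by hlra.
rewrite (le_trans (ler_normD _ _))// (le_trans (lerD B12 B34))//.
have P0 : 0 <= `|xi| * C * K by rewrite !mulr_ge0// ltW.
have -> : 8 * C * K * `|xi| = 8 * (`|xi| * C * K) by ring.
have -> : `|xi| * (2 * C * K) = 2 * (`|xi| * C * K) by ring.
have -> : `|xi| * (4 * C * K) = 4 * (`|xi| * C * K) by ring.
hlra.
Qed.

End Wave.

Let cosw (xi x : R) := cos (x * xi).
Let sinw (xi x : R) := sin (x * xi).

Let dlin (xi x : R) : is_derive x (1 : R) (fun x : R => x * xi) xi.
Proof.
apply: (is_derive_eq (is_derive_mul (is_derive_id x (1 : R)) (is_derive_constant xi x 1))).
by rewrite mulr0 add0r mulr1.
Qed.

Let dcos xi (x : R) : is_derive x (1 : R) (cosw xi) (- (xi * sinw xi x)).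
Proof.
apply: (is_derive_eq (@is_derive_comp R R cos (fun x : R => x * xi) x 1 _ _
  (is_derive_cos (x * xi)) (dlin xi x))).
by rewrite mulNr mulrC.
Qed.

Let dsin xi (x : R) : is_derive x (1 : R) (sinw xi) (xi * cosw xi x).
Proof.
apply: (is_derive_eq (@is_derive_comp R R sin (fun x : R => x * xi) x 1 _ _
  (is_derive_sin (x * xi)) (dlin xi x))).
by rewrite mulrC.
Qed.

Let dNcos xi (x : R) : is_derive x (1 : R) (fun x => - cosw xi x) (xi * sinw xi x).
Proof. by apply: (is_derive_eq (is_deriveN (dcos xi x))); rewrite opprK. Qed.

Let dsin' xi (x : R) : is_derive x (1 : R) (sinw xi) (- (xi * - cosw xi x)).
Proof. by apply: (is_derive_eq (dsin xi x)); rewrite mulrN opprK. Qed.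

Definition cosT (f : R -> R) (xi : R) := \int[mu]_x (f x * cos (x * xi)).
Definition sinT (f : R -> R) (xi : R) := \int[mu]_x (f x * sin (x * xi)).

Let Ncos_max (xi x : R) : `|- cosw xi x| <= 1.
Proof. by rewrite normrN cos_max. Qed.

Lemma plateau_fourier_le xi :
  [/\ `|cosT g xi| <= 4 * K * T, `|xi| * `|cosT g xi| <= 4 * C * K &
      `|xi| ^+ 2 * `|cosT g xi| <= 4 * C * K] /\
  [/\ `|sinT g xi| <= 4 * K * T, `|xi| * `|sinT g xi| <= 4 * C * K &
      `|xi| ^+ 2 * `|sinT g xi| <= 4 * C * K].
Proof.
split; split.
- exact: plateau_integral_le_T (dcos xi) (fun x => cos_max _).
- exact: plateau_integral_le_1 (dcos xi) (dsin xi) (fun x => sin_max _).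
- exact: plateau_integral_le_2 (dcos xi) (dsin xi) (fun x => cos_max _).
- exact: plateau_integral_le_T (dsin' xi) (fun x => sin_max _).
- exact: plateau_integral_le_1 (dsin' xi) (dNcos xi) (Ncos_max xi).
- exact: plateau_integral_le_2 (dsin' xi) (dNcos xi) (fun x => sin_max _).
Qed.

Lemma plateau_cosT_approx xi : `|h| <= K ->
  `|xi * cosT g xi - 2 * h * sin (T * xi)| <= 8 * C * K * `|xi|.
Proof.
move=> hK.
have := plateau_integral_approx (dcos xi) (dsin xi) (fun x => cos_max _) hK.
rewrite /sinw mulNr sinN.
by rewrite (_ : h * (_ - _) = 2 * h * sin (T * xi))//; ring.
Qed.

(** The transform is Lipschitz: on the support, a change of frequency moves the phase by at most [A]
    times as much. *)
Let wave_transform_continuous (w : R -> R) : continuous w ->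
  (forall x, `|w x| <= 1) -> (forall u v, `|w u - w v| <= `|u - v|) ->
  continuous (fun xi => \int[mu]_x (g x * w (x * xi))).
Proof.
move=> cw w1 wL.
have cgw xi : continuous (fun x => g x * w (x * xi)).
  move=> x; apply: cvgM; first exact: cg.
  apply: continuous_comp; last exact: cw.
  by apply: cvgM; [exact: cvg_id|exact: cvg_cst].
have [F HF] := choice (fun xi => continuous_has_primitive (cgw xi)).
have dF xi := (HF xi).2.
have E xi : \int[mu]_x (g x * w (x * xi)) = F xi A - F xi (- A).
  apply: Rintegral_primitive A0 (cgw xi) (dF xi) _ => x xA.
  by have [_ _ _ _ [_ ->]] := G; rewrite ?mul0r.
have lip xi eta : `|\int[mu]_x (g x * w (x * xi)) - \int[mu]_x (g x * w (x * eta))|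
    <= K * (A * `|xi - eta|) * (A - - A).
  rewrite !E.
  have -> : F xi A - F xi (- A) - (F eta A - F eta (- A)) =
    (F xi A - F eta A) - (F xi (- A) - F eta (- A)) by ring.
  have AA : - A <= A by have := A0; hlra.
  apply: (primitive_increment_le (F := fun x => F xi x - F eta x) AA
    (fun x => is_derive_sub (dF xi x) (dF eta x))) => x; rewrite -ler_norml => xA.
  rewrite -mulrBr normrM ler_pM//.
  by rewrite (le_trans (wL _ _))// -mulrBr normrM ler_wpM2r.
move=> xi; apply/cvgrPdist_le => /= e e0.
set L := K * A * (A - - A).
have L0 : 0 <= L by rewrite /L opprK !mulr_ge0 ?addr_ge0// ltW.
have d0 : 0 < e / (L + 1) by rewrite divr_gt0// ltr_wpDl.
near=> eta; apply: (le_trans (lip xi eta)).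
have -> : K * (A * `|xi - eta|) * (A - - A) = L * `|xi - eta| by rewrite /L; ring.
have : `|xi - eta| <= e / (L + 1).
  near: eta; apply: (@cvgr_dist_le _ _ _ (nbhs xi) _ id xi) => //; exact: cvg_id.
rewrite ler_pdivlMr ?ltr_wpDl// => H; apply: le_trans H.
by rewrite mulrC ler_wpM2l// lerDl.
Unshelve. all: by end_near. Qed.

Lemma cosT_continuous : continuous (cosT g).
Proof.
apply: wave_transform_continuous; [exact: continuous_cos|exact: cos_max|].
exact: cos_lipschitz.
Qed.

Lemma sinT_continuous : continuous (sinT g).
Proof.
apply: wave_transform_continuous; [exact: continuous_sin|exact: sin_max|].
exact: sin_lipschitz.
Qed.

End Plateau.

End Oscillatory.

(** * Dyadic shells *)

Section DyadicShells.
Context {R : realType}.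
Local Notation mu := (@lebesgue_measure R).
Implicit Types (j : int) (xi : R).

Definition shell j : set R :=
  [set xi : R | ((2 : R) ^ j <= `|xi| < (2 : R) ^ (j + 1))%R].

Lemma pow2_gt0 j : 0 < (2 : R) ^ j.
Proof. by rewrite exprz_gt0. Qed.

Lemma pow2S j : (2 : R) ^ (j + 1) = 2 * 2 ^ j.
Proof. by rewrite expfzDr// expr1z mulrC. Qed.

Lemma pow2_le j k : (j <= k)%R -> (2 : R) ^ j <= 2 ^ k.
Proof. by move=> jk; rewrite ler_weXz2l// ler1n. Qed.

Lemma measurable_shell j : measurable (shell j).
Proof.
have -> : shell j = (fun x : R => `|x|) @^-1` `[(2 : R) ^ j, (2 : R) ^ (j + 1)[.
  by apply/seteqP; split => x; rewrite /shell /= in_itv.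
rewrite -[X in measurable X]setTI.
have m : measurable_fun setT (fun x : R => `|x|).
  by apply: continuous_measurable_fun => x; exact: norm_continuous.
exact: m.
Qed.

Lemma shell_trivial j k xi : shell j xi -> shell k xi -> j = k.
Proof.
wlog jk : j k / (j < k)%R.
  by move=> H hj hk; have [/H|/H h|//] := ltgtP j k; [apply|rewrite h].
move=> /andP[_ h1] /andP[h2 _].
have h3 : (2 : R) ^ (j + 1) <= 2 ^ k by apply: pow2_le; rewrite lezD1.
by have := lt_le_trans h1 (le_trans h3 h2); rewrite ltxx.
Qed.

Lemma shell_cover xi : xi != 0 -> exists j, shell j xi.
Proof.
move=> x0; have n0 : 0 < `|xi| by rewrite normr_gt0.
have l2 : 0 < ln 2 :> R by rewrite ln_gt0// ltr1n.
have E (j : int) : (2 : R) ^ j = expR (j%:~R * ln 2).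
  by rewrite -powR_intmul// /powR ifF//; apply/negbTE; rewrite pnatr_eq0.
exists (Num.floor (ln `|xi| / ln 2)); rewrite /shell /= !E.
rewrite -{2 3}(lnK (_ : `|xi| \is Num.pos)) ?posrE// ler_expR ltr_expR.
rewrite -ler_pdivlMr// -ltr_pdivrMr//.
by rewrite Num.Theory.floor_le// Num.Theory.floorD1_gt.
Qed.

(** The enumeration 0, -1, 1, -2, ... turns sums over shells into series. *)
Definition zigzag (n : nat) : int := if odd n then Negz n./2 else Posz n./2.

Lemma zigzag_bij : set_bij setT setT zigzag.
Proof.
split=> // [n k _ _|[n|n] _].
  rewrite /zigzag; case: (boolP (odd n)) => on; case: (boolP (odd k)) => ok//.
    by case=> h; rewrite -(odd_double_half n) -(odd_double_half k) on ok h.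
  by case=> h; rewrite -(odd_double_half n) -(odd_double_half k) (negbTE on) (negbTE ok) h.
- by exists n.*2 => //; rewrite /zigzag odd_double doubleK.
- by exists n.*2.+1 => //; rewrite /zigzag /= odd_double /= uphalf_double.
Qed.

(** * Shell sums of a spectral density under the three decay bounds *)

Section Spectrum.
Variables (S : R -> R) (B T : R).
Hypotheses (cS : continuous S) (S0 : forall xi, 0 <= S xi) (B0 : 0 < B) (T0 : 0 < T)
  (S1 : forall xi, S xi <= (B * T) ^+ 2)
  (S2 : forall xi, `|xi| ^+ 2 * S xi <= B ^+ 2)
  (S3 : forall xi, `|xi| ^+ 4 * S xi <= B ^+ 2).

Let I j : \bar R := (\int[mu]_(xi in shell j) (S xi)%:E)%E.

Definition shell_weight j : R := Num.sqrt (2 ^ j * fine (I j)).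

Let mS (D : set R) : measurable_fun D (fun xi => (S xi)%:E).
Proof.
apply/measurable_EFinP; apply: measurable_funTS.
exact: continuous_measurable_fun.
Qed.

Let I_le j (M : R) : 0 <= M -> (forall xi, shell j xi -> S xi <= M) ->
  (I j <= (4 * M * 2 ^ j)%:E)%E.
Proof.
move=> M0 HM.
have h1 : (I j <= \int[mu]_(xi in shell j) cst M%:E xi)%E.
  apply: ge0_le_integral.
  - exact: measurable_shell.
  - by move=> x _; rewrite lee_fin.
  - exact: mS.
  - exact: measurable_cst.
  - by move=> x xj; rewrite lee_fin; exact: HM.
rewrite (le_trans h1)// integral_cst; last exact: measurable_shell.
have h2 : (mu (shell j) <= mu `[(- 2 ^ (j + 1))%R, (2 ^ (j + 1))%R]%classic)%E.
  apply: le_measure; rewrite ?inE.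
  - exact: measurable_shell.
  - exact: measurable_itv.
  - by move=> x /andP[_ /ltW xj]; rewrite /= in_itv /= -ler_norml.
rewrite (le_trans (lee_wpmul2l _ h2)) ?lee_fin// lebesgue_measure_itv /=.
rewrite lte_fin ifT; last by have := pow2_gt0 (j + 1); lra.
by rewrite -EFinB -EFinM lee_fin pow2S; lra.
Qed.

Let I_ge0 j : (0 <= I j)%E.
Proof. by apply: integral_ge0 => x _; rewrite lee_fin. Qed.

Let I_fin j : I j = (fine (I j))%:E.
Proof.
rewrite fineK// ge0_fin_numE// (le_lt_trans _ (ltry (4 * (B * T) ^+ 2 * 2 ^ j)))//.
by apply: I_le; rewrite ?sqr_ge0.
Qed.

Lemma shell_weight_ge0 j : 0 <= shell_weight j.
Proof. exact: sqrtr_ge0. Qed.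

Lemma shell_weight_sqr j : shell_weight j ^+ 2 = 2 ^ j * fine (I j).
Proof. by rewrite sqr_sqrtr// mulr_ge0 ?fine_ge0// ltW// pow2_gt0. Qed.

Lemma shell_weightE j : ((2 `^ (j%:~R / 2))%:E *
  (\int[mu]_(xi in shell j) (S xi)%:E) `^ 2^-1 = (shell_weight j)%:E)%E.
Proof.
rewrite -/(I j) I_fin poweR_EFin -EFinM; congr EFin.
rewrite powRrM powR_intmul// powR12_sqrt ?(ltW (pow2_gt0 j))//.
by rewrite powR12_sqrt ?fine_ge0// -sqrtrM ?(ltW (pow2_gt0 j)).
Qed.

(** Applied with [x] equal to [B * T], [B / 2 ^ j] and [B / 4 ^ j] for the low, middle and high
    regimes. *)
Let shell_weight_le j (x : R) : 0 <= x -> (forall xi, shell j xi -> S xi <= x ^+ 2) ->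
  shell_weight j <= 2 * x * 2 ^ j.
Proof.
move=> x0 Hx; have p0 := pow2_gt0 j.
have y0 : 0 <= 2 * x * 2 ^ j by rewrite !mulr_ge0// ltW.
rewrite -[leRHS]ger0_norm// -sqrtr_sqr ler_wsqrtr//.
have := I_le (sqr_ge0 x) Hx; rewrite I_fin lee_fin => H.
have -> : (2 * x * 2 ^ j) ^+ 2 = 2 ^ j * (4 * x ^+ 2 * 2 ^ j) by ring.
by rewrite ler_wpM2l// ltW.
Qed.

Lemma shell_weight_le_low j : shell_weight j <= 2 * (B * T) * 2 ^ j.
Proof.
apply: shell_weight_le => [|xi _]; last exact: S1.
by rewrite mulr_ge0// ltW.
Qed.

Lemma shell_weight_le_mid j : shell_weight j <= 2 * B.
Proof.
have p0 := pow2_gt0 j.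
have := @shell_weight_le j (B / 2 ^ j); rewrite mulrA mulfVK ?gt_eqF//; apply.
  by rewrite divr_ge0// ltW.
move=> xi /andP[h _]; rewrite expr_div_n ler_pdivlMr ?exprn_gt0//.
apply: le_trans (S2 xi); rewrite mulrC ler_wpM2r// ler_pXn2r ?nnegrE// ltW//.
Qed.

Lemma shell_weight_le_high j : shell_weight j <= 2 * B / 2 ^ j.
Proof.
have p0 := pow2_gt0 j.
have := @shell_weight_le j (B / (2 ^ j) ^+ 2).
have -> : 2 * (B / (2 ^ j) ^+ 2) * 2 ^ j = 2 * B / 2 ^ j :> R.
  by field; rewrite gt_eqF.
apply; first by rewrite divr_ge0 ?exprn_ge0// ltW.
move=> xi /andP[h _]; rewrite expr_div_n ler_pdivlMr ?exprn_gt0//.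
apply: le_trans (S3 xi); rewrite mulrC ler_wpM2r// -exprM.
by rewrite ler_pXn2r ?nnegrE// ltW.
Qed.

Let half : R := 2^-1.

(** Closed forms of partial sums. [Vp] adds 1, 1/2, 1/4, ... for the shells [j >= 0]; [Vn] adds [n0]
    ones and then 1/2, 1/4, ... for the shells [j < 0]. *)
Let Vp (q : nat) : R := 2 - 2 * half ^+ q.
Let Vn (n0 q : nat) : R := if (q <= n0)%N then q%:R else n0%:R + (1 - half ^+ (q - n0)).

Let half_ge0 q : 0 <= half ^+ q.
Proof. by rewrite exprn_ge0// /half invr_ge0. Qed.

Let VnS n0 q : Vn n0 q.+1 - Vn n0 q = if (q < n0)%N then 1 else half ^+ (q.+1 - n0).
Proof.
rewrite /Vn; have [qn|qn] := ltnP q n0.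
  by rewrite (ltnW qn) -natr1 addrAC subrr add0r.
rewrite subSn// exprS; have [qn'|qn'] := leqP q n0.
  have -> : q = n0 by apply/eqP; rewrite eqn_leq qn' qn.
  by rewrite subnn expr0 /half; field.
by rewrite /half; field.
Qed.

Let Vn_le n0 q : Vn n0 q <= n0%:R + 1.
Proof.
rewrite /Vn; case: ifPn => h; first by rewrite -[leLHS]addr0 lerD// ler_nat.
by rewrite lerD2l lerBlDr lerDl.
Qed.

(* Low shells contribute a geometric series, the [n0] shells with
   [1 / T <= 2 ^ j <= 1] at most [2 * B] each, high shells a geometric series. *)
Lemma besov_le (n0 : nat) : T <= 2 ^+ n0 ->
  (\esum_(j in [set: int]) (shell_weight j)%:E <= (2 * B * (n0%:R + 3))%:E)%E.
Proof.
move=> Tn; rewrite (reindex_esum setT setT zigzag); last exact: zigzag_bij.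
have w0 n : (0 <= (shell_weight (zigzag n))%:E)%E by rewrite lee_fin shell_weight_ge0.
rewrite -nneseries_esumT//; apply: lime_le; first by apply: is_cvg_nneseries => n _ _.
apply: nearW => n; rewrite sumEFin lee_fin.
(* Among the first [n] shells of the enumeration, [uphalf n] have [j >= 0] and [n./2] have
   [j < 0]. *)
suff H : \sum_(0 <= i < n) shell_weight (zigzag i) <= 2 * B * (Vp (uphalf n) + Vn n0 n./2).
  apply: (le_trans H); rewrite ler_wpM2l ?mulr_ge0 ?(ltW B0)//.
  have := Vn_le n0 n./2; have := half_ge0 (uphalf n); rewrite /Vp; lra.
have B20 : 0 <= 2 * B by rewrite mulr_ge0// ltW.
elim: n => [|n IH].
  by rewrite big_geq// mulr_ge0// /Vp /Vn /= expr0 mulr1 subrr addr0.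
rewrite big_nat_recr//=; apply: (le_trans (lerD IH (lexx _))).
rewrite -lerBrDl -mulrBr uphalf_half /zigzag; set q := n./2.
have pV (m : nat) : (2 : R) ^ (- m%:Z) = half ^+ m by rewrite -exprnN /half exprVn.
case: (boolP (odd n)) => _ /=.
  rewrite add1n (_ : _ - _ = Vn n0 q.+1 - Vn n0 q); last by ring.
  rewrite VnS; have [qn|qn] := ltnP q n0; first by rewrite mulr1 shell_weight_le_mid.
  apply: (le_trans (shell_weight_le_low _)).
  have -> x : 2 * (B * T) * x = 2 * B * (T * x) by ring.
  rewrite ler_wpM2l// NegzE pV.
  apply: (le_trans (ler_wpM2r (half_ge0 _) Tn)).
  by rewrite -{1}(subnK (leqW qn)) exprD mulrCA /half -exprMn mulfV// expr1n mulr1.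
rewrite add0n (_ : _ - _ = half ^+ q); last by rewrite /Vp exprS /half; field.
apply: (le_trans (shell_weight_le_high _)).
by rewrite ler_wpM2l// -exprnP -exprVn.
Qed.

Let shell_integral_le j :
  (\int[mu]_(xi in shell j) (`|xi| * S xi)%:E <= (4 * B)%:E * (shell_weight j)%:E)%E.
Proof.
have p0 := pow2_gt0 j.
have h1 : (\int[mu]_(xi in shell j) (`|xi| * S xi)%:E <=
    \int[mu]_(xi in shell j) ((2 ^ (j + 1))%:E * (S xi)%:E))%E.
  apply: ge0_le_integral.
  - exact: measurable_shell.
  - by move=> x _; rewrite lee_fin mulr_ge0.
  - apply/measurable_EFinP; apply: measurable_funTS; apply: measurable_funM.
      exact: normr_measurable.
    exact: continuous_measurable_fun.
  - apply: measurable_funeM; exact: mS.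
  - by move=> x /andP[_ /ltW xj]; rewrite -EFinM lee_fin ler_wpM2r.
rewrite (le_trans h1)// ge0_integralZl_EFin; last 4 first.
- exact: measurable_shell.
- by move=> x _; rewrite lee_fin.
- exact: mS.
- by rewrite ltW// pow2_gt0.
rewrite -/(I j) I_fin -!EFinM lee_fin pow2S -mulrA -shell_weight_sqr expr2 mulrA.
rewrite ler_wpM2r ?shell_weight_ge0//; have := shell_weight_le_mid j; lra.
Qed.

(* Each shell carries [H^{1/2}] energy at most twice the square of its Besov
   weight, and these weights are uniformly bounded. *)
Lemma sobolev_le_besov : (\int[mu]_xi (`|xi| * S xi)%:E <=
  (4 * B)%:E * \esum_(j in [set: int]) (shell_weight j)%:E)%E.
Proof.
pose f xi := (`|xi| * S xi)%:E.
pose F n := shell (zigzag n).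
have mf : measurable_fun setT f.
  apply/measurable_EFinP; apply: measurable_funM; first exact: normr_measurable.
  exact: continuous_measurable_fun.
have f0 x : (0 <= f x)%E by rewrite lee_fin mulr_ge0.
have -> : (\int[mu]_xi f xi = \int[mu]_(xi in \bigcup_n F n) f xi)%E.
  rewrite [RHS]integral_mkcond; apply: eq_integral => x _; rewrite patchE.
  case: ifPn => //; rewrite notin_setE => nF.
  have [->|/shell_cover[j xj]] := eqVneq x 0; first by rewrite /f normr0 mul0r.
  exfalso; apply: nF; have I0 : [set: int] j by [].
  have [_ _ sur] := zigzag_bij.
  by have [n _ nj] := sur j I0; exists n => //; rewrite /F nj.
rewrite ge0_integral_bigcup.
- rewrite (reindex_esum setT setT zigzag); last exact: zigzag_bij.
  rewrite -nneseries_esumT; last by move=> n; rewrite lee_fin shell_weight_ge0.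
  rewrite -nneseriesZl; last by move=> n _; rewrite lee_fin shell_weight_ge0.
  apply: lee_nneseries => n _; first by move=> _; apply: integral_ge0.
  exact: shell_integral_le.
- by move=> n; exact: measurable_shell.
- exact: measurable_funTS.
- by [].
- apply/trivIsetP => i k _ _ ik; rewrite -subset0 => x [xi xk] /=.
  have [_ inj _] := zigzag_bij.
  by move/eqP : ik; apply; apply: inj; rewrite ?inE//; exact: shell_trivial xi xk.
Qed.

Let cxS : continuous (fun xi => `|xi| * S xi).
Proof.
move=> x; apply: cvgM; last exact: cS.
exact: norm_continuous.
Qed.

Lemma sobolev_ge (h K1 : R) : 1 < T ->
  (forall xi, 0 < xi <= 1 -> 2 * h ^+ 2 * sin (T * xi) ^+ 2 - K1 ^+ 2 * xi ^+ 2
     <= xi ^+ 2 * S xi) ->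
  ((h ^+ 2 * ln T - (h ^+ 2 + K1 ^+ 2))%:E <= \int[mu]_xi (`|xi| * S xi)%:E)%E.
Proof.
move=> T1 H.
have [F [_ dF]] := continuous_has_primitive cxS.
have T10 : T^-1 < 1 by rewrite invf_lt1.
have Ti : 0 < T^-1 by rewrite invr_gt0.
have h1 : ((F 1 - F T^-1)%:E <= \int[mu]_xi (`|xi| * S xi)%:E)%E.
  rewrite -(integral_itv_primitive T10 cxS dF).
  apply: ge0_subset_integral => //.
    apply/measurable_EFinP; exact: continuous_measurable_fun.
  by move=> x _; rewrite lee_fin mulr_ge0.
apply: le_trans h1; rewrite lee_fin.
(* a primitive of a lower bound for [2 h^2 sin (T x)^2 / x - K1^2 x] *)
pose G (x : R) := h ^+ 2 * (ln x - sin (2 * T * x) * (2 * T * x)^-1 + (2 * T * x)^-1)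
  - K1 ^+ 2 / 2 * (x * x).
pose v (x : R) := - (2 * T * x) ^- 2 * (2 * T).
pose dG (x : R) := h ^+ 2 * ((x^-1 - (sin (2 * T * x) * v x
  + (2 * T * x)^-1 * (cos (2 * T * x) * (2 * T)))) + v x) - K1 ^+ 2 * x.
have dGP (x : R) : 0 < x -> is_derive x (1 : R) G (dG x).
  move=> x0; have Tx0 : 2 * T * x != 0 by rewrite gt_eqF// !mulr_gt0.
  have dl : is_derive x (1 : R) (fun x : R => 2 * T * x) (2 * T).
    apply: (is_derive_eq (is_derive_mul (is_derive_constant (2 * T) x 1)
      (is_derive_id x (1 : R)))).
    by rewrite mulr1 mulr0 addr0.
  have dV := @is_deriveV R (fun x : R => 2 * T * x) x _ 1 Tx0 dl.
  have ds := @is_derive_comp R R sin (fun x : R => 2 * T * x) x 1 _ _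
    (is_derive_sin (2 * T * x)) dl.
  have ci (c : R) := is_derive_constant c x (1 : R).
  have di := is_derive_id x (1 : R).
  apply: (is_derive_eq (is_derive_sub (is_derive_mul (ci (h ^+ 2))
    (is_derive_add (is_derive_sub (is_derive1_ln x0) (is_derive_mul ds dV)) dV))
    (is_derive_mul (ci (K1 ^+ 2 / 2)) (is_derive_mul di di)))).
  have [xn Tn] : x != 0 /\ T != 0 by rewrite !gt_eqF.
  by rewrite /dG /v /GRing.scale /=; field; rewrite ?xn ?Tn.
have dG_le (x : R) : 0 < x <= 1 -> dG x <= `|x| * S x.
  move=> /andP[x0 x1]; rewrite gtr0_norm//.
  rewrite -(ler_pM2l x0) mulrA -expr2.
  apply: le_trans (H x _); last by rewrite x0.
  have -> : x * dG x = h ^+ 2 * (1 - cos (2 * T * x))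
      - K1 ^+ 2 * x ^+ 2 - h ^+ 2 * ((1 - sin (2 * T * x)) * (2 * T * x)^-1).
    by rewrite /dG /v; field; rewrite !gt_eqF.
  have -> : 2 * T * x = T * x *+ 2 by rewrite -mulrA mulr_natl.
  rewrite cos_mulr2n cos2sin2.
  have P0 : 0 <= h ^+ 2 * ((1 - sin (T * x *+ 2)) * (T * x *+ 2)^-1).
    rewrite mulr_ge0 ?sqr_ge0// mulr_ge0 ?subr_ge0 ?sin_le1// invr_ge0 mulrn_wge0//.
    by rewrite mulr_ge0// ltW.
  by lra.
have GF : G 1 - G T^-1 <= F 1 - F T^-1.
  have [x /andP[Tx x1]|c /andP[c0 c1] E] := mean_value T10
    (f := fun x => F x - G x) (df := fun x => `|x| * S x - dG x).
    exact: is_derive_sub (dF x) (dGP x (lt_le_trans Ti Tx)).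
  have : 0 <= (`|c| * S c - dG c) * (1 - T^-1).
    rewrite mulr_ge0 ?subr_ge0 ?(ltW T10)//; apply: dG_le.
    by rewrite (lt_trans Ti c0) ltW.
  by rewrite -E; lra.
apply: le_trans GF; rewrite /G ln1 lnV ?posrE// mulr1.
have -> : 2 * T * T^-1 = 2 by field; rewrite gt_eqF.
have T2 : 0 <= (2 * T)^-1 by rewrite invr_ge0 mulr_ge0// ltW.
have Q1 : 0 <= h ^+ 2 * ((1 - sin (2 * T)) * (2 * T)^-1).
  by rewrite mulr_ge0 ?sqr_ge0// mulr_ge0// subr_ge0 sin_le1.
have Q2 : 0 <= h ^+ 2 * (1 + sin 2).
  by rewrite mulr_ge0 ?sqr_ge0//; have := sin_geN1 (2 : R); lra.
have Q3 : 0 <= K1 ^+ 2 / 2 * (T^-1 * T^-1).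
  by apply: mulr_ge0; [rewrite mulr_ge0 ?sqr_ge0|rewrite mulr_ge0// ltW].
have Q4 : 0 <= K1 ^+ 2 by rewrite sqr_ge0.
have -> : h ^+ 2 * (0 - sin (2 * T) / (2 * T) + (2 * T)^-1) - K1 ^+ 2 / 2 * (1 * 1)
   - (h ^+ 2 * (- ln T - sin 2 / 2 + 2^-1) - K1 ^+ 2 / 2 * (T^-1 * T^-1)) =
   h ^+ 2 * ((1 - sin (2 * T)) * (2 * T)^-1) + h ^+ 2 * ln T
   + h ^+ 2 * (1 + sin 2) / 2 - h ^+ 2 + K1 ^+ 2 / 2 * (T^-1 * T^-1) - K1 ^+ 2 / 2.
  by move: ((2 * T)^-1) (T^-1) => y z; field.
lra.
Qed.

End Spectrum.

End DyadicShells.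

(** * Logarithmic growth *)

Section Growth.
Context {R : realType}.
Local Notation mu := (@lebesgue_measure R).

Lemma continuous_sum_fin (I : finType) (F : I -> R -> R) :
  (forall i, continuous (F i)) -> continuous (fun x => \sum_i F i x).
Proof.
move=> cF; rewrite (_ : (fun x => _) = (fun x => \sum_(i <- index_enum I) F i x))//.
elim: (index_enum I) => [|i r IH].
  rewrite (_ : (fun x => _) = (fun=> 0)); first by move=> x; exact: cst_continuous.
  by apply/funext => x; rewrite big_nil.
rewrite (_ : (fun x => _) = (fun x => F i x + \sum_(i <- r) F i x)).
  by move=> x; apply: cvgD; [exact: cF|exact: IH].
by apply/funext => x; rewrite big_cons.
Qed.

Lemma sqrt_le_poweR (a : R) (x : \bar R) : 0 <= a -> (a%:E <= x)%E ->
  ((Num.sqrt a)%:E <= x `^ 2^-1)%E.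
Proof.
move=> a0 ax; rewrite -powR12_sqrt// -poweR_EFin.
by apply: gt0_ler_poweR; rewrite ?in_itv /= ?lee_fin ?leey ?andbT// (le_trans _ ax)// lee_fin.
Qed.

Lemma poweR_le_sqrt (a : R) (x : \bar R) : (0 <= x)%E -> (x <= a%:E)%E ->
  (x `^ 2^-1 <= (Num.sqrt a)%:E)%E.
Proof.
move=> x0 xa; have a0 : 0 <= a by rewrite -lee_fin (le_trans x0).
rewrite -powR12_sqrt// -poweR_EFin.
by apply: gt0_ler_poweR; rewrite ?in_itv /= ?lee_fin ?leey ?andbT.
Qed.

Section PlateauSlices.
Variables (m : nat) (C K T : R) (g : R -> 'rV[R]_m) (g1 g2 : 'I_m -> R -> R)
  (h : 'rV[R]_m) (j0 : 'I_m).
Hypotheses (C0 : 0 < C) (CT : C < T) (T1 : 1 < T) (K0 : 0 < K).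
Hypothesis G : forall j, plateau C K T (h 0 j) (fun x => g x 0 j) (g1 j) (g2 j).
Hypothesis hK : `|h 0 j0| <= K.

Let S (xi : R) := cnorm (fourier g xi) ^+ 2.
Let P j := cosT (fun x => g x 0 j).
Let Q j := sinT (fun x => g x 0 j).

Let SE xi : S xi = \sum_(j < m) (P j xi ^+ 2 + Q j xi ^+ 2).
Proof.
rewrite /S /cnorm sqr_sqrtr.
  by apply: eq_bigr => j _; rewrite mxE /= sqrrN.
by apply: sumr_ge0 => j _; rewrite addr_ge0 ?sqr_ge0.
Qed.

Let S0 xi : 0 <= S xi. Proof. exact: sqr_ge0. Qed.

Let cS : continuous S.
Proof.
rewrite (_ : S = (fun xi => \sum_(j < m) (P j xi * P j xi + Q j xi * Q j xi))).
  apply: continuous_sum_fin => j xi.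
  have cP := @cosT_continuous _ _ _ _ _ _ _ _ C0 CT (ltW T1) (G j) xi.
  have cQ := @sinT_continuous _ _ _ _ _ _ _ _ C0 CT (ltW T1) (G j) xi.
  by apply: cvgD; apply: cvgM.
by apply/funext => xi; rewrite SE; apply: eq_bigr => j _; rewrite !expr2.
Qed.

(** Dominates both [4 * K] and [4 * C * K], the constants of the three decay bounds. *)
Let K1 := 4 * K * (1 + C).
Definition spectral_bound := 2 * m%:R * K1.
Let B := spectral_bound.

Let m1 : 1 <= m%:R :> R.
Proof. by rewrite ler1n; case: (m) j0 => [[]|]. Qed.

Let K10 : 0 < K1.
Proof. by rewrite !mulr_gt0// addr_gt0. Qed.

Let B0 : 0 < B.
Proof.
have m0 : 0 < m%:R :> R := lt_le_trans ltr01 m1.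
by rewrite /B /spectral_bound mulr_gt0 ?K10// mulr_gt0.
Qed.

(** [S] is a sum of [2 * m] squares, and [2 * m <= (2 * m) ^+ 2] hides this number in [B]. The
    weight [a] will be 1, [|xi|] or [|xi| ^+ 2]. *)
Let weighted_le (a b y : R) : 0 <= b ->
  (forall j, a * `|P j y| <= K1 * b) -> (forall j, a * `|Q j y| <= K1 * b) -> 0 <= a ->
  a ^+ 2 * S y <= (B * b) ^+ 2.
Proof.
move=> b0 HP HQ a0.
have sq z : a * `|z| <= K1 * b -> a ^+ 2 * z ^+ 2 <= (K1 * b) ^+ 2.
  move=> H; rewrite -(real_normK (num_real z)) -exprMn.
  by rewrite ler_pXn2r ?nnegrE// mulr_ge0// ltW.
rewrite SE mulr_sumr.
apply: (@le_trans _ _ (\sum_(j < m) 2 * (K1 * b) ^+ 2)).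
  by apply: ler_sum => j _; rewrite mulrDr mulr_natl mulr2n lerD ?sq.
rewrite sumr_const card_ord.
rewrite -[leLHS]mulr_natl /B /spectral_bound.
have -> : (2 * m%:R * K1 * b) ^+ 2 = (2 * m%:R) * (m%:R * (2 * (K1 * b) ^+ 2)) by ring.
have nn : 0 <= m%:R * (2 * (K1 * b) ^+ 2) by rewrite mulr_ge0// mulr_ge0 ?sqr_ge0.
rewrite ler_peMl//.
by rewrite (le_trans m1)// mulr_natl mulr2n lerDl.
Qed.

Let four_le j y := @plateau_fourier_le _ _ _ _ _ _ _ _ C0 CT (ltW T1) (G j) y.

Let K1T : 4 * K * T <= K1 * T.
Proof.
by rewrite ler_wpM2r ?ler_peMr ?mulr_ge0 ?(ltW K0) ?(le_trans _ (ltW T1))// lerDl ltW.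
Qed.

Let K1C : 4 * C * K <= K1.
Proof.
have -> : 4 * C * K = 4 * K * C by ring.
by rewrite ler_wpM2l ?mulr_ge0 ?(ltW K0)// lerDr.
Qed.

Let T0 : 0 < T. Proof. exact: lt_trans T1. Qed.

Let S1 xi : S xi <= (B * T) ^+ 2.
Proof.
rewrite -[leLHS]mul1r -(expr1n _ 2); apply: weighted_le => //; first exact: ltW.
- by move=> j; rewrite mul1r; have [[h1 _ _] _] := four_le j xi; exact: le_trans K1T.
- by move=> j; rewrite mul1r; have [_ [h1 _ _]] := four_le j xi; exact: le_trans K1T.
Qed.

Let S2 xi : `|xi| ^+ 2 * S xi <= B ^+ 2.
Proof.
rewrite -[B]mulr1; apply: weighted_le => //.
- by move=> j; rewrite mulr1; have [[_ h1 _] _] := four_le j xi; exact: le_trans K1C.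
- by move=> j; rewrite mulr1; have [_ [_ h1 _]] := four_le j xi; exact: le_trans K1C.
Qed.

Let S3 xi : `|xi| ^+ 4 * S xi <= B ^+ 2.
Proof.
rewrite -[B]mulr1 (_ : `|xi| ^+ 4 = (`|xi| ^+ 2) ^+ 2); last by rewrite -exprM.
apply: weighted_le; rewrite ?exprn_ge0//.
- by move=> j; rewrite mulr1; have [[_ _ h1] _] := four_le j xi; exact: le_trans K1C.
- by move=> j; rewrite mulr1; have [_ [_ _ h1]] := four_le j xi; exact: le_trans K1C.
Qed.

Let S_lower xi : 0 < xi <= 1 ->
  2 * h 0 j0 ^+ 2 * sin (T * xi) ^+ 2 - (8 * C * K) ^+ 2 * xi ^+ 2 <= xi ^+ 2 * S xi.
Proof.
move=> /andP[x0 _].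
have P_le : P j0 xi ^+ 2 <= S xi.
  rewrite SE (bigD1 j0)//= -addrA lerDl addr_ge0 ?sqr_ge0// sumr_ge0// => j _.
  by rewrite addr_ge0 ?sqr_ge0.
apply: (le_trans _ (ler_wpM2l (sqr_ge0 xi) P_le)).
have := plateau_cosT_approx C0 CT (ltW T1) (G j0) xi hK; rewrite -/(P j0).
rewrite (gtr0_norm x0); set d := _ - _ => Hd.
have Hd2 : d ^+ 2 <= (8 * C * K * xi) ^+ 2.
  rewrite -(real_normK (num_real d)) ler_pXn2r ?nnegrE//.
  by rewrite !mulr_ge0// ltW.
have E : xi * P j0 xi = d + 2 * h 0 j0 * sin (T * xi) by rewrite /d; ring.
have -> : xi ^+ 2 * P j0 xi ^+ 2 = (d + 2 * h 0 j0 * sin (T * xi)) ^+ 2.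
  by rewrite -E; ring.
(* Completing the square gives (d + 2 y)^2 >= 2 y^2 - d^2, which separates the main term from the
   error. *)
have Q0 : 0 <= 2 * (d + h 0 j0 * sin (T * xi)) ^+ 2 by rewrite mulr_ge0 ?sqr_ge0.
rewrite -subr_ge0.
have -> : (d + 2 * h 0 j0 * sin (T * xi)) ^+ 2 -
   (2 * h 0 j0 ^+ 2 * sin (T * xi) ^+ 2 - (8 * C * K) ^+ 2 * xi ^+ 2) =
   2 * (d + h 0 j0 * sin (T * xi)) ^+ 2 + ((8 * C * K * xi) ^+ 2 - d ^+ 2) by ring.
by apply: addr_ge0 => //; rewrite subr_ge0.
Qed.

Let bnormE : bnorm g = (\esum_(j in [set: int]) (shell_weight S j)%:E)%E.
Proof.
rewrite /bnorm; apply: eq_esum => j _.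
exact: (shell_weightE cS S0 S1 j).
Qed.

Let hnormE : hnorm g = ((\int[mu]_xi (`|xi| * S xi)%:E) `^ 2^-1)%E.
Proof. by []. Qed.

Lemma bnorm_le_log : 1 <= ln T ->
  (bnorm g <= (2 * B * ((ln 2)^-1 + 4) * ln T)%:E)%E.
Proof.
move=> L1; have l2 : 0 < ln 2 :> R by rewrite ln_gt0// ltr1n.
have L0 : 0 <= ln T / ln 2 by rewrite divr_ge0 ?(ltW l2)// (le_trans _ L1).
(* Then [n0 + 3] is at most log2 T + 4, and [1 <= ln T] absorbs the 4 into [4 * ln T]. *)
set n0 := (Num.truncn (ln T / ln 2)).+1.
have /andP[n1 n2] := Num.Theory.truncn_itv L0.
have Tn : T <= 2 ^+ n0.
  rewrite -ler_ln ?posrE ?exprn_gt0// lnXn// -[leRHS]mulr_natl -ler_pdivrMr//.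
  exact: ltW.
rewrite bnormE (le_trans (besov_le cS S0 B0 T0 S1 S2 S3 Tn))// lee_fin.
have B20 : 0 <= 2 * B by rewrite mulr_ge0// ltW.
rewrite -[leRHS]mulrA ler_wpM2l//.
rewrite /n0 -natr1 mulrDl [_^-1 * _]mulrC -addrA lerD// -[leRHS]mulr1.
by rewrite (_ : 1 + 3 = 4 * 1) ?mulr1 ?ler_peMr//; ring.
Qed.

Lemma hnorm_sqr_le_bnorm : (\int[mu]_xi (`|xi| * S xi)%:E <= (4 * B)%:E * bnorm g)%E.
Proof. rewrite bnormE; exact: (sobolev_le_besov cS S0 B0 S1 S2). Qed.

Lemma hnorm_sqr_ge_log : ((h 0 j0 ^+ 2 * ln T - (h 0 j0 ^+ 2 + (8 * C * K) ^+ 2))%:E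
  <= \int[mu]_xi (`|xi| * S xi)%:E)%E.
Proof. exact: (sobolev_ge cS S0 T0 T1 S_lower). Qed.

(** The last hypothesis lets half of the main term absorb the additive loss, hence the 1/2 in
    [ch]. *)
Lemma norms_log_bounds : 0 < h 0 j0 ^+ 2 -> 1 <= ln T ->
  h 0 j0 ^+ 2 + (8 * C * K) ^+ 2 <= h 0 j0 ^+ 2 / 2 * ln T ->
  let ch := h 0 j0 ^+ 2 / 2 in
  let cb := 2 * B * ((ln 2)^-1 + 4) in
  [/\ ((Num.sqrt ch * Num.sqrt (ln T))%:E <= hnorm g)%E,
      (hnorm g <= (Num.sqrt (4 * B * cb) * Num.sqrt (ln T))%:E)%E,
      ((ch / (4 * B) * ln T)%:E <= bnorm g)%E &
      (bnorm g <= (cb * ln T)%:E)%E].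
Proof.
move=> h0 L1 HL ch cb; have L0 : 0 <= ln T := le_trans ler01 L1.
have B40 : 0 < 4 * B by rewrite mulr_gt0.
have ch0 : 0 <= ch by rewrite /ch divr_ge0// ltW.
have l2 : 0 < ln 2 :> R by rewrite ln_gt0// ltr1n.
have cb0 : 0 <= cb by rewrite /cb mulr_ge0// ?mulr_ge0 ?addr_ge0 ?invr_ge0// ltW.
have low : ((ch * ln T)%:E <= \int[mu]_xi (`|xi| * S xi)%:E)%E.
  apply: le_trans hnorm_sqr_ge_log; rewrite lee_fin.
  by move: HL; rewrite /ch; lra.
have bn := bnorm_le_log L1.
have up : (\int[mu]_xi (`|xi| * S xi)%:E <= (4 * B * cb * ln T)%:E)%E.
  apply: (le_trans hnorm_sqr_le_bnorm).
  by rewrite -mulrA [leRHS]EFinM lee_wpmul2l ?lee_fin// ltW.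
rewrite hnormE; split=> //.
- by rewrite -sqrtrM// sqrt_le_poweR// mulr_ge0.
- rewrite -sqrtrM; last by rewrite mulr_ge0// ltW.
  apply: poweR_le_sqrt up.
  by apply: integral_ge0 => xi _; rewrite lee_fin mulr_ge0.
- have H := le_trans low hnorm_sqr_le_bnorm.
  rewrite mulrAC EFinM [(_^-1)%:E](_ : _ = ((4 * B)^-1)%:E)//.
  by rewrite muleC lee_pdivrMl.
Qed.

End PlateauSlices.

End Growth.

(** * Smoothness, support and size of the initial data *)

Section Data.
Context {R : realType}.

Lemma derive1n_scale (a : R) (f : R -> R) n : smooth f ->
  derive1n n (fun x => a * f x) = (fun x => a * derive1n n f x).
Proof.
elim: n f => [|n IH] f Sf; first by rewrite !derive1n0.
rewrite derive1Sn (_ : derive1 _ = (fun x => a * derive1 f x)).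
  by rewrite IH ?derive1Sn//; exact: smooth_derive.
apply: derive1_fun => x.
apply: (is_derive_eq (is_derive_mul (is_derive_constant a x 1) (smooth_is_derive x Sf))).
by rewrite mulr0 addr0.
Qed.

Let cos1 (C x : R) := cos (sigma C x) + - 1.
Let sin1 (C x : R) := sin (sigma C x).

Let cos1_smooth C : 0 < C -> smooth (cos1 C).
Proof.
move=> C0 n; apply: smoothnD; last exact: smoothn_cst.
by apply: smoothn_comp; [case: (@smoothn_sin_cos R n)|exact: sigma_smooth].
Qed.

Let sin1_smooth C : 0 < C -> smooth (sin1 C).
Proof.
move=> C0 n; apply: smoothn_comp; last exact: sigma_smooth.
by case: (@smoothn_sin_cos R n).
Qed.

Section Circle.
Variables (m : nat) (C : R) (C0 : 0 < C).

Lemma circle_data_sub_e1 (k x : R) : circle_data m C k x - e1 R m =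
  row3 (k * k * cos1 C x) (- (k * Num.sqrt (1 - k ^+ 2)) * cos1 C x) (k * sin1 C x).
Proof.
rewrite e1_row3 -scaleN1r row3Z row3D /cos1 /sin1.
by congr row3; ring.
Qed.

Lemma circle_data_smooth (k : R) : smooth_curve (circle_data m C k).
Proof.
have Sc := cos1_smooth C0; have Ss := sin1_smooth C0.
have E : circle_data m C k = (fun x => row3 (1 + k * k * cos1 C x)
   (- (k * Num.sqrt (1 - k ^+ 2)) * cos1 C x) (k * sin1 C x)).
  apply/funext => x; rewrite /circle_data /cos1 /sin1.
  by congr row3; ring.
rewrite E; apply: smooth_curve_row3 => n.
- apply: smoothnD; first exact: smoothn_cst.
  by apply: smoothnM; [exact: smoothn_cst|exact: Sc].
- by apply: smoothnM; [exact: smoothn_cst|exact: Sc].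
- by apply: smoothnM; [exact: smoothn_cst|exact: Ss].
Qed.

Lemma circle_data_support (k : R) :
  [set x | circle_data m C k x - e1 R m != 0] `<=` [set` `[- C, C]].
Proof.
move=> x /= H; rewrite in_itv /=.
have [xl|xl] := ltP x (- C).
  move: H; rewrite circle_data_sub_e1 /cos1 /sin1 sigma_left ?(ltW xl)// cos0 sin0.
  by rewrite subrr !mulr0 row30 eqxx.
have [//|xr] := leP x C.
move: H; rewrite circle_data_sub_e1 /cos1 /sin1 sigma_right ?(ltW xr)//.
by rewrite cos_2pi sin_2pi subrr !mulr0 row30 eqxx.
Qed.

(** Each coordinate is a profile depending on [C] alone times a coefficient of size at most [k], so
    the constants can be chosen before [k]. *)
Lemma circle_data_small : exists A : nat -> R, forall k : R, 0 < k < 1 ->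
  forall n x, 0 <= A n /\
    enorm (derive1n n (fun y => circle_data m C k y - e1 R m) x) <= A n * k.
Proof.
have Sc := cos1_smooth C0; have Ss := sin1_smooth C0.
have left0 y : y <= - C -> cos1 C y = 0.
  by move=> h; rewrite /cos1 sigma_left// cos0 subrr.
have right0 y : C <= y -> cos1 C y = 0.
  by move=> h; rewrite /cos1 sigma_right// cos_2pi subrr.
have left1 y : y <= - C -> sin1 C y = 0 by move=> h; rewrite /sin1 sigma_left// sin0.
have right1 y : C <= y -> sin1 C y = 0 by move=> h; rewrite /sin1 sigma_right// sin_2pi.
have [A1 H1] := smooth_eventually_cst_bounded Sc left0 right0.
have [A2 H2] := smooth_eventually_cst_bounded Ss left1 right1.
exists (fun n => A1 n + A1 n + A2 n) => k /andP[k0 k1] n x.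
have [a1 b1] := H1 n x; have [a2 b2] := H2 n x.
split; first by rewrite !addr_ge0.
have Sm (a : R) (f : R -> R) : smooth f -> smooth (fun x => a * f x).
  by move=> Sf j; apply: smoothnM; [exact: smoothn_cst|exact: Sf].
rewrite (_ : (fun y => _) = (fun x => row3 (k * k * cos1 C x)
   (- (k * Num.sqrt (1 - k ^+ 2)) * cos1 C x) (k * sin1 C x))); last first.
  by apply/funext => y; rewrite circle_data_sub_e1.
rewrite derive1n_row3; [|exact: Sm|exact: Sm|exact: Sm].
rewrite !derive1n_scale//.
apply: (le_trans (enorm_row3_le _ _ _ _)).
have ka1 : Num.sqrt (1 - k ^+ 2) <= 1.
  by rewrite -[leRHS]sqrtr1 ler_wsqrtr// lerBlDr lerDl sqr_ge0.
rewrite !normrM normrN normrM (gtr0_norm k0) (ger0_norm (sqrtr_ge0 _)) !mulrDl.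
rewrite lerD// ?lerD//.
- rewrite [leRHS]mulrC ler_pM ?mulr_ge0 ?(ltW k0)//.
  by rewrite ler_piMr// ltW.
- rewrite [leRHS]mulrC ler_pM ?mulr_ge0 ?sqrtr_ge0 ?(ltW k0)//.
  by rewrite ler_piMr// ltW.
- by rewrite [leRHS]mulrC ler_wpM2l// ltW.
Qed.

End Circle.

End Data.

(** * From time slices to growth at infinity *)

Section LogGrowth.
Context {R : realType}.
Local Notation ex := ((0, 1) : R * R).

(** Subtracting e1 costs 1 in the bound, hence [K + 1]. *)
Lemma slice_plateau m (phi : R * R -> 'rV[R]_m) (C K T : R) (h : 'rV[R]_m) :
  smooth_field phi -> 0 <= T ->
  (forall p j, [/\ `|phi p 0 j| <= K, `|dx phi p 0 j| <= K & `|dx (dx phi) p 0 j| <= K]) ->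
  (forall x : R, (`|x| <= T - C -> slice phi T x = h) /\
     (T + C <= `|x| -> slice phi T x = 0)) ->
  forall j, plateau C (K + 1) T (h 0 j) (fun x => slice phi T x 0 j)
    (fun x => dx phi (T, x) 0 j) (fun x => dx (dx phi) (T, x) 0 j).
Proof.
move=> Sphi T0 bnd H j.
have comp (F : R * R -> 'rV[R]_m) (x : R) : Ck 1 F ->
    is_derive x (1 : R) (fun y => F (T, y) 0 j) (dx F (T, x) 0 j).
  case=> _ D _ _; apply: (@is_derive_slice_x _ (fun q => F q 0 j)).
  exact: (is_derive_row F (T, x) ex _).1 (derivableP (D (T, x)).2) j.
have dxS n (F : R * R -> 'rV[R]_m) (HF : Ck n.+1 F) : Ck n (dx F) :=
  let: And4 _ _ _ H' := HF in H'.
split.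
- move=> x; have D := comp phi x (Sphi 1%N).
  have D' := is_derive_sub D (is_derive_constant (e1 R m 0 j) x 1).
  rewrite subr0 in D'; apply: is_derive_ext D' => y.
  by rewrite /slice !mxE.
- by move=> x; exact: comp (dxS _ _ (Sphi 2)).
- exact: is_derive_continuous (fun x => comp _ x (dxS _ _ (dxS _ _ (Sphi 3)))).
- move=> x; have [b0 b1 b2] := bnd (T, x) j; split.
  + rewrite /slice !mxE (le_trans (ler_normB _ _))// lerD//.
    by case: eqP => _; rewrite ?normr1 ?normr0.
  + by rewrite (le_trans b1)// lerDl.
  + by rewrite (le_trans b2)// lerDl.
- by split=> x hx; [rewrite (H x).1|rewrite (H x).2// mxE].
Qed.

Lemma ge_log_cvg (F : R -> \bar R) (c : R) (G : R -> R) (T0 : R) : 0 < c ->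
  (forall T, T0 <= T -> ((c * G T)%:E <= F T)%E) ->
  (forall M : R, exists T1, forall T, T1 <= T -> M <= G T) ->
  F T @[T --> +oo] --> +oo%E.
Proof.
move=> c0 HF HG; apply/cvgeyPge => M.
have [T1 H1] := HG (M / c).
near=> T; apply: (@le_trans _ _ (c * G T)%:E).
  rewrite lee_fin mulrC -ler_pdivrMr//; apply: H1.
  by near: T; apply: nbhs_pinfty_ge; exact: num_real.
by apply: HF; near: T; apply: nbhs_pinfty_ge; exact: num_real.
Unshelve. all: by end_near. Qed.

Lemma ln_unbounded (M : R) : exists T1 : R, forall T, T1 <= T -> M <= ln T.
Proof.
exists (expR M) => T MT; have T0 : 0 < T := lt_le_trans (expR_gt0 M) MT.
by rewrite -ler_expR lnK.
Qed.

Lemma sqrt_ln_unbounded (M : R) : exists T1 : R, forall T, T1 <= T -> M <= Num.sqrt (ln T).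
Proof.
have [T1 H] := ln_unbounded (M ^+ 2); exists T1 => T /H MT.
by rewrite (le_trans (ler_norm M))// -sqrtr_sqr ler_wsqrtr.
Qed.

End LogGrowth.

Theorem theorem1p3 (R : realType) (m : nat) (hm : (2 < m)%N)
    (C : R) (hC : 0 < C) :
  exists A : nat -> R, forall eps : R, 0 < eps ->
  exists f : R -> 'rV[R]_m,
    [/\ smooth_curve f,
        forall x, enorm (f x) = 1,
        [set x | f x - e1 R m != 0] `<=` [set` `[- C, C]] &
        forall (k : nat) (x : R),
          enorm (derive1n k (fun y => f y - e1 R m) x) <= A k * eps] /\
  exists phi : R * R -> 'rV[R]_m,
    [/\ unique (wave_map_solution f) phi,
        forall p, enorm (phi p) = 1,
        hnorm (slice phi T) @[T --> +oo] --> +oo%E,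
        bnorm (slice phi T) @[T --> +oo] --> +oo%E &
        exists c c' T0 : R,
          [/\ 0 < c, c <= c', 1 < T0 &
              forall T : R, T0 <= T ->
                ((c * Num.sqrt (ln T))%:E
                   <= hnorm (slice phi T)
                   <= (c' * Num.sqrt (ln T))%:E)%E /\
                ((c * ln T)%:E
                   <= bnorm (slice phi T)
                   <= (c' * ln T)%:E)%E]].
Proof.
have [A HA] := circle_data_small m hC.
exists A => eps eps0.
(* The modulus must stay below 1, so a large [eps] is capped. *)
pose k := Num.min eps 2^-1.
have k01 : 0 < k < 1.
  rewrite lt_min eps0 invr_gt0 ltr0n /= gt_min; apply/orP; right.
  by rewrite invf_lt1// ltr1n.
have keps : k <= eps by rewrite ge_min lexx.
have [s [c [w [D sc ws [w0 s0 c0 spi]]]]] := jacobi_functions k01.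
have [phi [Hphi norm1 [K HK] [h [h0 Hh]]]] :=
  explicit_solution hm hC k01 D sc ws w0 s0 c0 spi.
have [Sphi _ init _] := Hphi.
exists (circle_data m C k); split.
  split.
  - exact: circle_data_smooth.
  - by move=> x; rewrite -init.
  - exact: circle_data_support.
  - move=> n x; have [A0 An] := HA k k01 n x.
    by rewrite (le_trans An)// ler_wpM2l.
exists phi.
set j0 := Ordinal _ in h0.
have K0 : 0 <= K by have [+ _ _] := HK (0, 0) j0; exact: le_trans.
have K10 : 0 < K + 1 by rewrite ltr_wpDl.
have h20 : 0 < h 0 j0 ^+ 2 by rewrite exprn_even_gt0.
have plat T : 0 <= T -> forall j, plateau C (K + 1) T (h 0 j)
    (fun x => slice phi T x 0 j) (fun x => dx phi (T, x) 0 j)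
    (fun x => dx (dx phi) (T, x) 0 j).
  by move=> T0; apply: slice_plateau => // x; exact: Hh.
have hK : `|h 0 j0| <= K + 1.
  (* At time [C] the guaranteed plateau is the single point 0, enough to read [h] off as a value of
     the slice. *)
  have [_ _ _ bd [pl _]] := plat C (ltW hC) j0.
  by rewrite -(pl 0); [case: (bd 0)|rewrite normr0 subrr].
pose B := spectral_bound m C (K + 1).
pose ch := h 0 j0 ^+ 2 / 2.
pose cb := 2 * B * ((ln 2)^-1 + 4).
pose E := h 0 j0 ^+ 2 + (8 * C * (K + 1)) ^+ 2.
have E0 : 0 < E by rewrite /E ltr_wpDr ?sqr_ge0.
have ch0 : 0 < ch by rewrite /ch divr_gt0.
(* The logarithm then exceeds both 1 and [E / ch], while [1 + y <= expR y] puts [T] above [C] and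
   1. *)
pose T0 := expR (1 + C + E / ch).
have Ech : 0 < E / ch by rewrite divr_gt0.
have big T : T0 <= T -> [/\ C < T, 1 < T, 1 <= ln T & E <= ch * ln T].
  move=> TT; have Tpos : 0 < T := lt_le_trans (expR_gt0 _) TT.
  have lT : 1 + C + E / ch <= ln T by rewrite -ler_expR lnK.
  have T1 : 1 + (1 + C + E / ch) <= T := le_trans (expR_ge1Dx _) TT.
  split; [by lra|by lra|by lra|].
  by rewrite mulrC -ler_pdivrMr//; lra.
have bounds T : T0 <= T ->
  [/\ ((Num.sqrt ch * Num.sqrt (ln T))%:E <= hnorm (slice phi T))%E,
      (hnorm (slice phi T) <= (Num.sqrt (4 * B * cb) * Num.sqrt (ln T))%:E)%E,
      ((ch / (4 * B) * ln T)%:E <= bnorm (slice phi T))%E &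
      (bnorm (slice phi T) <= (cb * ln T)%:E)%E].
  move=> /big[CT T1 L1 EL]; have T00 : 0 <= T by rewrite (le_trans ler01)// ltW.
  exact: (norms_log_bounds hC CT T1 K10 (plat T T00) hK h20 L1 EL).
have B0 : 0 < B.
  have m0 : 0 < m%:R :> R by rewrite ltr0n (leq_trans _ hm).
  by rewrite /B /spectral_bound !mulr_gt0// addr_gt0.
have c1 : 0 < Num.sqrt ch by rewrite sqrtr_gt0.
have c2 : 0 < ch / (4 * B) by rewrite divr_gt0// mulr_gt0.
split.
- by split=> // psi Hpsi; exact: wave_map_unique Hphi Hpsi.
- exact: norm1.
- by apply: (ge_log_cvg c1 _ sqrt_ln_unbounded (T0 := T0)) => T /bounds[].
- by apply: (ge_log_cvg c2 _ ln_unbounded (T0 := T0)) => T /bounds[].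
pose cl := Num.min (Num.sqrt ch) (ch / (4 * B)).
(* Putting [cl] into the maximum makes [c <= c'] immediate. *)
exists cl, (Num.max cl (Num.max (Num.sqrt (4 * B * cb)) cb)), T0; split.
- by rewrite lt_min c1.
- by rewrite le_max lexx.
- by have [] := big T0 (lexx _).
move=> T TT; have [b1 b2 b3 b4] := bounds T TT; have [_ _ L1 _] := big T TT.
have L0 : 0 <= ln T by rewrite (le_trans ler01).
split; apply/andP; split.
- by apply: le_trans b1; rewrite lee_fin ler_wpM2r ?sqrtr_ge0// ge_min lexx.
- by apply: (le_trans b2); rewrite lee_fin ler_wpM2r ?sqrtr_ge0// !le_max lexx !orbT.
- by apply: le_trans b3; rewrite lee_fin ler_wpM2r// ge_min lexx orbT.
- by apply: (le_trans b4); rewrite lee_fin ler_wpM2r// !le_max lexx !orbT.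
Qed.
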